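(* Let $(\mathbb{Z},E)$ be a pseudo-free self-similar graph, where $E$ is a source-free, finite directed graph, and write $\mathbb{Z}=\langle a\rangle$ multiplicatively. Assume additionally that the following conditions hold: (1) For any $x\in E^\infty$ and $g\in\mathbb{Z}$, $x$ is either $g$-generic or $g$-rare. (2) For any cycle $C$ in $E$ with no entrance, if $p$ is the minimal positive integer such that $a^p$ fixes a vertex on $C$, we have $a^p|_C\ne a^{\pm p}$ (i.e. $a^p|_C\ne a^p$ and $a^p|_C\ne a^{-p}$). Then $C^*_r(\mathcal{S}_{\mathrm{sym}})$ is a Cartan subalgebra of $C^*_r(\mathcal{G}_{\mathbb{Z},E})$.
   Context: Graphs. $\mathbb{N}=\{0,1,2,\dots\}$. A directed graph $E=(E^0,E^1,r,s)$ has vertex set $E^0$, edge set $E^1$, range and source maps $r,s\colon E^1\to E^0$. It is finite if $E^0,E^1$ are finite, and source-free if every vertex is the range of some edge. A path of length $n\ge1$ is a word $e_1\cdots e_n$ of edges with $s(e_i)=r(e_{i+1})$, with range $r(e_1)$ and source $s(e_n)$; vertices are the paths of length $0$. $E^*$ is the set of finite paths, $|\mu|$ the length. $E^\infty$ is the set of infinite paths $x=e_1e_2\cdots$ ($s(e_i)=r(e_{i+1})$), $r(x)=r(e_1)$; $x(m,n)=e_{m+1}\cdots e_n$ for $m<n$, $x(n,n)=r(e_{n+1})$. $vE^\infty$ is the set of infinite paths with range $v$, $\mu E^\infty=\{\mu x:x\in s(\mu)E^\infty\}$; $E^\infty$ has the topology generated by the sets $\mu E^\infty$. A cycle is a path $C=\mu_1\cdots\mu_k$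 ($k\ge1$, $\mu_i\in E^1$) with $r(C)=s(C)$; it has no entrance if $e\in E^1$, $r(e)=r(\mu_i)$ for some $i$ implies $e=\mu_i$. Self-similar graph $(G,E)$ ($G$ a countable discrete group with identity $1_G$; here $G=\mathbb{Z}$): $G$ acts on $E^*$ by bijections preserving lengths and commuting with $r,s$, with a restriction map $G\times E^*\to G$, $(g,\mu)\mapsto g|_\mu$, such that $(gh)|_\mu=g|_{h\cdot\mu}h|_\mu$; $g|_v=g$ for $v\in E^0$; $1_G|_\mu=1_G$; $g|_{\mu\nu}=g|_\mu|_\nu$ and $g\cdot(\mu\nu)=(g\cdot\mu)(g|_\mu\cdot\nu)$ whenever $s(\mu)=r(\nu)$. The action extends to $E^\infty$ by $(g\cdot x)(p,q)=g|_{x(0,p)}\cdot x(p,q)$, and $g|_x\colon\mathbb{N}\to G$ is $p\mapsto g|_{x(0,p)}$. $(G,E)$ is pseudo-free if $g\cdot\mu=\mu$ and $g|_\mu=1_G$ imply $g=1_G$. Generic/rare. $x\in E^\infty$ is $g$-generic if either $g\cdot x\ne x$, or $g$ pointwise fixes a neighborhood of $x$. It is $g$-rare if $g\cdot x=x$ and there exists $N\in\mathbb{N}$ such that $g$ does not pointwise fix any neighborhood of any $z\in x(0,N)E^\infty$. Groupoid. $Q(\mathbb{N},G)$ is the group of functions $\mathbb{N}\to G$ (pointwise product) modulo eventual equality, $[f]$ the class of $f$. For $n\in\mathbb{Z}$, $\mathcal{T}_n(f)(p)=f(p-n)$ if $p\ge n$ and $1_G$ otherwise, inducing an automorphism $\mathcal{T}_n$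 of $Q(\mathbb{N},G)$. Then $$\mathcal{G}_{G,E}=\{(\mu(g\cdot x);\mathcal{T}_{|\mu|}([g|_x]),|\mu|-|\nu|;\nu x): g\in G,\ \mu,\nu\in E^*,\ s(\mu)=g\cdot s(\nu),\ x\in s(\nu)E^\infty\}$$ with $r(x;[f],k;y)=(x;[1_G],0;x)$, $s(x;[f],k;y)=(y;[1_G],0;y)$, product $(x;[f],k;y)(y;[h],l;z)=(x;[f]\mathcal{T}_k([h]),k+l;z)$, inverse $(y;\mathcal{T}_{-k}([f]^{-1}),-k;x)$. Its topology is generated by the cylinder sets $\mathcal{Z}(\mu,g,\nu)=\{(\mu(g\cdot x);\mathcal{T}_{|\mu|}([g|_x]),|\mu|-|\nu|;\nu x):x\in s(\nu)E^\infty\}$ with $s(\mu)=g\cdot s(\nu)$; for pseudo-free $(G,E)$ it is a second-countable Hausdorff ample groupoid. Cycline triples. $(\mu,g,\nu)$ is a cycline triple if $s(\mu)=g\cdot s(\nu)$ and $\mu(g\cdot x)=\nu x$ for all $x\in s(\nu)E^\infty$; it is symmetric if $\mu=\nu$. $\mathcal{S}_{\mathrm{sym}}$ is the union of the sets $\mathcal{Z}(\mu,g,\mu)$ over all symmetric cycline triples (an open subgroupoid of $\mathcal{G}_{G,E}$). For an open subgroupoid $\mathcal{S}$ of $\mathcal{G}$, $C^*_r(\mathcal{S})$ is viewed as a subalgebra of $C^*_r(\mathcal{G})$ by extending functions by zero. A Cartan subalgebra is a maximal abelian subalgebra that is regular (its normalizers generate) and admits a faithful conditional expectation onto it. *)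

(* Defs.v *)
From HB Require Import structures.
From mathcomp Require Import all_boot all_order all_algebra.
From mathcomp Require Import complex.
From mathcomp Require Import all_classical all_reals all_analysis.

Set Implicit Arguments.
Unset Strict Implicit.
Unset Printing Implicit Defensive.

Import Order.TTheory GRing.Theory Num.Theory.
Import numFieldNormedType.Exports.

Local Open Scope classical_set_scope.
Local Open Scope ring_scope.

Record graph := Graph {
  vertex : finType;
  edge : finType;
  rge : edge -> vertex;
  sce : edge -> vertex }.

Definition source_free (E : graph) : Prop :=
  forall v : vertex E, exists e : edge E, rge e = v.

Section Paths.
Variable E : graph.

(* A finite path is a pair of its range and its word of edges; a vertex [v] is
   the path [(v, [::])], and for a nonempty word the first component is
   determined by the word (see [is_path]). *)
Definition rawpath : Type := (vertex E * seq (edge E))%type.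

Definition is_path (mu : rawpath) : bool :=
  if mu.2 is e :: w
  then (rge e == mu.1) && path (fun e1 e2 => sce e1 == rge e2) e w
  else true.

Definition vtx (v : vertex E) : rawpath := (v, [::]).
Definition plen (mu : rawpath) : nat := size mu.2.
Definition prng (mu : rawpath) : vertex E := mu.1.
Definition psrc (mu : rawpath) : vertex E := last mu.1 [seq sce e | e <- mu.2].
Definition pcat (mu nu : rawpath) : rawpath := (mu.1, mu.2 ++ nu.2).

Definition is_cycle (C : rawpath) : Prop :=
  [/\ is_path C, (0 < plen C)%N & prng C = psrc C].

Definition no_entrance (C : rawpath) : Prop :=
  forall e f : edge E, f \in C.2 -> rge e = rge f -> e = f.

Definition on_cycle (C : rawpath) (v : vertex E) : bool :=
  v \in [seq rge f | f <- C.2].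

(* Edges of infinite paths are indexed from 0. *)
Definition infword : Type := nat -> edge E.

Definition is_ipath (x : infword) : Prop := forall i, sce (x i) = rge (x i.+1).
Definition irng (x : infword) : vertex E := rge (x 0%N).

(* The segment x(m,n), for m <= n. *)
Definition iseg (x : infword) (m n : nat) : rawpath :=
  (rge (x m), [seq x i | i <- iota m (n - m)]).

(* Outside the range of the word, [nth] returns its default. *)
Definition icat (mu : rawpath) (x : infword) : infword :=
  fun i => nth (x (i - plen mu)%N) mu.2 i.

Definition cylinder (mu : rawpath) : set infword :=
  [set icat mu x | x in [set x | is_ipath x /\ irng x = psrc mu]].

HB.instance Definition _ := gen_eqMixin infword.
HB.instance Definition _ := gen_choiceMixin infword.
(* Infinite paths form an open subset of [infword] for this topology. *)
HB.instance Definition _ := isSubBaseTopological.Build infword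
  [set cylinder mu | mu in [set mu | is_path mu]] id.

End Paths.

(* Self-similar actions of the infinite cyclic group <a>: the element a^n is
   represented by n : int, so the group law is addition and the unit is 0.
   Only values at [is_path] arguments are meaningful. *)
Record self_similar (E : graph) := SelfSimilar {
  act : int -> rawpath E -> rawpath E;
  restr : int -> rawpath E -> int;
  act_path : forall g mu, is_path mu -> is_path (act g mu);
  act0 : forall mu, is_path mu -> act 0 mu = mu;
  actD : forall g h mu, is_path mu -> act (g + h) mu = act g (act h mu);
  act_len : forall g mu, is_path mu -> plen (act g mu) = plen mu;
  act_rng : forall g mu, is_path mu ->
    vtx (prng (act g mu)) = act g (vtx (prng mu));
  act_src : forall g mu, is_path mu ->
    vtx (psrc (act g mu)) = act g (vtx (psrc mu));
  restrD : forall g h mu, is_path mu ->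
    restr (g + h) mu = restr g (act h mu) + restr h mu;
  restr_vtx : forall g v, restr g (vtx v) = g;
  restr0 : forall mu, is_path mu -> restr 0 mu = 0;
  restr_cat : forall g mu nu, is_path mu -> is_path nu -> psrc mu = prng nu ->
    restr g (pcat mu nu) = restr (restr g mu) nu;
  act_cat : forall g mu nu, is_path mu -> is_path nu -> psrc mu = prng nu ->
    act g (pcat mu nu) = pcat (act g mu) (act (restr g mu) nu) }.

(* The quotient of the functions nat -> int by eventual equality. *)
Section EventualEquality.

Definition eveq (f h : nat -> int) : bool := `[< \forall n \near \oo, f n = h n >].

Lemma eveq_refl : reflexive eveq.
Proof. by move=> f; apply/asboolP; apply: nearW. Qed.

Lemma eveq_sym : symmetric eveq.
Proof.
by move=> f h; apply/idP/idP => /asboolP fh; apply/asboolP;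
  apply: filterS fh => n.
Qed.

Lemma eveq_trans : transitive eveq.
Proof.
move=> h f k /asboolP fh /asboolP hk; apply/asboolP.
by apply: filterS2 fh hk => n -> ->.
Qed.

Canonical eveq_equiv := EquivRel eveq eveq_refl eveq_sym eveq_trans.

Definition qgroup : Type := {eq_quot eveq}%qT.
HB.instance Definition _ := Choice.on qgroup.
HB.instance Definition _ := EqQuotient.on qgroup.

Definition qclass (f : nat -> int) : qgroup := \pi_qgroup%qT f.
Definition qone : qgroup := qclass (fun _ => 0).
Definition qmul (a b : qgroup) : qgroup := qclass (fun p => repr a p + repr b p).
Definition qinv (a : qgroup) : qgroup := qclass (fun p => - repr a p).

Definition tshift (n : int) (f : nat -> int) : nat -> int :=
  fun p => if n <= p%:Z then f `|p%:Z - n|%N else 0.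
Definition qshift (n : int) (a : qgroup) : qgroup := qclass (tshift n (repr a)).

End EventualEquality.

Section SelfSimilar.
Variables (E : graph) (X : self_similar E).

Definition pseudo_free : Prop :=
  forall (g : int) (mu : rawpath E), is_path mu ->
    act X g mu = mu -> restr X g mu = 0 -> g = 0.

Definition irestr (g : int) (x : infword E) : nat -> int :=
  fun p => restr X g (iseg x 0 p).

(* The edge (g.x)(n,n+1) = g|_{x(0,n)} . x(n,n+1). *)
Definition iact (g : int) (x : infword E) : infword E :=
  fun n => head (x n) (act X (irestr g x n) (iseg x n n.+1)).2.

Definition fixes_nbhd (g : int) (x : infword E) : Prop :=
  \forall y \near x, is_ipath y -> iact g y = y.

Definition generic (g : int) (x : infword E) : Prop :=
  iact g x <> x \/ fixes_nbhd g x.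

Definition rare (g : int) (x : infword E) : Prop :=
  iact g x = x /\
  exists N : nat, forall z, cylinder (iseg x 0 N) z -> ~ fixes_nbhd g z.

End SelfSimilar.

(* A groupoid with arrows in an ambient type; [gmul alpha beta] is meaningful
   when [gsrc alpha = grng beta]. *)
Record groupoid_data (T : Type) := GroupoidData {
  arrows : set T;
  grng : T -> T;
  gsrc : T -> T;
  gmul : T -> T -> T;
  ginv : T -> T }.

(* The quadruple (x; q, k; y); the type depends on [X] because its topology
   does. *)
Record quad (E : graph) (X : self_similar E) := Quad {
  qrng : infword E;
  qcls : qgroup;
  qdeg : int;
  qsrc : infword E }.

Section SelfSimilarGroupoid.
Variables (E : graph) (X : self_similar E).
Local Notation quad := (quad X).
Local Notation Quad := (@Quad E X).

Definition zelt (mu : rawpath E) (g : int) (nu : rawpath E) (x : infword E) :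
    quad :=
  Quad (icat mu (iact X g x)) (qshift (plen mu)%:Z (qclass (irestr X g x)))
    ((plen mu)%:Z - (plen nu)%:Z) (icat nu x).

Definition zcyl (mu : rawpath E) (g : int) (nu : rawpath E) : set quad :=
  [set zelt mu g nu x | x in [set x | is_ipath x /\ irng x = psrc nu]].

Definition admissible (mu : rawpath E) (g : int) (nu : rawpath E) : Prop :=
  [/\ is_path mu, is_path nu & vtx (psrc mu) = act X g (vtx (psrc nu))].

Definition cycline (mu : rawpath E) (g : int) (nu : rawpath E) : Prop :=
  admissible mu g nu /\
  forall x, is_ipath x -> irng x = psrc nu -> icat mu (iact X g x) = icat nu x.

Definition ssg_groupoid : groupoid_data quad := {|
  arrows := [set gam | exists mu g nu, admissible mu g nu /\ zcyl mu g nu gam];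
  grng := fun a => Quad (qrng a) qone 0 (qrng a);
  gsrc := fun a => Quad (qsrc a) qone 0 (qsrc a);
  gmul := fun a b =>
    Quad (qrng a) (qmul (qcls a) (qshift (qdeg a) (qcls b))) (qdeg a + qdeg b)
      (qsrc b);
  ginv := fun a =>
    Quad (qsrc a) (qshift (- qdeg a) (qinv (qcls a))) (- qdeg a) (qrng a) |}.

Definition Ssym : set quad :=
  [set gam | exists mu g, cycline mu g mu /\ zcyl mu g mu gam].

HB.instance Definition _ := gen_eqMixin quad.
HB.instance Definition _ := gen_choiceMixin quad.
HB.instance Definition _ := isSubBaseTopological.Build quad
  [set U | exists mu g nu, admissible mu g nu /\ U = zcyl mu g nu] id.

End SelfSimilarGroupoid.

Arguments zelt [E] X mu g nu x.
Arguments zcyl [E] X mu g nu.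
Arguments ssg_groupoid [E] X.
Arguments Ssym [E] X.

(* The Hilbert space l^2(D) consists of square-summable functions T -> C
   vanishing off D, and operators on it are extended by 0 to all functions
   T -> C, so that two bounded operators agree iff they are equal. *)
Section Hilbert.
Variables (R : realType) (T : choiceType) (D : set T).

Definition vec : Type := T -> R[i].
Definition operator : Type := vec -> vec.

Definition sqnorm (xi : vec) : \bar R :=
  (\esum_(t in D) (ComplexField.Normc.normc (xi t) ^+ 2)%:E)%R.

Definition ell2 : set vec :=
  [set xi | (forall t, ~ D t -> xi t = 0) /\ (sqnorm xi < +oo)%E].

Definition l2norm (xi : vec) : R := Num.sqrt (fine (sqnorm xi)).

(* Sums of absolutely summable families. *)
Definition rsum (f : T -> R) : R :=
  fine (\esum_(t in D) (Num.max (f t) 0)%:E)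
  - fine (\esum_(t in D) (Num.max (- f t) 0)%:E).
Definition csum (f : T -> R[i]) : R[i] :=
  (rsum (fun t => complex.Re (f t)) +i* rsum (fun t => complex.Im (f t)))%C.

Definition inner (xi eta : vec) : R[i] :=
  csum (fun t => xi t * ((eta t)^*)%C).

Definition opzero : operator := fun _ _ => 0.
Definition oplin (a : R[i]) (A B : operator) : operator :=
  fun xi t => a * A xi t + B xi t.

Definition bounded_op (A : operator) : Prop :=
  [/\ forall xi, ~ ell2 xi -> A xi = (fun _ => 0),
      forall xi, ell2 xi -> ell2 (A xi),
      forall (a : R[i]) xi eta, ell2 xi -> ell2 eta ->
        A (fun t => a * xi t + eta t) = (fun t => a * A xi t + A eta t) &
      exists M : R, forall xi, ell2 xi -> l2norm (A xi) <= M * l2norm xi].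

Definition opnorm (A : operator) : R :=
  sup [set l2norm (A xi) | xi in [set xi | ell2 xi /\ l2norm xi <= 1]].

Definition opclosure (S : set operator) : set operator :=
  [set A | bounded_op A /\
    forall eps : R, 0 < eps -> exists2 B, S B & opnorm (oplin (-1) B A) <= eps].

Definition is_adjoint (A B : operator) : Prop :=
  bounded_op B /\
  forall xi eta, ell2 xi -> ell2 eta -> inner (A xi) eta = inner xi (B eta).

Definition adj (A : operator) : operator := xget opzero [set B | is_adjoint A B].

Definition positive_op (A : operator) : Prop :=
  forall xi, ell2 xi -> 0 <= inner (A xi) xi.

Definition Cstar_algebra (S : set operator) : Prop :=
  [/\ S `<=` bounded_op,
      S opzero,
      forall (a : R[i]) A B, S A -> S B -> S (oplin a A B),
      forall A B, S A -> S B -> S (A \o B) &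
      (forall A, S A -> S (adj A)) /\ opclosure S `<=` S].

Definition abelian_ops (S : set operator) : Prop :=
  forall A B, S A -> S B -> A \o B = B \o A.

Definition maximal_abelian (A B : set operator) : Prop :=
  [/\ B `<=` A, Cstar_algebra B, abelian_ops B &
      forall M, Cstar_algebra M -> M `<=` A -> abelian_ops M -> B `<=` M ->
        M = B].

Definition normalizer (A B : set operator) : set operator :=
  [set n | A n /\ forall b, B b -> B (n \o b \o adj n) /\ B (adj n \o b \o n)].

Definition regular (A B : set operator) : Prop :=
  smallest Cstar_algebra (normalizer A B) = A.

Definition cond_expectation (A B : set operator) (P : operator -> operator) :
    Prop :=
  [/\ forall a, A a -> B (P a),
      forall b, B b -> P b = b,
      forall (c : R[i]) a a', A a -> A a' ->
        P (oplin c a a') = oplin c (P a) (P a'),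
      forall b a b', B b -> A a -> B b' -> P (b \o a \o b') = b \o P a \o b' &
      (forall a, A a -> positive_op a -> positive_op (P a)) /\
      (forall a, A a -> opnorm (P a) <= opnorm a)].

Definition faithful (A : set operator) (P : operator -> operator) : Prop :=
  forall a, A a -> P (adj a \o a) = opzero -> a = opzero.

Definition Cartan (A B : set operator) : Prop :=
  [/\ maximal_abelian A B, regular A B &
      exists2 P, cond_expectation A B P & faithful A P].

End Hilbert.

Section ReducedAlgebra.
Variables (R : realType) (T : topologicalType) (G : groupoid_data T).

(* C_c(S), for S open in the arrow space, extended by zero. *)
Definition Cc (S : set T) : set (T -> R[i]) :=
  [set f | [/\ forall gam, ~ S gam -> f gam = 0,
               {within S, continuous (f : T -> R[i]^o)} &
               compact (S `&` closure [set gam | f gam != 0])]].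

(* Convolution, (f * xi)(gam) = sum of f(alpha) xi(alpha^-1 gam) over the alpha
   with the range of gam; for f in C_c(G) only finitely many terms are nonzero. *)
Definition convolve (f xi : T -> R[i]) : T -> R[i] := fun gam =>
  if gam \in arrows G then
    \sum_(al \in [set al | arrows G al /\ grng G al = grng G gam])
      f al * xi (gmul G (ginv G al) gam)
  else 0.

(* The regular representation on l^2(G), that is, the direct sum over the units
   u of the representations on l^2(G_u). *)
Definition lreg (f : T -> R[i]) : operator R T := fun xi =>
  if xi \in ell2 (arrows G) then convolve f xi else (fun _ => 0).

(* C*_r(S) inside C*_r(G), for an open subgroupoid S of G. *)
Definition Cred_sub (S : set T) : set (operator R T) :=
  opclosure (arrows G) [set lreg f | f in Cc S].

Definition Cred : set (operator R T) := Cred_sub (arrows G).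

End ReducedAlgebra.

Arguments Cred_sub R [T] G S.
Arguments Cred R [T] G.

(* Main.v *)
Require Import Defs.
From mathcomp Require Import all_boot all_order all_algebra finmap complex.
From mathcomp Require Import all_classical all_reals all_analysis.
From mathcomp Require Import zify ring lra.
Set Implicit Arguments.
Unset Strict Implicit.
Unset Printing Implicit Defensive.
Import Order.TTheory GRing.Theory Num.Theory.
Import ComplexField.Normc.
Import numFieldNormedType.Exports.
Local Open Scope classical_set_scope.
Local Open Scope ring_scope.

(** The proof has an analytic half, valid for ample groupoids, and a combinatorial
    half about paths.

    Analytic half. Let [G] be a groupoid whose topology has a base of compact open
    bisections, and let [S] be an open subgroupoid, closed in [G], containing the
    units, contained in the isotropy, commutative and normal. Compressing an
    operator on l^2(G) to the cosets of [S] is a contraction that is positive and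
    faithful for trivial reasons, and it sends convolution by [f] to convolution by
    the restriction of [f] to [S]; this is the conditional expectation
    ([compress_expectation]). Functions carried by one bisection are normalizers,
    as [S] is normal, and they span a dense subspace ([subalgebra_regular]). Let [x]
    commute with C*_r(S). Commuting with functions on the units confines the
    coefficients of [x] to the isotropy, and by continuity to its interior. If this
    interior were [S], one could stop here. In general it suffices that an interior
    isotropy arrow outside [S] sits over an isolated unit and has infinitely many
    [S]-conjugates: the coefficients of [x] are constant on the conjugates and
    square summable, hence vanish there ([coefficient_support]).

    Combinatorial half. Pseudo-freeness makes two cylinder sets with the same
    source prefix equal or disjoint ([zelt_inj]); the cylinder sets thus form a base
    of compact open bisections ([ssg_ample]). The subgroupoid [Ssym] is the interior
    of the isotropy of degree zero ([SsymP]), whence it is an open normal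
    subgroupoid, commutative because the integers are. It is closed because every
    path is generic or rare ([Ssym_closed]). An interior isotropy arrow outside it
    comes from a cycline triple with prefixes of different lengths. Such a triple
    yields an equation [x = m (g x)] for all [x] with a given range, so there is a
    single such [x], and it ends in a cycle without entrance
    ([cycline_lonely], [lonely_cycle]). Let [a^p] generate the stabilizer of a vertex
    of this cycle, and let [a^(p c)] be its restriction along the cycle. The
    restrictions of [a^p] along the path are then the powers with exponents
    [p c^j]. Pseudo-freeness gives [c <> 0] and the hypothesis on cycles gives
    [c <> 1] and [c <> -1], so that this sequence is not eventually periodic
    ([cycle_twist]). Conjugating an arrow of degree [k <> 0] by the multiples of the
    resulting isotropy element [q] changes its class by the multiples of
    [q - T_k q], which are pairwise different ([lonely_conj]). *)

(** * Finite sums, moduli of complex numbers, unconditional sums *)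

Section FiniteSums.
Variables (R : realType) (T : choiceType).
Implicit Types (F : {fset T}) (g : T -> R).

Lemma fset_subset_sum F F' g : (forall t, 0 <= g t) -> (F `<=` F')%fset ->
  \sum_(t <- F) g t <= \sum_(t <- F') g t.
Proof.
move=> g0 FF'; rewrite [leRHS](big_fsetID _ (mem F))/=.
rewrite [X in X + _](_ : _ = \sum_(t <- F) g t) ?lerDl ?sumr_ge0//.
by apply: eq_fbigl => t; rewrite !inE/= andbC; case: (boolP (t \in F)) => //= /(fsubsetP FF').
Qed.

Lemma sum_fset_esum (D : set T) F g : (forall t, ~ D t -> g t = 0) ->
  exists2 A, fsets D A & \sum_(t \in A) (g t)%:E = (\sum_(t <- F) g t)%:E.
Proof.
move=> gD; exists ([set` F] `&` D).
  by split; [apply: finite_setIl; exact: finite_fset | move=> t []].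
rewrite fsbig_mkcondr fsbig_finite/=; last exact: finite_fset.
rewrite set_fsetK -sumEFin; apply: eq_bigr => t _.
by case: ifPn => // /negP tD; rewrite gD// => Dt; apply: tD; rewrite inE.
Qed.

Lemma esum_lub (D : set T) g (M : R) : (forall t, 0 <= g t) ->
  (forall t, ~ D t -> g t = 0) -> (forall F, \sum_(t <- F) g t <= M) ->
  exists s : R, [/\ (\esum_(t in D) (g t)%:E)%R = s%:E,
    forall F, \sum_(t <- F) g t <= s &
    forall e, 0 < e -> exists F, s - e < \sum_(t <- F) g t].
Proof.
move=> g0 gD gM.
have ub : (\esum_(t in D) (g t)%:E <= M%:E)%E.
  apply: ub_ereal_sup => _ [A [finA _] <-].
  by rewrite fsbig_finite// sumEFin lee_fin.
have lb F : ((\sum_(t <- F) g t)%:E <= \esum_(t in D) (g t)%:E)%E.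
  have [A DA <-] := sum_fset_esum F gD.
  by apply: ereal_sup_ubound; exists A.
have fn : (\esum_(t in D) (g t)%:E)%E \is a fin_num.
  rewrite fin_numE; apply/andP; split.
    by apply/eqP => h; have := lb fset0; rewrite h big_nil.
  by apply/eqP => h; move: ub; rewrite h.
exists (fine (\esum_(t in D) (g t)%:E)); split.
- by rewrite fineK.
- by move=> F; rewrite -lee_fin fineK.
- move=> e e0; have : ((fine (\esum_(t in D) (g t)%:E) - e)%:E < \esum_(t in D) (g t)%:E)%E.
    by rewrite -[ltRHS]fineK// lte_fin; lra.
  move=> /ereal_sup_gt[_ [A [finA AD] <-]].
  rewrite fsbig_finite// sumEFin lte_fin => h; exists (fset_set A); exact: h.
Qed.

(** Lagrange's identity: twice the difference of the two sides is the double sum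
    of the squares of [a i * b j - a j * b i]. *)
Lemma cauchy_schwarz_fset F (a b : T -> R) :
  (\sum_(t <- F) a t * b t) ^+ 2 <=
  (\sum_(t <- F) a t ^+ 2) * (\sum_(t <- F) b t ^+ 2).
Proof.
rewrite expr2 2!big_distrlr/= -subr_ge0.
set X := \sum_(i <- F) \sum_(j <- F) a i ^+ 2 * b j ^+ 2.
set Y := \sum_(i <- F) _.
have XE : X = \sum_(i <- F) \sum_(j <- F) a j ^+ 2 * b i ^+ 2.
  by rewrite /X exchange_big.
suff : 0 <= X + X - (Y + Y) by lra.
rewrite {2}XE /X /Y -!big_split/= -sumrB; apply: sumr_ge0 => i _.
rewrite -!big_split/= -sumrB; apply: sumr_ge0 => j _.
have -> : a i ^+ 2 * b j ^+ 2 + a j ^+ 2 * b i ^+ 2 -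
  (a i * b i * (a j * b j) + a i * b i * (a j * b j)) = (a i * b j - a j * b i) ^+ 2.
  by ring.
exact: sqr_ge0.
Qed.

End FiniteSums.

(** The share [e / (K + 1)] of an error [e] survives a factor [K], including
    the case [K = 0]. *)
Lemma share_le (R : realType) (K e : R) : 0 <= K -> 0 < e ->
  0 < e / (K + 1) /\ K * (e / (K + 1)) <= e.
Proof.
move=> K0 e0; have K1 : 0 < K + 1 by lra.
by rewrite divr_gt0// mulrCA ger_pMr// ler_pdivrMr// mul1r; split => //; lra.
Qed.

Section ComplexModulus.
Variable R : realType.
Implicit Types z w : R[i].

Lemma modulus_ge0 z : 0 <= normc z.
Proof. by case: z => a b; exact: sqrtr_ge0. Qed.

Lemma modulusC z : normc (z^*)%C = normc z.
Proof. by case: z => a b /=; rewrite sqrrN. Qed.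

Lemma modulusB z w : normc (z - w) = normc (w - z).
Proof. by rewrite -normcN opprB. Qed.

Lemma modulus_real (x : R) : normc (x%:C)%C = `|x|.
Proof. by rewrite /= expr0n addr0 sqrtr_sqr. Qed.

Lemma modulus_sq z : ((normc z ^+ 2)%:C)%C = z * (z^*)%C.
Proof.
case: z => a b /=; rewrite sqr_sqrtr ?addr_ge0 ?sqr_ge0//.
by apply/eqP; rewrite eq_complex /=; apply/andP; split; apply/eqP; ring.
Qed.

Lemma norm_Re_le z : `|complex.Re z| <= normc z.
Proof.
case: z => a b /=; rewrite -sqrtr_sqr ler_wsqrtr// lerDl; exact: sqr_ge0.
Qed.

Lemma norm_Im_le z : `|complex.Im z| <= normc z.
Proof.
case: z => a b /=; rewrite -sqrtr_sqr ler_wsqrtr// lerDr; exact: sqr_ge0.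
Qed.

Lemma modulus_le_ReIm z : normc z <= `|complex.Re z| + `|complex.Im z|.
Proof.
case: z => a b /=.
rewrite -[leRHS]ger0_norm ?addr_ge0// -sqrtr_sqr ler_wsqrtr// sqrrD !real_normK ?num_real//.
by rewrite lerD2r lerDl mulrn_wge0// mulr_ge0.
Qed.

Lemma modulus_sum (T : Type) (s : seq T) (f : T -> R[i]) :
  normc (\sum_(t <- s) f t) <= \sum_(t <- s) normc (f t).
Proof.
elim/big_rec2: _ => [|t x y _ h]; first by rewrite normc0.
by rewrite (le_trans (le_normcD _ _))// lerD2l.
Qed.

Lemma modulus_le0 z : normc z <= 0 -> z = 0.
Proof. by move=> h; apply: eq0_normc; apply/eqP; rewrite eq_le h modulus_ge0. Qed.

Lemma modulus_small0 z : (forall e, 0 < e -> normc z <= e) -> z = 0.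
Proof.
move=> h; apply: modulus_le0; apply/ler_addgt0Pr => e e0.
by rewrite add0r h.
Qed.

Lemma ge0_closed z : (forall e, 0 < e -> exists2 w : R[i], 0 <= w & normc (w - z) <= e) ->
  0 <= z.
Proof.
move=> h; rewrite lecE/=; apply/andP; split.
  rewrite -normr_eq0 eq_le normr_ge0 andbT; apply/ler_addgt0Pr => e e0.
  have [w w0 we] := h e e0; rewrite add0r.
  have := le_trans (norm_Im_le _) we.
  move: w0; rewrite lecE/= => /andP[/eqP w0 _].
  by case: z w w0 {we h} => a b [c d] /= ->; rewrite sub0r normrN.
apply/ler_addgt0Pr => e e0.
have [w w0 we] := h e e0.
have := le_trans (norm_Re_le _) we.
move: w0; rewrite lecE/= => /andP[_].
case: z w {we h} => a b [c d] /= c0 /ler_normlP[h1 h2]; lra.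
Qed.

End ComplexModulus.

Section HasSum.
Variables (R : realType) (T : choiceType).
Implicit Types (f g : T -> R[i]) (F : {fset T}) (D : set T).

(** Convergence along the finite subsets. It is linear on its face, whereas [csum]
    is put together from the suprema of the positive and negative parts; inner
    products are therefore computed through [has_sum]. *)
Definition has_sum f (l : R[i]) : Prop := forall e : R, 0 < e ->
  exists F0, forall F, (F0 `<=` F)%fset -> normc (\sum_(t <- F) f t - l) <= e.

Lemma has_sum_uniq f l l' : has_sum f l -> has_sum f l' -> l = l'.
Proof.
move=> fl fl'; apply/eqP; rewrite -subr_eq0; apply/eqP/modulus_small0 => e e0.
have [|F1 h1] := fl (e / 2); first by rewrite divr_gt0.
have [|F2 h2] := fl' (e / 2); first by rewrite divr_gt0.
have {}h1 := h1 _ (fsubsetUl F1 F2); have {}h2 := h2 _ (fsubsetUr F1 F2).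
move: h1 h2; set s := \sum_(t <- _) _ => h1 h2.
have -> : l - l' = (l - s) + (s - l') by ring.
rewrite (le_trans (le_normcD _ _))// modulusB; lra.
Qed.

Lemma has_sum_finite f F0 : (forall t, t \notin F0 -> f t = 0) ->
  has_sum f (\sum_(t <- F0) f t).
Proof.
move=> f0 e e0; exists F0 => F F0F.
rewrite -(big_fset_incl _ F0F) ?subrr ?normc0 ?ltW// => t _; exact: f0.
Qed.

Lemma has_sum_lin f g l m (a : R[i]) : has_sum f l -> has_sum g m ->
  has_sum (fun t => a * f t + g t) (a * l + m).
Proof.
move=> fl gm e e0.
have na := modulus_ge0 a; have e2 : 0 < e / 2 by rewrite divr_gt0.
have [d0 da] := share_le na e2.
have [F1 h1] := fl _ d0; have [F2 h2] := gm _ e2.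
exists (F1 `|` F2)%fset => F; rewrite fsubUset => /andP[/h1{}h1 /h2{}h2].
rewrite big_split/= -mulr_sumr.
set s := \sum_(t <- F) f t in h1 *; set s' := \sum_(t <- F) g t in h2 *.
have -> : a * s + s' - (a * l + m) = a * (s - l) + (s' - m) by ring.
rewrite (le_trans (le_normcD _ _))// normcM.
have := ler_wpM2l na h1; lra.
Qed.

Lemma has_sum_conj f l : has_sum f l ->
  has_sum (fun t => (f t)^*%C) (l^*)%C.
Proof.
move=> fl e /fl[F0 h]; exists F0 => F /h.
by rewrite -modulusC raddfB raddf_sum.
Qed.

Lemma has_sum_bound f l M : has_sum f l ->
  (forall F, normc (\sum_(t <- F) f t) <= M) -> normc l <= M.
Proof.
move=> fl fM; apply/ler_addgt0Pr => e /fl[F0 /(_ F0 (fsubset_refl _))h].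
have -> : l = \sum_(t <- F0) f t + - (\sum_(t <- F0) f t - l) by ring.
by rewrite (le_trans (le_normcD _ _))// normcN lerD.
Qed.

Lemma rsum_lim D (f : T -> R) (M : R) : (forall t, ~ D t -> f t = 0) ->
  (forall F, \sum_(t <- F) `|f t| <= M) ->
  forall e, 0 < e -> exists F0, forall F, (F0 `<=` F)%fset ->
    `|\sum_(t <- F) f t - rsum D f| <= e.
Proof.
move=> fD fM e e0.
have part (g : T -> R) : (forall t, 0 <= g t <= `|f t|) ->
    exists F0, forall F, (F0 `<=` F)%fset ->
      fine (\esum_(t in D) (g t)%:E) - e / 2 <= \sum_(t <- F) g t <=
      fine (\esum_(t in D) (g t)%:E).
  move=> gf.
  have g0 t : 0 <= g t by have /andP[] := gf t.
  have [||s [sE ub lb]] := @esum_lub R T D g M g0.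
  - move=> t /fD ft; have := gf t.
    by rewrite ft normr0 => gt0; apply/eqP; rewrite eq_le andbC.
  - move=> F; rewrite (le_trans _ (fM F))// ler_sum// => t _.
    by have /andP[] := gf t.
  have [|F0 h] := lb (e / 2); first by rewrite divr_gt0.
  exists F0 => F F0F; rewrite sE/= ub andbT.
  by rewrite (le_trans (ltW h))// fset_subset_sum.
have [|F1 h1] := part (fun t => Num.max (f t) 0).
  by move=> t; rewrite le_max lexx orbT/= ge_max ler_norm normr_ge0.
have [|F2 h2] := part (fun t => Num.max (- f t) 0).
  by move=> t; rewrite le_max lexx orbT/= ge_max -normrN ler_norm normr_ge0.
exists (F1 `|` F2)%fset => F; rewrite fsubUset => /andP[/h1/andP[h3 h4] /h2/andP[h5 h6]].
have -> : \sum_(t <- F) f t =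
    \sum_(t <- F) Num.max (f t) 0 - \sum_(t <- F) Num.max (- f t) 0.
  rewrite -sumrB; apply: eq_bigr => t _.
  case: (lerP 0 (f t)) => ft.
    by rewrite max_r ?subr0// oppr_le0.
  by rewrite max_l ?sub0r ?opprK// oppr_ge0 ltW.
rewrite /rsum; apply/ler_normlP; split; lra.
Qed.

Lemma has_sum_csum D f (M : R) : (forall t, ~ D t -> f t = 0) ->
  (forall F, \sum_(t <- F) normc (f t) <= M) -> has_sum f (csum D f).
Proof.
move=> fD fM e e0.
have e2 : 0 < e / 2 by rewrite divr_gt0.
have [| |F1 h1] := @rsum_lim D (fun t => complex.Re (f t)) M _ _ _ e2.
- by move=> t /fD ->.
- by move=> F; rewrite (le_trans _ (fM F))// ler_sum// => t _; exact: norm_Re_le.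
have [| |F2 h2] := @rsum_lim D (fun t => complex.Im (f t)) M _ _ _ e2.
- by move=> t /fD ->.
- by move=> F; rewrite (le_trans _ (fM F))// ler_sum// => t _; exact: norm_Im_le.
exists (F1 `|` F2)%fset => F; rewrite fsubUset => /andP[/h1{}h1 /h2{}h2].
apply: le_trans (modulus_le_ReIm _) _.
have E (h : R[i] -> R) : h 0 = 0 -> {morph h : x y / x + y} ->
    h (\sum_(t <- F) f t) = \sum_(t <- F) h (f t).
  by move=> h0 hD; rewrite (big_morph h hD h0).
have ReD : {morph (@complex.Re R) : x y / x + y} by move=> [a b] [c d].
have ImD : {morph (@complex.Im R) : x y / x + y} by move=> [a b] [c d].
have B (z w : R[i]) : (complex.Re (z - w) = complex.Re z - complex.Re w) *
   (complex.Im (z - w) = complex.Im z - complex.Im w) by case: z w => a b [c d].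
rewrite !B !E//= [leRHS]splitr lerD//.
Qed.

End HasSum.

(** * Square-summable families *)

#[local] Arguments normc : simpl never.

Section SquareSummable.
Variables (R : realType) (T : choiceType) (D : set T).
Implicit Types (xi eta zeta : vec R T) (F : {fset T}).

Definition fsq xi F : R := \sum_(t <- F) normc (xi t) ^+ 2.

Lemma fsq_ge0 xi F : 0 <= fsq xi F.
Proof. by apply: sumr_ge0 => t _; exact: sqr_ge0. Qed.

Lemma fsq_sqnorm xi (M : R) : (forall t, ~ D t -> xi t = 0) ->
  (forall F, fsq xi F <= M) ->
  exists s : R, [/\ sqnorm D xi = s%:E, forall F, fsq xi F <= s &
    forall e, 0 < e -> exists F, s - e < fsq xi F].
Proof.
move=> xiD xiM; apply: (@esum_lub R T D (fun t => normc (xi t) ^+ 2) M) => //.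
- by move=> t; exact: sqr_ge0.
- by move=> t /xiD ->; rewrite normc0 expr0n.
Qed.

Lemma ell2_off xi : ell2 D xi -> forall t, ~ D t -> xi t = 0.
Proof. by case. Qed.

Lemma ell2_fsq xi : ell2 D xi -> exists M : R, forall F, fsq xi F <= M.
Proof.
move=> [xiD fin]; exists (fine (sqnorm D xi)) => F.
have sq0 : (0 <= sqnorm D xi)%E.
  by apply: esum_ge0 => t _; rewrite lee_fin sqr_ge0.
rewrite -lee_fin fineK; last by rewrite ge0_fin_numE.
have [|A DA <-] := @sum_fset_esum R T D F (fun t => normc (xi t) ^+ 2).
  by move=> t /xiD ->; rewrite normc0 expr0n.
by apply: ereal_sup_ubound; exists A.
Qed.

Lemma l2norm_ge0 xi : 0 <= l2norm D xi.
Proof. exact: sqrtr_ge0. Qed.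

(** Sums over all finite sets replace the extended real [sqnorm] from here on:
    a uniform bound on them gives membership and norm at once. *)
Lemma ell2_bound xi M : (forall t, ~ D t -> xi t = 0) -> 0 <= M ->
  (forall F, fsq xi F <= M ^+ 2) -> ell2 D xi /\ l2norm D xi <= M.
Proof.
move=> xiD M0 xiM; have [s [sE ub lb]] := fsq_sqnorm xiD xiM.
split; first by split => //; rewrite sE ltry.
rewrite /l2norm sE/= -[leRHS]ger0_norm// -sqrtr_sqr ler_wsqrtr//.
apply/ler_addgt0Pr => e /lb[F h]; have := xiM F; lra.
Qed.

Lemma l2norm_sup xi : ell2 D xi -> (forall F, fsq xi F <= l2norm D xi ^+ 2) /\
  (forall e, 0 < e -> exists F, l2norm D xi ^+ 2 - e < fsq xi F).
Proof.
move=> xi2; have [M xiM] := ell2_fsq xi2.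
have [s [sE ub lb]] := fsq_sqnorm (ell2_off xi2) xiM.
rewrite /l2norm sE/= sqr_sqrtr//.
by rewrite (le_trans _ (ub fset0))// /fsq big_nil.
Qed.

Lemma fsq_le xi F : ell2 D xi -> fsq xi F <= l2norm D xi ^+ 2.
Proof. by move=> /l2norm_sup[]. Qed.

Lemma l2norm_le xi M : ell2 D xi -> 0 <= M ->
  (forall F, fsq xi F <= M ^+ 2) -> l2norm D xi <= M.
Proof. by move=> /ell2_off xi2 M0 h; have [] := ell2_bound xi2 M0 h. Qed.

Lemma modulus_le_l2norm xi t : ell2 D xi -> normc (xi t) <= l2norm D xi.
Proof.
move=> xi2; have := fsq_le [fset t]%fset xi2.
by rewrite /fsq big_seq_fset1 ler_pXn2r// ?nnegrE ?modulus_ge0 ?l2norm_ge0.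
Qed.

Lemma l2norm_eq0 xi : ell2 D xi -> l2norm D xi <= 0 -> xi = (fun=> 0).
Proof.
move=> xi2 h; apply/funext => t; apply: modulus_le0.
by rewrite (le_trans (modulus_le_l2norm t xi2)).
Qed.

Lemma sum_mul_le F (a b : T -> R) (X Y : R) : 0 <= X -> 0 <= Y ->
  \sum_(t <- F) a t ^+ 2 <= X ^+ 2 -> \sum_(t <- F) b t ^+ 2 <= Y ^+ 2 ->
  \sum_(t <- F) a t * b t <= X * Y.
Proof.
move=> X0 Y0 aX bY; rewrite leNgt; apply/negP => h.
have XY0 : 0 <= X * Y by rewrite mulr_ge0.
have : (X * Y) ^+ 2 < (\sum_(t <- F) a t * b t) ^+ 2.
  by rewrite ltr_pXn2r// nnegrE// (le_trans XY0 (ltW h)).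
apply/negP; rewrite -leNgt (le_trans (cauchy_schwarz_fset _ _ _))//.
by rewrite exprMn ler_pM// sumr_ge0// => t _; exact: sqr_ge0.
Qed.

Lemma ell2_lin (a : R[i]) xi eta : ell2 D xi -> ell2 D eta ->
  ell2 D (fun t => a * xi t + eta t) /\
  l2norm D (fun t => a * xi t + eta t) <= normc a * l2norm D xi + l2norm D eta.
Proof.
move=> xi2 eta2; apply: ell2_bound.
- by move=> t tD; rewrite (ell2_off xi2)// (ell2_off eta2)// mulr0 addr0.
- by rewrite addr_ge0 ?mulr_ge0 ?l2norm_ge0 ?modulus_ge0.
move=> F; set X := l2norm D xi; set Y := l2norm D eta.
have X0 : 0 <= X by exact: l2norm_ge0.
have Y0 : 0 <= Y by exact: l2norm_ge0.
have a0 := modulus_ge0 a.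
have hX := fsq_le F xi2; have hY := fsq_le F eta2.
have hXY := sum_mul_le X0 Y0 hX hY.
apply: (@le_trans _ _ (\sum_(t <- F) (normc a ^+ 2 * normc (xi t) ^+ 2 +
   (2 * normc a * (normc (xi t) * normc (eta t)) + normc (eta t) ^+ 2)))).
  apply: ler_sum => t _.
  have -> : normc a ^+ 2 * normc (xi t) ^+ 2 +
   (2 * normc a * (normc (xi t) * normc (eta t)) + normc (eta t) ^+ 2) =
   (normc a * normc (xi t) + normc (eta t)) ^+ 2 by ring.
  rewrite ler_pXn2r ?nnegrE ?addr_ge0 ?mulr_ge0 ?modulus_ge0//.
  by rewrite (le_trans (le_normcD _ _))// normcM.
rewrite !big_split/= -!mulr_sumr.
have -> : (normc a * X + Y) ^+ 2 = normc a ^+ 2 * X ^+ 2 + (2 * normc a * (X * Y) + Y ^+ 2).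
  by ring.
by rewrite lerD// ?lerD// ler_wpM2l// ?sqr_ge0// mulr_ge0.
Qed.

Lemma ell20 : ell2 D (fun=> 0 : R[i]) /\ l2norm D (fun=> 0 : R[i]) <= 0.
Proof.
apply: ell2_bound => // F.
by rewrite /fsq big1 ?expr0n//= => t _; rewrite normc0 expr0n.
Qed.

Lemma ell2D xi eta : ell2 D xi -> ell2 D eta -> ell2 D (fun t => xi t + eta t).
Proof.
move=> xi2 eta2; have [] := ell2_lin 1 xi2 eta2.
by under eq_fun do rewrite mul1r.
Qed.

Lemma ell2Z (a : R[i]) xi : ell2 D xi -> ell2 D (fun t => a * xi t).
Proof.
move=> xi2; have [] := ell2_lin a xi2 ell20.1.
by under eq_fun do rewrite addr0.
Qed.

Lemma ell2B xi eta : ell2 D xi -> ell2 D eta -> ell2 D (fun t => xi t - eta t).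
Proof.
move=> xi2 eta2; have [] := ell2_lin (-1) eta2 xi2.
by under eq_fun do rewrite mulN1r addrC.
Qed.

Lemma l2normZ (a : R[i]) xi : ell2 D xi ->
  l2norm D (fun t => a * xi t) <= normc a * l2norm D xi.
Proof.
move=> xi2; have [_] := ell2_lin a xi2 ell20.1.
under eq_fun do rewrite addr0; have := ell20.2; lra.
Qed.

Lemma ell2_mono xi eta : (forall t, normc (eta t) <= normc (xi t)) -> ell2 D xi ->
  ell2 D eta /\ l2norm D eta <= l2norm D xi.
Proof.
move=> le xi2; apply: ell2_bound; last 2 first.
- exact: l2norm_ge0.
- move=> F; rewrite (le_trans _ (fsq_le F xi2))// ler_sum// => t _.
  by rewrite ler_pXn2r// nnegrE modulus_ge0.
by move=> t tD; apply: modulus_le0; rewrite (le_trans (le _))// (ell2_off xi2)// normc0.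
Qed.

Definition vrestr (p : T -> bool) xi : vec R T := fun t => if p t then xi t else 0.

Lemma ell2_vrestr p xi : ell2 D xi -> ell2 D (vrestr p xi).
Proof.
move=> /(@ell2_mono xi (vrestr p xi))[]// t; rewrite /vrestr.
by case: ifP; rewrite ?normc0 ?modulus_ge0.
Qed.

Lemma l2norm_vrestr p xi : ell2 D xi -> l2norm D (vrestr p xi) <= l2norm D xi.
Proof.
move=> /(@ell2_mono xi (vrestr p xi))[]// t; rewrite /vrestr.
by case: ifP; rewrite ?normc0 ?modulus_ge0.
Qed.

Definition delta (s : T) : vec R T := fun t => (t == s)%:R.

Lemma ell2_delta s : D s -> ell2 D (delta s) /\ l2norm D (delta s) <= 1.
Proof.
move=> Ds; apply: ell2_bound => //.
- by move=> t tD; rewrite /delta; case: eqP => // ts; rewrite ts in tD.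
move=> F; rewrite expr1n; case: (boolP (s \in F)) => sF.
  rewrite /fsq (big_fsetD1 s)//= /delta eqxx normc1 expr1n big1_fset ?addr0//.
  by move=> t; rewrite !inE => /andP[/negbTE -> _] _; rewrite normc0 expr0n.
rewrite /fsq big_seq big1// => t tF; rewrite /delta; case: eqP => [ts|_].
  by rewrite -ts tF in sF.
by rewrite normc0 expr0n.
Qed.

Lemma ell2_finite xi F : ell2 D xi ->
  vrestr (mem F) xi = (fun t => \sum_(s <- F) xi s * delta s t).
Proof.
move=> xi2; apply/funext => t; rewrite /vrestr/=; case: ifPn => tF.
  rewrite (big_fsetD1 t)//= /delta eqxx mulr1 big1_fset ?addr0//.
  by move=> s; rewrite !inE => /andP[/negbTE st _] _; rewrite eq_sym st mulr0.
rewrite big_seq big1// => s sF; rewrite /delta; case: eqP => [ts|]; last by rewrite mulr0.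
by rewrite ts sF in tF.
Qed.

Lemma fsq_vrestrC xi F F' : fsq (vrestr (fun t => t \notin F) xi) F' =
  fsq xi (F `|` F')%fset - fsq xi F.
Proof.
rewrite /fsq [X in _ = X - _](big_fsetID _ (mem F))/=.
rewrite (_ : \sum_(i <- [fset x in (F `|` F')%fset | x \in F]%fset) _ =
  \sum_(t <- F) normc (xi t) ^+ 2); last first.
  by apply: eq_fbigl => t; rewrite !inE/=; case: (t \in F); rewrite ?andbF.
rewrite [RHS]addrAC subrr add0r [LHS](big_fsetID _ (mem F))/= big1_fset ?add0r; last first.
  by move=> t; rewrite !inE => /andP[_ tF] _; rewrite /vrestr tF normc0 expr0n.
apply: eq_fbig => t; last first.
  by rewrite !inE => h; rewrite /vrestr; have -> : t \notin F by move: h; case: (t \in F); rewrite /= ?andbF ?andFb.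
by rewrite !inE; case: (t \in F); rewrite ?andbF.
Qed.

Lemma finite_dense xi e : ell2 D xi -> 0 < e -> exists F,
  l2norm D (fun t => xi t - vrestr (mem F) xi t) <= e.
Proof.
move=> xi2 e0; have [ub lb] := l2norm_sup xi2.
have [|F hF] := lb (e ^+ 2); first by rewrite exprn_gt0.
exists F.
have -> : (fun t => xi t - vrestr (mem F) xi t) = vrestr (fun t => t \notin F) xi.
  by apply/funext => t; rewrite /vrestr/=; case: (t \in F); rewrite ?subrr ?subr0.
apply: l2norm_le; [exact: ell2_vrestr|exact: ltW|] => F'.
rewrite fsq_vrestrC; have := ub (F `|` F')%fset; lra.
Qed.

(** ** Inner products *)

Lemma sum_inner_le xi eta F : ell2 D xi -> ell2 D eta ->
  \sum_(t <- F) normc (xi t * (eta t)^*%C) <= l2norm D xi * l2norm D eta.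
Proof.
move=> xi2 eta2; under eq_bigr do rewrite normcM modulusC.
apply: sum_mul_le; rewrite ?l2norm_ge0//; exact: fsq_le.
Qed.

Lemma has_sum_inner xi eta : ell2 D xi -> ell2 D eta ->
  has_sum (fun t => xi t * (eta t)^*%C) (inner D xi eta).
Proof.
move=> xi2 eta2; apply: has_sum_csum.
  by move=> t tD; rewrite (ell2_off xi2)// mul0r.
by move=> F; exact: sum_inner_le.
Qed.

Lemma inner_bound xi eta : ell2 D xi -> ell2 D eta ->
  normc (inner D xi eta) <= l2norm D xi * l2norm D eta.
Proof.
move=> xi2 eta2; apply: (has_sum_bound (has_sum_inner xi2 eta2)) => F.
by rewrite (le_trans (modulus_sum _ _))// sum_inner_le.
Qed.

Lemma inner_lin (a : R[i]) xi eta zeta : ell2 D xi -> ell2 D eta -> ell2 D zeta ->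
  inner D (fun t => a * xi t + eta t) zeta = a * inner D xi zeta + inner D eta zeta.
Proof.
move=> xi2 eta2 zeta2; have [lin2 _] := ell2_lin a xi2 eta2.
apply: (has_sum_uniq (has_sum_inner lin2 zeta2)).
under eq_fun do rewrite mulrDl -mulrA.
by apply: has_sum_lin; exact: has_sum_inner.
Qed.

Lemma inner_conj xi eta : ell2 D xi -> ell2 D eta ->
  inner D eta xi = ((inner D xi eta)^*)%C.
Proof.
move=> xi2 eta2; apply: (has_sum_uniq (has_sum_inner eta2 xi2)).
have conjE (x y : R[i]) : ((x * y^*)^* = y * x^*)%C.
  by rewrite rmorphM/= conjcK mulrC.
have := has_sum_conj (has_sum_inner xi2 eta2).
by under eq_fun do rewrite conjE.
Qed.

Lemma inner0l eta : ell2 D eta -> inner D (fun=> 0) eta = 0.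
Proof.
move=> eta2; apply: modulus_le0; apply: le_trans (inner_bound ell20.1 eta2) _.
by rewrite mulr_le0_ge0 ?l2norm_ge0//; exact: ell20.2.
Qed.

Lemma inner0r eta : ell2 D eta -> inner D eta (fun=> 0) = 0.
Proof. by move=> eta2; rewrite (inner_conj ell20.1 eta2) inner0l// conjc0. Qed.

Lemma innerDl xi xi' eta : ell2 D xi -> ell2 D xi' -> ell2 D eta ->
  inner D (fun t => xi t + xi' t) eta = inner D xi eta + inner D xi' eta.
Proof.
move=> xi2 xi'2 eta2; have := inner_lin 1 xi2 xi'2 eta2.
by under eq_fun do rewrite mul1r; rewrite mul1r.
Qed.

Lemma innerDr xi xi' eta : ell2 D xi -> ell2 D xi' -> ell2 D eta ->
  inner D eta (fun t => xi t + xi' t) = inner D eta xi + inner D eta xi'.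
Proof.
move=> xi2 xi'2 eta2; rewrite (inner_conj (ell2D xi2 xi'2) eta2) innerDl//.
by rewrite rmorphD/= (inner_conj xi2 eta2) (inner_conj xi'2 eta2).
Qed.

Lemma innerZr (a : R[i]) xi eta : ell2 D xi -> ell2 D eta ->
  inner D eta (fun t => a * xi t) = (a^*)%C * inner D eta xi.
Proof.
move=> xi2 eta2; rewrite (inner_conj (ell2Z a xi2) eta2).
have := inner_lin a xi2 ell20.1 eta2.
under eq_fun do rewrite addr0.
by move=> ->; rewrite inner0l// addr0 rmorphM/= (inner_conj xi2 eta2).
Qed.

Lemma inner_delta eta s : ell2 D eta -> D s -> inner D eta (delta s) = eta s.
Proof.
move=> eta2 Ds; have [d2 _] := ell2_delta Ds.
apply: (has_sum_uniq (has_sum_inner eta2 d2)).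
have := @has_sum_finite R T (fun t => eta t * (delta s t)^*%C) [fset s]%fset.
rewrite big_seq_fset1 /delta eqxx conjc1 mulr1; apply => t.
by rewrite inE => /negbTE ->; rewrite conjc0 mulr0.
Qed.

Lemma inner_self0 xi : ell2 D xi -> inner D xi xi = 0 -> xi = (fun=> 0).
Proof.
move=> xi2 h; apply: (l2norm_eq0 xi2).
apply: l2norm_le => // F; rewrite expr0n/=; apply/ler_addgt0Pr => e e0.
have [F0 hF0] := has_sum_inner xi2 xi2 e0.
have := hF0 _ (fsubsetUl F0 F); rewrite h subr0.
under eq_bigr do rewrite -modulus_sq.
rewrite -raddf_sum modulus_real add0r => /ler_normlP[_]; apply: le_trans.
by apply: fset_subset_sum; [move=> t; exact: sqr_ge0 | exact: fsubsetUr].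
Qed.

End SquareSummable.

(** * Bounded operators and their adjoints *)

Section BoundedOperators.
Variables (R : realType) (T : choiceType) (D : set T).
Implicit Types (xi eta zeta : vec R T) (F : {fset T}) (A B : operator R T).

Lemma bop_off A xi : bounded_op D A -> ~ ell2 D xi -> A xi = (fun=> 0).
Proof. by case=> h _ _ _; exact: h. Qed.

Lemma bop_ell2 A xi : bounded_op D A -> ell2 D (A xi).
Proof.
move=> Ab; have [xi2|xi2] := pselect (ell2 D xi); first by case: Ab => _ h _ _; exact: h.
rewrite (bop_off Ab)//; exact: (ell20 _ _).1.
Qed.

Lemma bop_lin A (a : R[i]) xi eta : bounded_op D A -> ell2 D xi -> ell2 D eta ->
  A (fun t => a * xi t + eta t) = (fun t => a * A xi t + A eta t).
Proof. by case=> _ _ h _; exact: h. Qed.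

Lemma bop0 A : bounded_op D A -> A (fun=> 0) = (fun=> 0).
Proof.
move=> Ab; have z2 := (ell20 R D).1.
have := bop_lin (-1) Ab z2 z2.
rewrite (_ : (fun t => -1 * 0 + 0) = (fun=> 0 : R[i])); last first.
  by apply/funext => t; rewrite mulr0 addr0.
by move=> h; apply/funext => t; have := congr1 (@^~ t) h; rewrite /= mulN1r addNr.
Qed.

Lemma bopD A xi eta : bounded_op D A -> ell2 D xi -> ell2 D eta ->
  A (fun t => xi t + eta t) = (fun t => A xi t + A eta t).
Proof.
move=> Ab xi2 eta2; have := bop_lin 1 Ab xi2 eta2.
by under eq_fun do rewrite mul1r; under [in RHS]eq_fun do rewrite mul1r.
Qed.

Lemma bopZ A (a : R[i]) xi : bounded_op D A -> ell2 D xi ->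
  A (fun t => a * xi t) = (fun t => a * A xi t).
Proof.
move=> Ab xi2; have := bop_lin a Ab xi2 (ell20 R D).1; rewrite (bop0 Ab).
by under eq_fun do rewrite addr0; under [in RHS]eq_fun do rewrite addr0.
Qed.

Lemma bopB A xi eta : bounded_op D A -> ell2 D xi -> ell2 D eta ->
  A (fun t => xi t - eta t) = (fun t => A xi t - A eta t).
Proof.
move=> Ab xi2 eta2; have := bop_lin (-1) Ab eta2 xi2.
by under eq_fun do rewrite mulN1r addrC; under [in RHS]eq_fun do rewrite mulN1r addrC.
Qed.

Lemma ell2_sum I (s : seq I) (xi : I -> vec R T) : (forall i, ell2 D (xi i)) ->
  ell2 D (fun t => \sum_(i <- s) xi i t).
Proof.
move=> xi2; elim: s => [|i s ih].
  under eq_fun do rewrite big_nil; exact: (ell20 R D).1.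
under eq_fun do rewrite big_cons; exact: ell2D.
Qed.

Lemma bop_sum A I (s : seq I) (xi : I -> vec R T) : bounded_op D A ->
  (forall i, ell2 D (xi i)) ->
  A (fun t => \sum_(i <- s) xi i t) = (fun t => \sum_(i <- s) A (xi i) t).
Proof.
move=> Ab xi2; elim: s => [|i s ih].
  under eq_fun do rewrite big_nil; rewrite (bop0 Ab).
  by apply/funext => t; rewrite big_nil.
under eq_fun do rewrite big_cons; rewrite (bopD Ab)//; last exact: ell2_sum.
by apply/funext => t; rewrite big_cons ih.
Qed.

Lemma opnorm_has_sup A : bounded_op D A ->
  has_sup [set l2norm D (A xi) | xi in [set xi | ell2 D xi /\ l2norm D xi <= 1]].
Proof.
move=> [_ _ _ [M hM]]; split.
  exists (l2norm D (A (fun=> 0))); exists (fun=> 0) => //.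
  by have [? h] := ell20 R D; split => //; rewrite (le_trans h).
exists `|M| => _ [xi [xi2 xi1] <-]; rewrite (le_trans (hM _ xi2))//.
rewrite (le_trans (ler_norm _))// normrM (ger0_norm (l2norm_ge0 _ _)).
by rewrite ler_piMr.
Qed.

Lemma opnorm_ge0 A : bounded_op D A -> 0 <= opnorm D A.
Proof.
move=> Ab; have [_ ub] := opnorm_has_sup Ab.
apply: (le_trans (l2norm_ge0 D (A (fun=> 0)))); apply: ub_le_sup => //.
exists (fun=> 0) => //.
by have [? h] := ell20 R D; split => //; rewrite (le_trans h).
Qed.

(** [opnorm] is a supremum over the unit ball, so [xi] is first scaled into it. *)
Lemma opnorm_ub A xi : bounded_op D A -> ell2 D xi ->
  l2norm D (A xi) <= opnorm D A * l2norm D xi.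
Proof.
move=> Ab xi2; have [x0|x0] := leP (l2norm D xi) 0.
  rewrite (l2norm_eq0 xi2 x0) (bop0 Ab) (le_trans (ell20 R D).2)//.
  by rewrite mulr_ge0 ?opnorm_ge0 ?l2norm_ge0.
set n := l2norm D xi in x0 *.
pose eta : vec R T := fun t => (n^-1%:C)%C * xi t.
have eta2 : ell2 D eta by exact: ell2Z.
have nz : n != 0 by rewrite gt_eqF.
have eta1 : l2norm D eta <= 1.
  rewrite (le_trans (l2normZ _ xi2))// modulus_real gtr0_norm ?invr_gt0//.
  by rewrite mulVf.
have : l2norm D (A eta) <= opnorm D A.
  by apply: ub_le_sup; [exact: (opnorm_has_sup Ab).2 | exists eta].
have xiE : xi = (fun t => (n%:C)%C * eta t).
  by apply/funext => t; rewrite /eta mulrA -rmorphM/= divff// mul1r.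
move=> h; rewrite {1}xiE (bopZ _ Ab eta2).
rewrite (le_trans (l2normZ _ (bop_ell2 _ Ab)))// modulus_real gtr0_norm// mulrC.
by rewrite ler_pM2r.
Qed.

Lemma opnorm_le A M : bounded_op D A -> 0 <= M ->
  (forall xi, ell2 D xi -> l2norm D (A xi) <= M * l2norm D xi) -> opnorm D A <= M.
Proof.
move=> Ab M0 h; apply: ge_sup; first by case: (opnorm_has_sup Ab).
move=> _ [xi [xi2 xi1] <-]; rewrite (le_trans (h _ xi2))//.
by rewrite ler_piMr.
Qed.

Lemma bop_ext A B : bounded_op D A -> bounded_op D B ->
  (forall xi, ell2 D xi -> A xi = B xi) -> A = B.
Proof.
move=> Ab Bb h; apply/funext => xi; have [/h//|xi2] := pselect (ell2 D xi).
by rewrite (bop_off Ab)// (bop_off Bb).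
Qed.

Lemma bounded_zero : bounded_op D (@opzero R T) /\ opnorm D (@opzero R T) <= 0.
Proof.
have b : bounded_op D (@opzero R T).
  split => //.
  - by move=> xi _; exact: (ell20 R D).1.
  - by move=> a xi eta _ _; apply/funext => t; rewrite /opzero mulr0 addr0.
  - by exists 0 => xi xi2; rewrite mul0r; exact: (ell20 R D).2.
split => //; apply: opnorm_le => // xi _; rewrite mul0r; exact: (ell20 R D).2.
Qed.

Lemma bounded_lin (a : R[i]) A B : bounded_op D A -> bounded_op D B ->
  bounded_op D (oplin a A B) /\
  opnorm D (oplin a A B) <= normc a * opnorm D A + opnorm D B.
Proof.
move=> Ab Bb.
have bd xi : ell2 D xi -> l2norm D (oplin a A B xi) <=
    (normc a * opnorm D A + opnorm D B) * l2norm D xi.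
  move=> xi2; have [_] := ell2_lin a (bop_ell2 xi Ab) (bop_ell2 xi Bb).
  move=> /le_trans; apply; rewrite mulrDl -mulrA lerD ?opnorm_ub//.
  by rewrite ler_wpM2l ?modulus_ge0// opnorm_ub.
have b : bounded_op D (oplin a A B).
  split.
  - move=> xi xi2; rewrite /oplin (bop_off Ab)// (bop_off Bb)//.
    by apply/funext => t; rewrite mulr0 addr0.
  - by move=> xi xi2; have [] := ell2_lin a (bop_ell2 xi Ab) (bop_ell2 xi Bb).
  - move=> c xi eta xi2 eta2; rewrite /oplin (bop_lin c Ab)// (bop_lin c Bb)//.
    by apply/funext => t; ring.
  - by exists (normc a * opnorm D A + opnorm D B).
split => //; apply: opnorm_le => //.
by rewrite addr_ge0 ?mulr_ge0 ?modulus_ge0 ?opnorm_ge0.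
Qed.

Lemma bounded_comp A B : bounded_op D A -> bounded_op D B ->
  bounded_op D (A \o B) /\ opnorm D (A \o B) <= opnorm D A * opnorm D B.
Proof.
move=> Ab Bb.
have bd xi : ell2 D xi -> l2norm D ((A \o B) xi) <= opnorm D A * opnorm D B * l2norm D xi.
  move=> xi2; rewrite (le_trans (opnorm_ub Ab (bop_ell2 xi Bb)))// -mulrA.
  by rewrite ler_wpM2l ?opnorm_ge0 ?opnorm_ub.
have b : bounded_op D (A \o B).
  split.
  - by move=> xi xi2 /=; rewrite (bop_off Bb)// (bop0 Ab).
  - by move=> xi xi2; exact: (bop_ell2 _ Ab).
  - by move=> c xi eta xi2 eta2 /=; rewrite (bop_lin c Bb)// (bop_lin c Ab)//; exact: bop_ell2.
  - by exists (opnorm D A * opnorm D B).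
split => //; apply: opnorm_le => //.
by rewrite mulr_ge0 ?opnorm_ge0.
Qed.

(** Two operators with the same matrix agree on finitely supported vectors, and
    these are dense. *)
Lemma bop_ext_matrix A B : bounded_op D A -> bounded_op D B ->
  (forall s t, D s -> D t -> A (delta R s) t = B (delta R s) t) -> A = B.
Proof.
move=> Ab Bb AB; apply: bop_ext => // xi xi2.
have dE s : D s -> A (delta R s) = B (delta R s).
  move=> Ds; apply/funext => t; have [Dt|Dt] := pselect (D t); first exact: AB.
  by rewrite (ell2_off (bop_ell2 _ Ab))// (ell2_off (bop_ell2 _ Bb)).
pose xid (s : T) : vec R T := fun t => xi s * delta R s t.
have xid2 s : ell2 D (xid s).
  have [Ds|Ds] := pselect (D s); first by apply: ell2Z; exact: (ell2_delta _ Ds).1.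
  rewrite /xid (ell2_off xi2)//; under eq_fun do rewrite mul0r; exact: (ell20 R D).1.
have xidE s : A (xid s) = B (xid s).
  have [Ds|Ds] := pselect (D s).
    by rewrite /xid (bopZ _ Ab) ?(bopZ _ Bb) ?dE//; exact: (ell2_delta _ Ds).1.
  rewrite /xid (ell2_off xi2)//; under eq_fun do rewrite mul0r.
  by rewrite (bop0 Ab) (bop0 Bb).
have finE F : A (vrestr (mem F) xi) = B (vrestr (mem F) xi).
  rewrite (ell2_finite _ xi2) (bop_sum _ Ab xid2) (bop_sum _ Bb xid2).
  by apply/funext => t; apply: eq_bigr => s _; rewrite xidE.
have K0 : 0 <= opnorm D A + opnorm D B by rewrite addr_ge0 ?opnorm_ge0.
apply/funext => t; apply/eqP; rewrite -subr_eq0; apply/eqP/modulus_small0 => e e0.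
have [d0 dK] := share_le K0 e0; have [F hF] := finite_dense xi2 d0.
set eta := (fun t => _) in hF.
have eta2 : ell2 D eta by apply: ell2B => //; exact: ell2_vrestr.
have -> : A xi t - B xi t = A eta t - B eta t.
  rewrite /eta (bopB Ab) ?(bopB Bb) ?finE//; [ring | exact: ell2_vrestr..].
rewrite (le_trans (le_normcD _ _))// normcN.
have h1 := le_trans (modulus_le_l2norm t (bop_ell2 eta Ab)) (opnorm_ub Ab eta2).
have h2 := le_trans (modulus_le_l2norm t (bop_ell2 eta Bb)) (opnorm_ub Bb eta2).
rewrite (le_trans (lerD h1 h2))// -mulrDl.
exact: le_trans (ler_wpM2l K0 hF) dK.
Qed.

(** The matrix of the adjoint is forced, so the adjoint can be written down from
    it; testing [A] on the vector whose coordinates are those of the candidate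
    shows that the candidate is square summable. *)
Lemma adjoint_exists A : bounded_op D A -> exists2 B, is_adjoint D A B &
  opnorm D B <= opnorm D A.
Proof.
move=> Ab; pose K := opnorm D A; have K0 : 0 <= K by exact: opnorm_ge0.
pose B : operator R T := fun eta t =>
  if `[< ell2 D eta >] && `[< D t >] then inner D eta (A (delta R t)) else 0.
have BE eta t : ell2 D eta -> D t -> B eta t = inner D eta (A (delta R t)).
  by move=> h1 h2; rewrite /B !asboolT.
have Boff eta t : ~ D t -> B eta t = 0 by move=> h; rewrite /B (asboolF h) andbF.
have innersum (c : T -> R[i]) (xi : T -> vec R T) eta (s : seq T) :
    (forall t, ell2 D (xi t)) -> ell2 D eta ->
    inner D eta (fun t => \sum_(i <- s) c i * xi i t) =
    \sum_(i <- s) (c i)^*%C * inner D eta (xi i).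
  move=> xi2 eta2; elim: s => [|i s ih].
    by under eq_fun do rewrite big_nil; rewrite big_nil inner0r.
  under eq_fun do rewrite big_cons; rewrite big_cons innerDr ?innerZr ?ih//.
    exact: ell2Z.
  by apply: (@ell2_sum _ _ (fun i t => c i * xi i t)) => j; exact: ell2Z.
pose d (s : T) : vec R T := if `[< D s >] then delta R s else (fun=> 0).
have d2 s : ell2 D (d s).
  by rewrite /d; case: asboolP => [/(ell2_delta R)[]//|_]; exact: (ell20 R D).1.
have BdE eta t : ell2 D eta -> B eta t = inner D eta (A (d t)).
  move=> eta2; rewrite /d; case: asboolP => Dt; first by rewrite BE.
  by rewrite Boff// (bop0 Ab) inner0r.
have Bbound eta : ell2 D eta -> ell2 D (B eta) /\ l2norm D (B eta) <= K * l2norm D eta.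
  move=> eta2; apply: ell2_bound => [t /Boff//||F].
    by rewrite mulr_ge0 ?l2norm_ge0.
  set Q := fsq _ _; have Q0 : 0 <= Q by exact: fsq_ge0.
  pose zeta : vec R T := fun t => \sum_(s <- F) B eta s * d s t.
  have zeta2 : ell2 D zeta.
    by apply: (@ell2_sum _ _ (fun i t => B eta i * d i t)) => j; exact: ell2Z.
  have zeta1 : l2norm D zeta <= Num.sqrt Q.
    have zE : zeta = vrestr (mem F) (B eta).
      apply/funext => t; rewrite /zeta /vrestr/=; case: ifPn => tF.
        rewrite (big_fsetD1 t)//= big1_fset ?addr0.
          rewrite /d; case: asboolP => Dt; first by rewrite /delta eqxx mulr1.
          by rewrite mulr0 Boff.
        move=> s; rewrite !inE => /andP[/negbTE st _] _; rewrite /d.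
        by case: asboolP; rewrite ?mulr0// /delta eq_sym st mulr0.
      rewrite big_seq big1// => s sF; rewrite /d; case: asboolP; rewrite ?mulr0//.
      by rewrite /delta; case: eqP => [ts|]; rewrite ?mulr0//; rewrite ts sF in tF.
    apply: l2norm_le => //.
    move=> F'; rewrite sqr_sqrtr// zE /fsq.
    rewrite (big_fsetID _ (mem F))/= [X in _ + X]big1_fset ?addr0; last first.
      by move=> t; rewrite !inE => /andP[_ tF] _; rewrite /vrestr/= (negbTE tF) normc0 expr0n.
    rewrite /Q /fsq; apply: le_trans (_ : _ <= \sum_(t <- F) normc (vrestr (mem F) (B eta) t) ^+ 2) _.
      apply: fset_subset_sum; first by move=> t; exact: sqr_ge0.
      by apply/fsubsetP => t; rewrite !inE => /andP[].
    by rewrite big_seq [leRHS]big_seq ler_sum// => t tF; rewrite /vrestr/= tF.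
  have AzE : inner D eta (A zeta) = (Q%:C)%C.
    rewrite /zeta (@bop_sum A _ _ (fun i t => B eta i * d i t))//; last first.
      by move=> j; exact: ell2Z.
    under eq_fun do under eq_bigr do rewrite (bopZ _ Ab (d2 _)).
    rewrite innersum//; last by move=> t; exact: bop_ell2.
    have -> : (Q%:C)%C = \sum_(t <- F) ((normc (B eta t) ^+ 2)%:C)%C.
      by rewrite /Q /fsq raddf_sum.
    apply: eq_bigr => t _.
    by rewrite modulus_sq -BdE// mulrC.
  have := inner_bound eta2 (bop_ell2 zeta Ab).
  rewrite AzE modulus_real ger0_norm//.
  have hz : l2norm D (A zeta) <= K * Num.sqrt Q.
    by rewrite (le_trans (opnorm_ub Ab zeta2))// ler_wpM2l.
  move=> /le_trans /(_ (ler_wpM2l (l2norm_ge0 D eta) hz)).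
  have [->|Qn0] := eqVneq Q 0; first by rewrite sqr_ge0.
  have sQ : 0 < Num.sqrt Q by rewrite sqrtr_gt0 lt_neqAle eq_sym Qn0.
  rewrite -{1}(sqr_sqrtr Q0) expr2 mulrCA mulrA ler_pM2r// => h.
  by rewrite -(sqr_sqrtr Q0) ler_pXn2r// nnegrE ?mulr_ge0 ?l2norm_ge0// ltW.
have Bb : bounded_op D B.
  split.
  - by move=> eta eta2; apply/funext => t; rewrite /B (asboolF eta2).
  - by move=> eta /Bbound[].
  - move=> a xi eta xi2 eta2; apply/funext => t.
    have [lin2 _] := ell2_lin a xi2 eta2.
    by rewrite !BdE// inner_lin//; exact: bop_ell2.
  - by exists K => eta /Bbound[].
exists B; last by apply: opnorm_le => // eta /Bbound[].
split => // xi eta xi2 eta2.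
have dd s : D s -> inner D (A (d s)) eta = inner D (d s) (B eta).
  move=> Ds; rewrite (inner_conj eta2 (bop_ell2 _ Ab)) -BdE//.
  rewrite (inner_conj (bop_ell2 _ Bb) (d2 s)) /d asboolT// inner_delta//.
  exact: bop_ell2.
have fin F : inner D (A (vrestr (mem F) xi)) eta = inner D (vrestr (mem F) xi) (B eta).
  have -> : vrestr (mem F) xi = (fun t => \sum_(s <- F) xi s * d s t).
    rewrite (ell2_finite _ xi2); apply/funext => t; apply: eq_bigr => s _.
    by rewrite /d; case: asboolP => // /(ell2_off xi2) ->; rewrite !mul0r.
  elim: (F : seq T) => [|s l ih].
    under eq_fun do rewrite big_nil; rewrite (bop0 Ab).
    rewrite (inner_conj eta2 (ell20 R D).1) (inner_conj (bop_ell2 eta Bb) (ell20 R D).1).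
    by rewrite !inner0r//; exact: bop_ell2.
  under eq_fun do rewrite big_cons.
  have l2 : ell2 D (fun t => \sum_(j <- l) xi j * d j t).
    by apply: (@ell2_sum _ _ (fun i t => xi i * d i t)) => j; exact: ell2Z.
  rewrite (bop_lin _ Ab)// !inner_lin ?ih//; try exact: bop_ell2.
  have [Ds|Ds] := pselect (D s); first by rewrite dd.
  by rewrite (ell2_off xi2)// !mul0r.
have xi0 := l2norm_ge0 D eta.
apply/eqP; rewrite -subr_eq0; apply/eqP/modulus_small0 => e e0.
pose L := K * l2norm D eta + K * l2norm D eta.
have L0 : 0 <= L by rewrite addr_ge0 ?mulr_ge0.
have [d0 dL] := share_le L0 e0; have [F hF] := finite_dense xi2 d0.
set rho := (fun t => _) in hF.
have v2 : ell2 D (vrestr (mem F) xi) by exact: ell2_vrestr.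
have rho2 : ell2 D rho by exact: ell2B.
have xiE : xi = (fun t => 1 * rho t + vrestr (mem F) xi t).
  by apply/funext => t; rewrite /rho; ring.
have -> : inner D (A xi) eta - inner D xi (B eta) = inner D (A rho) eta - inner D rho (B eta).
  rewrite {1 2}xiE (bop_lin _ Ab)// !inner_lin ?fin//; try exact: bop_ell2.
  ring.
rewrite (le_trans (le_normcD _ _))// normcN.
have h1 := inner_bound (bop_ell2 rho Ab) eta2.
have h2 := inner_bound rho2 (bop_ell2 eta Bb).
have h3 := opnorm_ub Ab rho2.
have [_ h4] := Bbound _ eta2.
have h5 : l2norm D (A rho) * l2norm D eta <= K * l2norm D rho * l2norm D eta.
  by rewrite ler_wpM2r.
have h6 : l2norm D rho * l2norm D (B eta) <= l2norm D rho * (K * l2norm D eta).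
  by rewrite ler_wpM2l ?l2norm_ge0.
apply: le_trans (_ : L * l2norm D rho <= e); first by rewrite /L; lra.
exact: le_trans (ler_wpM2l L0 hF) dL.
Qed.

Lemma adjoint_uniq A B B' : bounded_op D A -> is_adjoint D A B -> is_adjoint D A B' -> B = B'.
Proof.
move=> Ab [Bb h] [Bb' h']; apply: bop_ext_matrix => // s t Ds Dt.
have s2 := (ell2_delta R Ds).1; have t2 := (ell2_delta R Dt).1.
rewrite -(inner_delta (bop_ell2 _ Bb) Dt) -(inner_delta (bop_ell2 _ Bb') Dt).
by rewrite (inner_conj t2 (bop_ell2 _ Bb)) (inner_conj t2 (bop_ell2 _ Bb')) -h// -h'.
Qed.

Lemma adjP A : bounded_op D A -> is_adjoint D A (adj D A).
Proof.
by move=> /adjoint_exists[B AB _]; rewrite /adj; case: xgetP => [B' -> //|/(_ B)].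
Qed.

Lemma adjE A B : bounded_op D A -> is_adjoint D A B -> adj D A = B.
Proof. by move=> Ab AB; apply: (adjoint_uniq Ab) => //; exact: adjP. Qed.

Lemma bounded_adj A : bounded_op D A -> bounded_op D (adj D A).
Proof. by move=> /adjP[]. Qed.

Lemma opnorm_adj A : bounded_op D A -> opnorm D (adj D A) <= opnorm D A.
Proof. by move=> Ab; have [B /(adjE Ab)->] := adjoint_exists Ab. Qed.

Lemma adj_matrix A s t : bounded_op D A -> D s -> D t ->
  adj D A (delta R s) t = ((A (delta R t) s)^*)%C.
Proof.
move=> Ab Ds Dt; have [Bb h] := adjP Ab.
have s2 := (ell2_delta R Ds).1; have t2 := (ell2_delta R Dt).1.
rewrite -(inner_delta (bop_ell2 _ Bb) Dt) (inner_conj t2 (bop_ell2 _ Bb)) -h//.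
by rewrite inner_delta//; exact: bop_ell2.
Qed.

Lemma adj_lin (a : R[i]) A B : bounded_op D A -> bounded_op D B ->
  adj D (oplin a A B) = oplin (a^*)%C (adj D A) (adj D B).
Proof.
move=> Ab Bb; have [lb _] := bounded_lin a Ab Bb.
have [rb _] := bounded_lin (a^*)%C (bounded_adj Ab) (bounded_adj Bb).
apply: bop_ext_matrix => //; first exact: bounded_adj.
by move=> s t Ds Dt; rewrite adj_matrix// /oplin rmorphD rmorphM/= !adj_matrix.
Qed.

End BoundedOperators.

(** * Norm closures and block compressions *)

Section OperatorClosure.
Variables (R : realType) (T : choiceType) (D : set T).
Implicit Types (A B : operator R T) (S : set (operator R T)).

Lemma opclosure_bounded S A : opclosure D S A -> bounded_op D A.
Proof. by case. Qed.

Lemma op_eq_small A B : bounded_op D A -> bounded_op D B ->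
  (forall e : R, 0 < e -> opnorm D (oplin (-1) B A) <= e) -> A = B.
Proof.
move=> Ab Bb h; have [db _] := bounded_lin (-1) Bb Ab.
apply: (@bop_ext _ _ D) => // xi xi2; apply/funext => t.
apply/eqP; rewrite -subr_eq0; apply/eqP/modulus_small0 => e e0.
have [d0 dn] := share_le (l2norm_ge0 D xi) e0.
have := opnorm_ub db xi2; rewrite /oplin => h1.
have := modulus_le_l2norm t (bop_ell2 xi db); rewrite /oplin mulN1r addrC.
move=> /le_trans/(_ h1)/le_trans; apply.
by apply: le_trans (ler_wpM2r (l2norm_ge0 D xi) (h _ d0)) _; rewrite mulrC.
Qed.

Lemma sub_opclosure S : S `<=` bounded_op D -> S `<=` opclosure D S.
Proof.
move=> Sb A SA; have Ab := Sb _ SA; split => // e e0; exists A => //.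
rewrite (_ : oplin _ _ _ = @opzero R T); first exact: le_trans (bounded_zero R D).2 (ltW e0).
by apply/funext => xi; apply/funext => t; rewrite /oplin mulN1r addNr.
Qed.

Lemma opclosureS S S' : S `<=` S' -> opclosure D S `<=` opclosure D S'.
Proof.
by move=> SS' A [Ab h]; split => // e /h[B SB]; exists B => //; exact: SS'.
Qed.

Lemma opclosure_idem S : S `<=` bounded_op D ->
  opclosure D (opclosure D S) `<=` opclosure D S.
Proof.
move=> Sb A [Ab h]; split => // e e0.
have e2 : 0 < e / 2 by rewrite divr_gt0.
have [B [Bb h'] AB] := h _ e2; have [C SC BC] := h' _ e2; exists C => //.
have Cb := Sb _ SC.
rewrite (_ : oplin (-1) C A = oplin 1 (oplin (-1) C B) (oplin (-1) B A)); last first.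
  by apply/funext => xi; apply/funext => t; rewrite /oplin; ring.
have [cb _] := bounded_lin (-1) Cb Bb; have [bb _] := bounded_lin (-1) Bb Ab.
have [_] := bounded_lin 1 cb bb; rewrite normc1 mul1r; lra.
Qed.

(** For a product the second factor is approximated after the first one, within
    an error that depends on the norm of the chosen approximant. *)
Lemma opclosure_Cstar S : S `<=` bounded_op D -> S (@opzero R T) ->
  (forall (a : R[i]) A B, S A -> S B -> S (oplin a A B)) ->
  (forall A B, S A -> S B -> S (A \o B)) ->
  (forall A, S A -> S (adj D A)) -> Cstar_algebra D (opclosure D S).
Proof.
move=> Sb S0 Slin Scomp Sadj; split.
- by move=> A [].
- exact: sub_opclosure.
- move=> a A B [Ab hA] [Bb hB]; split; first exact: (bounded_lin a Ab Bb).1.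
  move=> e e0; have a0 := modulus_ge0 a; have e2 : 0 < e / 2 by rewrite divr_gt0.
  have [d0 da] := share_le a0 e2.
  have [A' SA' AA'] := hA _ d0; have [B' SB' BB'] := hB _ e2.
  have A'b := Sb _ SA'; have B'b := Sb _ SB'.
  exists (oplin a A' B'); first exact: Slin.
  rewrite (_ : oplin (-1) _ _ = oplin a (oplin (-1) A' A) (oplin (-1) B' B)); last first.
    by apply/funext => xi; apply/funext => t; rewrite /oplin; ring.
  have [h1 _] := bounded_lin (-1) A'b Ab; have [h2 _] := bounded_lin (-1) B'b Bb.
  have [_ /le_trans] := bounded_lin a h1 h2; apply.
  have := ler_wpM2l a0 AA'; lra.
- move=> A B [Ab hA] [Bb hB]; split; first exact: (bounded_comp Ab Bb).1.
  move=> e e0; have nB := opnorm_ge0 Bb; have e2 : 0 < e / 2 by rewrite divr_gt0.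
  have [d0 dB] := share_le nB e2; have [A' SA' AA'] := hA _ d0.
  have A'b := Sb _ SA'; have nA' := opnorm_ge0 A'b.
  have [d'0 dA'] := share_le nA' e2; have [B' SB' BB'] := hB _ d'0.
  have B'b := Sb _ SB'.
  exists (A' \o B'); first exact: Scomp.
  have [h1 _] := bounded_lin (-1) A'b Ab; have [h2 _] := bounded_lin (-1) B'b Bb.
  rewrite (_ : oplin (-1) _ _ =
    oplin 1 (oplin (-1) A' A \o B) (A' \o oplin (-1) B' B)); last first.
    apply/funext => xi; apply/funext => t; rewrite /oplin /=.
    rewrite (bop_lin (-1) A'b (bop_ell2 xi B'b) (bop_ell2 xi Bb)); ring.
  have [h3 h3'] := bounded_comp h1 Bb; have [h4 h4'] := bounded_comp A'b h2.
  have [_ /le_trans] := bounded_lin 1 h3 h4; apply.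
  rewrite normc1 mul1r.
  have := ler_wpM2r nB AA'; have := ler_wpM2l nA' BB'; lra.
split; last exact: opclosure_idem.
move=> A [Ab hA]; split; first exact: bounded_adj.
move=> e /hA[A' SA' AA']; exists (adj D A'); first exact: Sadj.
have A'b := Sb _ SA'; have [h1 _] := bounded_lin (-1) A'b Ab.
have -> : oplin (-1) (adj D A') (adj D A) = adj D (oplin (-1) A' A).
  by rewrite adj_lin// rmorphN rmorph1.
exact: le_trans (opnorm_adj h1) AA'.
Qed.

(** The commutator with a fixed operator is continuous in norm. *)
Lemma opclosure_commute S A B : S `<=` bounded_op D -> bounded_op D B ->
  (forall A', S A' -> A' \o B = B \o A') -> opclosure D S A -> A \o B = B \o A.
Proof.
move=> Sb Bb SB [Ab hA]; have [ABb _] := bounded_comp Ab Bb; have [BAb _] := bounded_comp Bb Ab.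
apply: op_eq_small => // e e0; have nB := opnorm_ge0 Bb.
have e2 : 0 < e / 2 by rewrite divr_gt0.
have [d0 dB] := share_le nB e2; have [A' SA' AA'] := hA _ d0.
have A'b := Sb _ SA'; have [h1 _] := bounded_lin (-1) A'b Ab.
have [h2 h2'] := bounded_comp h1 Bb; have [h3 h3'] := bounded_comp Bb h1.
rewrite (_ : oplin (-1) _ _ = oplin (-1) (B \o oplin (-1) A' A) (oplin (-1) A' A \o B)).
  have [_ /le_trans] := bounded_lin (-1) h3 h2; apply.
  rewrite normcN normc1 mul1r.
  have := ler_wpM2r nB AA'; have := ler_wpM2l nB AA'; lra.
apply/funext => xi; apply/funext => t; rewrite /oplin /=.
rewrite (bop_lin (-1) Bb (bop_ell2 xi A'b) (bop_ell2 xi Ab)).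
have := congr1 (fun f => f xi t) (SB _ SA') => /= ->; ring.
Qed.

End OperatorClosure.

Section Compression.
Variables (R : realType) (T K : choiceType) (D : set T) (kappa : T -> K).
Implicit Types (A B : operator R T) (xi eta : vec R T) (c : K).

Definition block c xi : vec R T := vrestr (fun s => kappa s == c) xi.

(** The block-diagonal part of [A] for the partition of the index set into the
    fibres of [kappa], that is, the sum of the [p A p] over the projections [p] onto
    the blocks. This form makes contractivity, positivity and the bimodule
    property independent of where [A] comes from. *)
Definition compress A : operator R T := fun xi t =>
  if `[< ell2 D xi >] then A (block (kappa t) xi) t else 0.

Definition block_diagonal B := forall c xi, ell2 D xi -> B (block c xi) = block c (B xi).

Lemma compressE A xi t : ell2 D xi -> compress A xi t = A (block (kappa t) xi) t.
Proof. by move=> xi2; rewrite /compress asboolT. Qed.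

Lemma ell2_block c xi : ell2 D xi -> ell2 D (block c xi).
Proof. exact: ell2_vrestr. Qed.

Lemma pythagoras (p q : T -> bool) xi : ell2 D xi -> (forall t, p t -> ~~ q t) ->
  l2norm D (vrestr p xi) ^+ 2 + l2norm D (vrestr q xi) ^+ 2 <=
  l2norm D (vrestr (fun t => p t || q t) xi) ^+ 2.
Proof.
move=> xi2 pq; apply/ler_addgt0Pr => e e0.
have e2 : 0 < e / 2 by rewrite divr_gt0.
have [_ /(_ _ e2)[F hF]] := l2norm_sup (ell2_vrestr p xi2).
have [_ /(_ _ e2)[F' hF']] := l2norm_sup (ell2_vrestr q xi2).
have := fsq_le (F `|` F')%fset (ell2_vrestr (fun t => p t || q t) xi2).
have h1 : fsq (vrestr p xi) F <= fsq (vrestr p xi) (F `|` F')%fset.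
  by apply: fset_subset_sum; [move=> t; exact: sqr_ge0 | exact: fsubsetUl].
have h2 : fsq (vrestr q xi) F' <= fsq (vrestr q xi) (F `|` F')%fset.
  by apply: fset_subset_sum; [move=> t; exact: sqr_ge0 | exact: fsubsetUr].
have -> : fsq (vrestr (fun t => p t || q t) xi) (F `|` F')%fset =
  fsq (vrestr p xi) (F `|` F')%fset + fsq (vrestr q xi) (F `|` F')%fset.
  rewrite /fsq -big_split/=; apply: eq_bigr => t _; rewrite /vrestr.
  have := pq t; case: (p t) => [/(_ isT)/negbTE ->|_] /=.
    by rewrite normc0 expr0n addr0.
  by rewrite normc0 expr0n add0r.
lra.
Qed.

Lemma sum_block_le xi (l : seq K) : ell2 D xi -> uniq l ->
  \sum_(c <- l) l2norm D (block c xi) ^+ 2 <= l2norm D xi ^+ 2.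
Proof.
move=> xi2 ul.
apply: (@le_trans _ _ (l2norm D (vrestr (fun t => kappa t \in l) xi) ^+ 2)); last first.
  by rewrite ler_pXn2r ?nnegrE ?l2norm_ge0// l2norm_vrestr.
elim: l ul => [_|c l ih /= /andP[cl ul]]; first by rewrite big_nil sqr_ge0.
rewrite big_cons (le_trans (lerD (lexx _) (ih ul)))//.
apply: le_trans (pythagoras xi2 _) _; first by move=> t /eqP ->.
rewrite le_eqVlt; apply/orP; left; apply/eqP; congr (l2norm _ _ ^+ 2).
Qed.

(** The images of distinct blocks stay in distinct blocks, so the squared norms
    add up. *)
Lemma bounded_compress A : bounded_op D A ->
  bounded_op D (compress A) /\ opnorm D (compress A) <= opnorm D A.
Proof.
move=> Ab; have nA := opnorm_ge0 Ab.
have bd xi : ell2 D xi -> ell2 D (compress A xi) /\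
    l2norm D (compress A xi) <= opnorm D A * l2norm D xi.
  move=> xi2; apply: ell2_bound.
  - by move=> t tD; rewrite compressE// (ell2_off (bop_ell2 _ Ab)).
  - by rewrite mulr_ge0 ?l2norm_ge0.
  move=> F; rewrite /fsq (partition_big_imfset _ kappa)/= exprMn.
  apply: le_trans (ler_wpM2l (sqr_ge0 _) (@sum_block_le xi (kappa @` F)%fset xi2 (fset_uniq _))).
  rewrite mulr_sumr; apply: ler_sum => c _; rewrite -exprMn.
  apply: (@le_trans _ _ (fsq (A (block c xi)) F)).
    rewrite /fsq big_mkcond/=; apply: ler_sum => t _.
    by case: eqP => [<-|_]; [rewrite compressE | exact: sqr_ge0].
  rewrite (le_trans (fsq_le _ (bop_ell2 _ Ab)))//.
  rewrite ler_pXn2r ?nnegrE ?mulr_ge0 ?l2norm_ge0//.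
  by apply: opnorm_ub => //; exact: ell2_block.
have b : bounded_op D (compress A).
  split.
  - by move=> xi xi2; apply/funext => t; rewrite /compress asboolF.
  - by move=> xi /bd[].
  - move=> a xi eta xi2 eta2; apply/funext => t.
    have [l2 _] := ell2_lin a xi2 eta2; rewrite !compressE//.
    have -> : block (kappa t) (fun t0 => a * xi t0 + eta t0) =
        (fun s => a * block (kappa t) xi s + block (kappa t) eta s).
      by apply/funext => s; rewrite /block /vrestr; case: ifP; rewrite ?mulr0 ?addr0.
    by rewrite (bop_lin a Ab)//; exact: ell2_block.
  - by exists (opnorm D A) => xi /bd[].
by split => //; apply: opnorm_le => // xi /bd[].
Qed.

Lemma compress_lin (a : R[i]) A B : compress (oplin a A B) = oplin a (compress A) (compress B).
Proof.
apply/funext => xi; apply/funext => t; rewrite /oplin /compress.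
by case: ifP; rewrite ?mulr0 ?addr0.
Qed.

Lemma compress_block A c xi : ell2 D xi -> block c (compress A xi) = block c (A (block c xi)).
Proof.
move=> xi2; apply/funext => t; rewrite /block /vrestr; case: eqP => // <-.
by rewrite compressE.
Qed.

Lemma compress_bimodule B A B' : bounded_op D B -> bounded_op D A -> bounded_op D B' ->
  block_diagonal B -> block_diagonal B' ->
  compress (B \o A \o B') = B \o compress A \o B'.
Proof.
move=> Bb Ab B'b Bd B'd.
have [BAb _] := bounded_comp Bb Ab; have [BABb _] := bounded_comp BAb B'b.
have [cAb _] := bounded_compress Ab; have [lb _] := bounded_compress BABb.
have [Bc _] := bounded_comp Bb cAb; have [rb _] := bounded_comp Bc B'b.
apply: (@bop_ext _ _ D) => // xi xi2; apply/funext => t; rewrite compressE//=.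
have atk eta : eta t = block (kappa t) eta t by rewrite /block /vrestr eqxx.
rewrite atk [RHS]atk -!Bd; try exact: bop_ell2.
by rewrite compress_block ?B'd//; exact: bop_ell2.
Qed.

Lemma compress_id B : bounded_op D B -> block_diagonal B -> compress B = B.
Proof.
move=> Bb Bd; apply: (@bop_ext _ _ D) => //; first exact: (bounded_compress Bb).1.
move=> xi xi2; apply/funext => t; rewrite compressE// Bd//.
by rewrite /block /vrestr eqxx.
Qed.

Lemma block_diagonal_matrix B : bounded_op D B ->
  (forall s t, D s -> D t -> kappa s != kappa t -> B (delta R s) t = 0) ->
  compress B = B.
Proof.
move=> Bb B0; apply: (@bop_ext_matrix _ _ D) => //; first exact: (bounded_compress Bb).1.
move=> s t Ds Dt; rewrite compressE; last exact: (ell2_delta R Ds).1.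
have [st|st] := eqVneq (kappa s) (kappa t).
  congr (B _ t); apply/funext => u; rewrite /block /vrestr /delta.
  by case: eqP => // ut; case: (eqVneq u s) => // us; rewrite us st in ut.
rewrite B0// (_ : block _ _ = (fun=> 0)) ?(bop0 Bb)//.
apply/funext => u; rewrite /block /vrestr /delta.
by case: eqP => // ut; case: (eqVneq u s) => // us; rewrite -us ut eqxx in st.
Qed.

(** Being block diagonal means commuting with the projections onto the blocks. *)
Lemma block_diagonal_closure S A : S `<=` bounded_op D ->
  (forall B, S B -> block_diagonal B) -> opclosure D S A -> block_diagonal A.
Proof.
move=> Sb Sd AS c; have Ab := opclosure_bounded AS.
pose Q : operator R T := fun xi t => if `[< ell2 D xi >] then block c xi t else 0.
have QE xi : ell2 D xi -> Q xi = block c xi.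
  by move=> xi2; apply/funext => t; rewrite /Q asboolT.
have Qb : bounded_op D Q.
  split.
  - by move=> xi xi2; apply/funext => t; rewrite /Q asboolF.
  - by move=> xi xi2; rewrite QE//; exact: ell2_block.
  - move=> a xi eta xi2 eta2; have [l2 _] := ell2_lin a xi2 eta2; rewrite !QE//.
    by apply/funext => s; rewrite /block /vrestr; case: ifP; rewrite ?mulr0 ?addr0.
  - by exists 1 => xi xi2; rewrite QE// mul1r; exact: l2norm_vrestr.
have cQ : A \o Q = Q \o A.
  apply: (opclosure_commute Sb Qb _ AS) => B SB.
  have Bb := Sb _ SB; apply: (@bop_ext _ _ D); [exact: (bounded_comp _ _).1..|].
  move=> xi xi2 /=; rewrite !QE//; first exact: Sd.
  exact: bop_ell2.
move=> xi xi2; have := congr1 (@^~ xi) cQ; rewrite /= !QE//.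
exact: bop_ell2.
Qed.

(** On a finitely supported vector the quadratic form of the compression is a
    finite sum of values of the form of [A], one for each block. *)
Lemma positive_compress A : bounded_op D A -> positive_op D A -> positive_op D (compress A).
Proof.
move=> Ab Ap xi xi2; have [cb _] := bounded_compress Ab.
have fin (F : {fset T}) : 0 <= inner D (compress A (vrestr (mem F) xi)) (vrestr (mem F) xi).
  set eta := vrestr (mem F) xi; have eta2 : ell2 D eta by exact: ell2_vrestr.
  have innE zeta p : ell2 D zeta -> inner D zeta (vrestr p eta) =
      \sum_(t <- F) zeta t * (vrestr p eta t)^*%C.
    move=> z2; apply: (has_sum_uniq (has_sum_inner z2 (ell2_vrestr p eta2))).
    apply: has_sum_finite => t /negbTE tF.
    by rewrite /eta /vrestr /= tF if_same conjc0 mulr0.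
  have -> : inner D (compress A eta) eta =
      \sum_(c <- (kappa @` F)%fset) inner D (A (block c eta)) (block c eta).
    have {2}-> : eta = vrestr xpredT eta by [].
    rewrite innE; last exact: bop_ell2.
    rewrite (partition_big_imfset _ kappa)/=; apply: eq_bigr => c _.
    rewrite [in RHS]/block innE; last exact: bop_ell2.
    rewrite big_mkcond/=; apply: eq_bigr => t _.
    have vE p : vrestr p eta t = if p t then eta t else 0 by [].
    rewrite !vE; case: eqP => [<-|_]; last by rewrite conjc0 mulr0.
    by rewrite compressE.
  by apply: sumr_ge0 => c _; apply: Ap; exact: ell2_block.
apply: ge0_closed => e e0.
have nx := l2norm_ge0 D xi; have nc := opnorm_ge0 cb.
pose L := opnorm D (compress A) * l2norm D xi + opnorm D (compress A) * l2norm D xi.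
have L0 : 0 <= L by rewrite addr_ge0 ?mulr_ge0.
have [d0 dL] := share_le L0 e0; have [F hF] := finite_dense xi2 d0.
exists (inner D (compress A (vrestr (mem F) xi)) (vrestr (mem F) xi)) => //.
set rho := (fun t => _) in hF; set xiF := vrestr _ _.
have f2 : ell2 D xiF by exact: ell2_vrestr.
have rho2 : ell2 D rho by exact: ell2B.
have xiE : xi = (fun t => rho t + xiF t).
  by apply/funext => t; rewrite /rho /xiF; ring.
have -> : inner D (compress A xiF) xiF - inner D (compress A xi) xi =
   - inner D (compress A rho) xi - inner D (compress A xiF) rho.
  have -> : inner D (compress A xi) xi = inner D (compress A rho) xi + inner D (compress A xiF) xi.
    by rewrite {1}xiE (bopD cb)// innerDl//; exact: bop_ell2.
  have -> : inner D (compress A xiF) xi = inner D (compress A xiF) rho + inner D (compress A xiF) xiF.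
    by rewrite {1}xiE innerDr//; exact: bop_ell2.
  ring.
rewrite (le_trans (le_normcD _ _))// !normcN.
have h1 := inner_bound (bop_ell2 rho cb) xi2.
have h2 := inner_bound (bop_ell2 xiF cb) rho2.
have h3 := opnorm_ub cb rho2.
have h4 := opnorm_ub cb f2.
have h5 : l2norm D xiF <= l2norm D xi by exact: l2norm_vrestr.
have h6 := ler_wpM2r nx h3.
have h7 := ler_wpM2r (l2norm_ge0 D rho) (le_trans h4 (ler_wpM2l nc h5)).
apply: le_trans (_ : L * l2norm D rho <= e); first by rewrite /L; lra.
exact: le_trans (ler_wpM2l L0 hF) dL.
Qed.

(** The diagonal entries of [A^* A] are the squared norms of the columns of [A],
    and compression does not change the diagonal. *)
Lemma compress_faithful A : bounded_op D A ->
  compress (adj D A \o A) = @opzero R T -> A = @opzero R T.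
Proof.
move=> Ab h; apply: (@bop_ext_matrix _ _ D) => //; first exact: (bounded_zero R D).1.
move=> s t Ds _; have [d2 _] := ell2_delta R Ds; have [aAb aA] := adjP Ab.
have A2 := bop_ell2 (delta R s) Ab.
suff -> : A (delta R s) = (fun=> 0) by [].
apply: (inner_self0 A2); rewrite aA// (inner_conj (bop_ell2 _ aAb) d2) inner_delta//; last first.
  exact: bop_ell2.
have := congr1 (fun f => f (delta R s) s) h; rewrite compressE//= => hs.
rewrite (_ : block (kappa s) (delta R s) = delta R s) in hs; last first.
  apply/funext => u; rewrite /block /vrestr /delta.
  by case: eqP => // us; case: (eqVneq u s) => // us'; rewrite us' in us.
by rewrite hs conjc0.
Qed.

End Compression.

(** * Groupoids with a base of compact open bisections *)

Record groupoid_laws (T : Type) (G : groupoid_data T) : Prop := GroupoidLaws {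
  arrows_rng : forall a, arrows G a -> arrows G (grng G a);
  arrows_src : forall a, arrows G a -> arrows G (gsrc G a);
  arrows_inv : forall a, arrows G a -> arrows G (ginv G a);
  arrows_mul : forall a b, arrows G a -> arrows G b -> gsrc G a = grng G b ->
    arrows G (gmul G a b);
  rng_mul : forall a b, grng G (gmul G a b) = grng G a;
  src_mul : forall a b, gsrc G (gmul G a b) = gsrc G b;
  rng_inv : forall a, grng G (ginv G a) = gsrc G a;
  src_inv : forall a, gsrc G (ginv G a) = grng G a;
  rng_rng : forall a, grng G (grng G a) = grng G a;
  src_rng : forall a, gsrc G (grng G a) = grng G a;
  rng_src : forall a, grng G (gsrc G a) = gsrc G a;
  src_src : forall a, gsrc G (gsrc G a) = gsrc G a;
  gpd_mulA : forall a b c, arrows G a -> arrows G b -> arrows G c ->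
    gsrc G a = grng G b -> gsrc G b = grng G c ->
    gmul G a (gmul G b c) = gmul G (gmul G a b) c;
  gpd_mul1 : forall a, arrows G a -> gmul G (grng G a) a = a;
  gpd_mulr1 : forall a, arrows G a -> gmul G a (gsrc G a) = a;
  gpd_mulV : forall a, arrows G a -> gmul G a (ginv G a) = grng G a;
  gpd_mulVl : forall a, arrows G a -> gmul G (ginv G a) a = gsrc G a }.

Section GroupoidAlgebra.
Variables (T : Type) (G : groupoid_data T).
Hypothesis gl : groupoid_laws G.
Local Notation D := (arrows G).
Local Notation r := (grng G).
Local Notation s := (gsrc G).
Local Notation "a ** b" := (gmul G a b) (at level 40, left associativity).
Local Notation "a ^v" := (ginv G a) (at level 2, format "a ^v").

Let DV a : D a -> D a^v. Proof. exact: (arrows_inv gl). Qed.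

Lemma gpd_mulVK a b : D a -> D b -> r a = r b -> a ** (a^v ** b) = b.
Proof.
move=> Da Db ab; rewrite (gpd_mulA gl)//; first by rewrite (gpd_mulV gl)// ab (gpd_mul1 gl).
- exact: DV.
- by rewrite (rng_inv gl).
- by rewrite (src_inv gl).
Qed.

Lemma gpd_mulKV a b : D a -> D b -> s a = r b -> a^v ** (a ** b) = b.
Proof.
move=> Da Db ab; rewrite (gpd_mulA gl)//; first by rewrite (gpd_mulVl gl)// ab (gpd_mul1 gl).
- exact: DV.
- by rewrite (src_inv gl).
Qed.

Lemma gpd_mulK a b : D a -> D b -> s a = r b -> (a ** b) ** b^v = a.
Proof.
move=> Da Db ab; rewrite -(gpd_mulA gl)//; first by rewrite (gpd_mulV gl)// -ab (gpd_mulr1 gl).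
- exact: DV.
- by rewrite (rng_inv gl).
Qed.

Lemma gpd_mulKr a b : D a -> D b -> s a = s b -> (a ** b^v) ** b = a.
Proof.
move=> Da Db ab; rewrite -(gpd_mulA gl)//; first by rewrite (gpd_mulVl gl)// -ab (gpd_mulr1 gl).
- exact: DV.
- by rewrite (rng_inv gl).
- by rewrite (src_inv gl).
Qed.

Lemma gpd_inv_uniq a b : D a -> D b -> s a = r b -> a ** b = r a -> b = a^v.
Proof.
move=> Da Db ab h; rewrite -(gpd_mulKV Da Db ab) h -(src_inv gl).
by rewrite (gpd_mulr1 gl)//; exact: (arrows_inv gl).
Qed.

Lemma gpd_invK a : D a -> (a^v)^v = a.
Proof.
move=> Da; apply/esym/gpd_inv_uniq => //; first exact: (arrows_inv gl).
  by rewrite (src_inv gl).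
by rewrite (gpd_mulVl gl)// (rng_inv gl).
Qed.

Lemma gpd_invM a b : D a -> D b -> s a = r b -> (a ** b)^v = b^v ** a^v.
Proof.
move=> Da Db ab; have iDa := arrows_inv gl Da; have iDb := arrows_inv gl Db.
apply/esym/gpd_inv_uniq; first exact: (arrows_mul gl).
- by apply: (arrows_mul gl) => //; rewrite (src_inv gl) (rng_inv gl).
- by rewrite (src_mul gl) (rng_mul gl) (rng_inv gl).
rewrite (gpd_mulA gl)//; first by rewrite gpd_mulK// (gpd_mulV gl)// (rng_mul gl).
- exact: (arrows_mul gl).
- by rewrite (src_mul gl) (rng_inv gl).
- by rewrite (src_inv gl) (rng_inv gl).
Qed.

Lemma arrows_quot a b : D a -> D b -> s a = s b -> D (a ** b^v).
Proof. by move=> Da Db ab; apply: (arrows_mul gl) => //; [exact: (arrows_inv gl)|rewrite (rng_inv gl)]. Qed.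

Lemma arrows_lquot a b : D a -> D b -> r a = r b -> D (a^v ** b).
Proof. by move=> Da Db ab; apply: (arrows_mul gl) => //; [exact: (arrows_inv gl)|rewrite (src_inv gl)]. Qed.

End GroupoidAlgebra.

(** An ample groupoid, presented by a base of compact open bisections stable
    under products and inverses. Points of the ambient space that are not arrows
    have no prescribed neighbourhoods, hence closedness is relative to the
    arrows. *)
Record ample_base (T : topologicalType) (G : groupoid_data T)
    (base : set (set T)) : Prop := AmpleBase {
  base_sub : forall U, base U -> U `<=` arrows G;
  base_rinj : forall U a b, base U -> U a -> U b -> grng G a = grng G b -> a = b;
  base_sinj : forall U a b, base U -> U a -> U b -> gsrc G a = gsrc G b -> a = b;
  base_nbhs : forall a W, arrows G a ->
    (nbhs a W <-> exists2 U, base U & U a /\ U `<=` W);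
  base_mul : forall U V a b, base U -> base V -> U a -> V b -> gsrc G a = grng G b ->
    base [set c | exists a b, [/\ U a, V b, gsrc G a = grng G b & c = gmul G a b]];
  base_inv : forall U, base U -> base [set ginv G a | a in U];
  base_compact : forall U, base U -> compact U;
  base_closed : forall U a, base U -> arrows G a -> ~ U a ->
    exists2 V, base V & V a /\ forall b, V b -> ~ U b;
  base_unit : forall a, arrows G a -> exists2 W, base W &
    W (grng G a) /\ forall b, W b -> grng G b = b;
  base_sep : forall a b, arrows G a -> arrows G b -> a <> b ->
    exists2 U, base U & U a /\ ~ U b }.

Lemma normE_modulus (R : realType) (z : R[i]) : `|z| = ((normc z)%:C)%C.
Proof. by rewrite normc_def; case: z. Qed.

Lemma complex_cvgP (R : realType) (T : Type) (F : set_system T) (f : T -> R[i]) (l : R[i]) :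
  Filter F -> ((f : T -> R[i]^o) @ F --> (l : R[i]^o)) <->
  (forall e : R, 0 < e -> \forall t \near F, normc (f t - l) <= e).
Proof.
move=> FF; split=> [/cvgrPdist_le h e e0|h].
  have := h (e%:C)%C; rewrite ltcR => /(_ e0); apply: filterS => t.
  by rewrite distrC normE_modulus lecR.
apply/cvgrPdist_le => eps; rewrite ltcE/= => /andP[/eqP im0 re0].
have epsE : eps = ((complex.Re eps)%:C)%C by case: eps im0 {re0} => x y /= ->.
rewrite epsE; apply: filterS (h _ re0) => t.
by rewrite distrC normE_modulus lecR.
Qed.

Section Convolution.
Variables (R : realType) (T : topologicalType) (G : groupoid_data T).
Variable base : set (set T).
Hypotheses (gl : groupoid_laws G) (ab : ample_base G base).
Local Notation D := (arrows G).
Local Notation r := (grng G).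
Local Notation s := (gsrc G).
Local Notation "a ** b" := (gmul G a b) (at level 40, left associativity).
Local Notation "a ^v" := (ginv G a) (at level 2, format "a ^v").
Implicit Types (f g h : T -> R[i]) (a b c : T) (U V W : set T) (S : set T).

Lemma base_nbhs1 U a : base U -> U a -> nbhs a U.
Proof.
move=> bU Ua; apply/(base_nbhs ab _ (base_sub ab bU Ua)).
by exists U => //; split => // b.
Qed.

Lemma base_inter U V a : base U -> base V -> U a -> V a ->
  exists2 W, base W & W a /\ forall b, W b -> U b /\ V b.
Proof.
move=> bU bV Ua Va.
have /(base_nbhs ab _ (base_sub ab bU Ua))[W bW [Wa WUV]] : nbhs a (U `&` V).
  by apply: filterI; exact: base_nbhs1.
by exists W => //; split => // b /WUV.
Qed.

Lemma base_at a : D a -> exists2 U, base U & U a.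
Proof.
by move=> Da; have /(base_nbhs ab _ Da)[U bU [Ua _]] : nbhs a setT by [exact: filterT]; exists U.
Qed.

Definition locally_continuous f := forall a, D a -> forall e : R, 0 < e ->
  exists2 U, base U & U a /\ forall b, U b -> normc (f b - f a) <= e.

Definition zero_off S f : T -> R[i] := fun a => if `[< S a >] then f a else 0.

Definition rel_clopen S := (forall a, S a -> exists2 U, base U & U a /\ U `<=` S) /\
  (forall a, D a -> ~ S a -> exists2 U, base U & U a /\ forall b, U b -> ~ S b).

Lemma base_clopen U : base U -> rel_clopen U.
Proof.
move=> bU; split => [a Ua|a Da Ua]; first by exists U => //; split => // b.
exact: (base_closed ab).
Qed.

Lemma locally_continuous_restrict S f : rel_clopen S -> locally_continuous f ->
  locally_continuous (zero_off S f).
Proof.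
move=> [So Sc] fc a Da e e0.
have [Sa|Sa] := pselect (S a).
  have [U bU [Ua US]] := So _ Sa; have [V bV [Va hV]] := fc _ Da _ e0.
  have [W bW [Wa WUV]] := base_inter bU bV Ua Va.
  exists W => //; split => // b /WUV[/US Sb /hV]; by rewrite /zero_off !asboolT.
have [U bU [Ua US]] := Sc _ Da Sa; exists U => //; split => // b /US Sb.
by rewrite /zero_off !asboolF// subrr normc0 ltW.
Qed.

Lemma locally_continuousD f g : locally_continuous f -> locally_continuous g ->
  locally_continuous (fun a => f a + g a).
Proof.
move=> fc gc a Da e e0; have e2 : 0 < e / 2 by rewrite divr_gt0.
have [U bU [Ua hU]] := fc _ Da _ e2; have [V bV [Va hV]] := gc _ Da _ e2.
have [W bW [Wa WUV]] := base_inter bU bV Ua Va.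
exists W => //; split => // b /WUV[/hU h1 /hV h2].
rewrite opprD addrACA (le_trans (le_normcD _ _))//; lra.
Qed.

(** Convolution by a function carried by one bisection is given by a single term,
    which is why [Cc S] is handled through sums of such functions. *)
Definition bisection_fun S f := exists2 U, base U &
  [/\ forall a, f a != 0 -> S a /\ U a, locally_continuous f &
      exists K : R, forall a, normc (f a) <= K].

Inductive bisection_sum S : (T -> R[i]) -> Prop :=
| BSum0 : bisection_sum S (fun=> 0)
| BSumS f g : bisection_fun S f -> bisection_sum S g ->
    bisection_sum S (fun a => f a + g a).

Lemma bisection_sum1 S f : bisection_fun S f -> bisection_sum S f.
Proof.
move=> hf; rewrite (_ : f = (fun a => f a + 0)); first exact: (BSumS hf (BSum0 S)).
by apply/funext => a; rewrite addr0.
Qed.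

Lemma bisection_sumD S f g : bisection_sum S f -> bisection_sum S g ->
  bisection_sum S (fun a => f a + g a).
Proof.
move=> hf hg; elim: hf => [|f1 f2 hf1 _ ih].
  by under eq_fun do rewrite add0r.
by under eq_fun do rewrite -addrA; exact: BSumS.
Qed.

Lemma bisection_sumZ S (c : R[i]) f : bisection_sum S f ->
  bisection_sum S (fun a => c * f a).
Proof.
elim=> [|f1 f2 hf1 _ ih].
  by under eq_fun do rewrite mulr0; exact: BSum0.
under eq_fun do rewrite mulrDr; apply: BSumS => //.
case: hf1 => U bU [fU fc [K fK]]; exists U => //; split.
- by move=> a; rewrite mulf_eq0 negb_or => /andP[_ /fU].
- move=> a Da e e0; have nc := modulus_ge0 c.
  have [d0 dc] := share_le nc e0; have [V bV [Va hV]] := fc _ Da _ d0.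
  exists V => //; split => // b /hV h; rewrite -mulrBr normcM.
  exact: le_trans (ler_wpM2l nc h) dc.
- by exists (normc c * K) => a; rewrite normcM ler_wpM2l ?modulus_ge0.
Qed.

Lemma bisection_sumS S S' f : S `<=` S' -> bisection_sum S f -> bisection_sum S' f.
Proof.
move=> SS'; elim=> [|f1 f2 [U bU [fU fc fK]] _ ih]; first exact: BSum0.
by apply: BSumS => //; exists U => //; split => // a /fU[/SS'].
Qed.

Lemma bisection_sum_off S f a : bisection_sum S f -> ~ S a -> f a = 0.
Proof.
move=> hf Sa; elim: hf => [//|f1 f2 [U bU [fU _ _]] _ ->].
by rewrite addr0; apply/eqP/negP => /negP /fU[].
Qed.

Lemma bisection_sum_supp S f a : bisection_sum S f -> f a != 0 -> S a.
Proof.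
move=> hf fa; apply: contrapT => /(bisection_sum_off hf) fa0.
by rewrite fa0 eqxx in fa.
Qed.

Lemma bisection_sum_continuous S f : bisection_sum S f -> locally_continuous f.
Proof.
elim=> [a Da e e0|f1 f2 [U bU [_ fc _]] _ ih]; last exact: locally_continuousD.
have [U bU Ua] := base_at Da.
by exists U => //; split => // b _; rewrite subrr normc0 ltW.
Qed.

Lemma bisection_sum_cover S f : bisection_sum S f -> exists2 l : seq (set T),
  (forall U, U \in l -> base U) & forall a, f a != 0 -> exists2 U, U \in l & U a.
Proof.
elim=> [|f1 f2 [U bU [fU _ _]] _ [l lb lc]]; first by exists [::] => // a; rewrite eqxx.
exists (U :: l); first by move=> V; rewrite in_cons => /orP[/eqP ->//|/lb].
move=> a fa; have [f1a|f1a] := eqVneq (f1 a) 0.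
  by have [|V Vl Va] := lc a; [rewrite f1a add0r in fa|exists V; rewrite // in_cons Vl orbT].
by exists U; [rewrite mem_head|case: (fU _ f1a)].
Qed.

Lemma bisection_sum_restrict S S' f : rel_clopen S' -> bisection_sum S f ->
  bisection_sum (S `&` S') (zero_off S' f).
Proof.
move=> clS; elim=> [|f1 f2 [U bU [fU fc [K fK]]] _ ih].
  rewrite (_ : zero_off _ _ = (fun=> 0)); first exact: BSum0.
  by apply/funext => a; rewrite /zero_off if_same.
rewrite (_ : zero_off _ _ = (fun a => zero_off S' f1 a + zero_off S' f2 a)); last first.
  by apply/funext => a; rewrite /zero_off; case: ifP; rewrite ?addr0.
apply: BSumS => //; exists U => //; split.
- move=> a; rewrite /zero_off; case: asboolP; last by rewrite eqxx.
  by move=> ? /fU[].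
- exact: locally_continuous_restrict.
- exists K => a; rewrite /zero_off; case: ifP => // _; rewrite normc0.
  exact: le_trans (modulus_ge0 _) (fK a).
Qed.

(** Otherwise the complements of the finite unions generate a proper filter on
    [A], and a cluster point of it lies in no neighbourhood from the family. *)
Lemma compact_finite_cover (A : set T) (fam : set (set T)) : compact A ->
  (forall a, A a -> exists2 U, fam U & nbhs a U) ->
  exists2 l : seq (set T), (forall U, U \in l -> fam U) &
    forall a, A a -> exists2 U, U \in l & U a.
Proof.
move=> Ac Afam; apply: contrapT => nocover.
pose good (l : seq (set T)) := forall U, U \in l -> fam U.
pose rest (l : seq (set T)) := [set a | A a /\ forall U, U \in l -> ~ U a].
pose F : set_system T := [set B | exists2 l, good l & rest l `<=` B].
have FF : ProperFilter F.
  split.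
    move=> [l lg le]; apply: nocover; exists l => // a Aa.
    apply: contrapT => h; apply: (le a); split => // U Ul Ua; apply: h; by exists U.
  split.
  - by exists [::].
  - move=> P Q [l lg lP] [l' lg' lQ]; exists (l ++ l').
      by move=> U; rewrite mem_cat => /orP[/lg|/lg'].
    move=> a [Aa h]; split; [apply: lP|apply: lQ]; split => // U Ul; apply: h;
      by rewrite mem_cat Ul ?orbT.
  - by move=> P Q PQ [l lg lP]; exists l => // a /lP/PQ.
have FA : F A by exists [::] => // a [].
have [a [Aa cla]] := Ac _ FF FA.
have [U famU nU] := Afam _ Aa.
have [|b [[_ /(_ U)]]] := cla (rest [:: U]) U _ nU.
  by exists [:: U] => // V; rewrite inE => /eqP ->.
by rewrite mem_head => /(_ isT).
Qed.

Lemma relopen_open S : (forall a, S a -> exists2 U, base U & U a /\ U `<=` S) -> open S.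
Proof.
move=> So; rewrite openE => a /So[U bU [Ua US]].
by apply/(base_nbhs ab _ (base_sub ab bU Ua)); exists U.
Qed.

(** Bisections of the base are closed as well as open, so the function is cut along
    the members of the cover one after the other without losing continuity. *)
Lemma cover_bisection_sum S f (l : seq (set T)) : locally_continuous f ->
  (forall a, f a != 0 -> S a) ->
  (forall U, U \in l -> base U /\ exists K : R, forall a, U a -> normc (f a) <= K) ->
  (forall a, f a != 0 -> exists2 U, U \in l & U a) -> bisection_sum S f.
Proof.
elim: l f => [|U l ih] f fc fS lb lc.
  rewrite (_ : f = (fun=> 0)); first exact: BSum0.
  by apply/funext => a; apply/eqP/negP => /negP /lc[].
have [bU [K UK]] := lb _ (mem_head _ _).
have clU := base_clopen bU.
pose fU := zero_off U f; pose g := fun a => if `[< U a >] then 0 else f a.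
have -> : f = (fun a => fU a + g a).
  by apply/funext => a; rewrite /fU /g /zero_off; case: ifP; rewrite ?addr0 ?add0r.
have fUc : locally_continuous fU by exact: locally_continuous_restrict.
apply: BSumS.
  exists U => //; split => //.
  - move=> a; rewrite /fU /zero_off; case: asboolP; last by rewrite eqxx.
    by move=> Ua /fS.
  - exists `|K| => a; rewrite /fU /zero_off; case: asboolP => [/UK h|_].
      exact: le_trans h (ler_norm _).
    by rewrite normc0.
have g0 a : g a != 0 -> f a != 0 /\ ~ U a.
  by rewrite /g; case: asboolP => //; rewrite eqxx.
apply: ih.
- rewrite (_ : g = fun a => f a + -1 * fU a); last first.
    apply/funext => a; rewrite /fU /g /zero_off; case: ifP => _; rewrite ?mulr0 ?addr0//.
    by rewrite mulN1r subrr.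
  apply: locally_continuousD => //.
  move=> a Da e /(fUc a Da)[V bV [Va hV]]; exists V => //; split => // b /hV.
  by rewrite -mulrBr normcM normcN normc1 mul1r.
- by move=> a /g0[/fS].
- move=> V Vl; have [|bV [KV hV]] := lb V; first by rewrite in_cons Vl orbT.
  split => //; exists `|KV| => a /hV h; rewrite /g; case: ifP => _.
    by rewrite normc0.
  exact: le_trans h (ler_norm _).
- move=> a /g0[fa Ua]; have [V Vl Va] := lc _ fa; exists V => //.
  by move: Vl; rewrite in_cons => /orP[/eqP VU|//]; rewrite VU in Va.
Qed.

(** Towards a sum, a finite cover of the compact support by bisections on which [f]
    is bounded is extracted. Conversely the support meets [S] in a closed part of
    a finite union of compact bisections. *)
Lemma CcP S f : S `<=` D -> rel_clopen S -> Cc S f <-> bisection_sum S f.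
Proof.
move=> SD [So Sc]; split.
  move=> [f0 fcont fcomp].
  have fS a : f a != 0 -> S a.
    by move=> fa; apply: contrapT => /f0 fa0; rewrite fa0 eqxx in fa.
  have fc : locally_continuous f.
    move=> a Da e e0; have [Sa|Sa] := pselect (S a); last first.
      have [U bU [Ua US]] := Sc _ Da Sa; exists U => //; split => // b /US Sb.
      by rewrite !f0// subrr normc0 ltW.
    have [U bU [Ua US]] := So _ Sa.
    have /complex_cvgP/(_ e e0) := (subspace_continuousP S (f : T -> R[i]^o)).1 fcont a Sa.
    rewrite near_withinE => /(base_nbhs ab _ Da)[V bV [Va hV]].
    have [W bW [Wa WUV]] := base_inter bU bV Ua Va.
    by exists W => //; split => // b /WUV[/US Sb /hV]; exact.
  (* boundedness comes from the oscillation bound with [e = 1] *)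
  pose fam U := base U /\ exists K : R, forall a, U a -> normc (f a) <= K.
  have [|l lfam lc] := compact_finite_cover fcomp (fam := fam).
    move=> a [Sa _]; have [U bU [Ua hU]] := fc _ (SD _ Sa) 1 ltr01.
    exists U; last exact: base_nbhs1.
    split => //; exists (normc (f a) + 1) => b /hU h.
    rewrite (_ : f b = f a + (f b - f a)); last by rewrite addrC subrK.
    by rewrite (le_trans (le_normcD _ _))// lerD2l.
  apply: (cover_bisection_sum (l := l)) => // a fa; apply: lc; split; first exact: fS.
  exact: subset_closure.
move=> hf; have [l lb lc] := bisection_sum_cover hf; split.
- by move=> a; exact: bisection_sum_off.
- apply/subspace_continuousP => a Sa; apply/complex_cvgP => e e0.
  have [U bU [Ua hU]] := bisection_sum_continuous hf (SD _ Sa) e0.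
  rewrite near_withinE; apply/(base_nbhs ab _ (SD _ Sa)); exists U => //.
  by split => // b /hU.
set N := [set gam | _].
(* [S] is closed among the arrows only; what is closed in the whole space is the
   complement of [D `\` S] *)
have -> : S `&` closure N = \big[setU/set0]_(U <- l) (U `&` (closure N `&` ~` (D `\` S))).
  apply/seteqP; split => a.
    move=> [Sa Na]; rewrite -bigcup_seq.
    have [[U Ul Ua]|nU] := pselect (exists2 U, U \in l & U a).
      by exists U => //; split => //; split => // -[].
    exfalso; have Da := SD _ Sa.
    have [V bV [Va hV]] : exists2 V, base V & V a /\ forall b U, V b -> U \in l -> ~ U b.
      have {Na} : forall U, U \in l -> ~ U a by move=> U Ul Ua; apply: nU; exists U.
      elim: (l) lb => [_ _|U l' ih lb na].
        by have [V bV Va] := base_at Da; exists V.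
      have [||V bV [Va hV]] := ih.
      - by move=> W Wl; apply: lb; rewrite in_cons Wl orbT.
      - by move=> W Wl; apply: na; rewrite in_cons Wl orbT.
      have [||V' bV' [V'a hV']] := @base_closed _ _ _ ab U a _ Da; first by apply: lb; rewrite mem_head.
        by apply: na; rewrite mem_head.
      have [W bW [Wa WVV]] := base_inter bV bV' Va V'a.
      exists W => //; split => // b X /WVV[Vb V'b]; rewrite in_cons => /orP[/eqP ->|].
        exact: hV'.
      exact: hV.
    have [|b [Nb Vb]] := Na V; first exact: base_nbhs1.
    by have [U Ul Ub] := lc _ Nb; exact: hV Ub.
  rewrite -bigcup_seq => -[U /= Ul [Ua [Na nS]]]; split => //.
  apply: contrapT => Sa; apply: nS; split => //.
  exact: (base_sub ab (lb _ Ul)).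
rewrite big_seq; apply: bigsetU_compact => U Ul; apply: compact_closedI.
  exact: (base_compact ab (lb _ Ul)).
apply: closedI; first exact: closed_closure.
rewrite closedC; apply: relopen_open => a [Da Sa].
have [V bV [Va hV]] := Sc _ Da Sa; exists V => //; split => // b Vb.
by split; [exact: (base_sub ab bV) | exact: hV].
Qed.

End Convolution.

(** * Convolution operators *)

Section ConvolutionOperators.
Variables (R : realType) (T : topologicalType) (G : groupoid_data T).
Variable base : set (set T).
Hypotheses (gl : groupoid_laws G) (ab : ample_base G base).
Local Notation D := (arrows G).
Local Notation r := (grng G).
Local Notation s := (gsrc G).
Local Notation "a ** b" := (gmul G a b) (at level 40, left associativity).
Local Notation "a ^v" := (ginv G a) (at level 2, format "a ^v").
Implicit Types (f g h : T -> R[i]) (a b c : T) (U V W : set T) (S : set T).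
Local Notation bsum := (@bisection_sum R T G base).
Local Notation bfun := (@bisection_fun R T G base).

Definition fibre_finite f := forall c, finite_set [set a | [/\ D a, r a = r c & f a != 0]].

Lemma bsum_fibre_finite S f : bsum S f -> fibre_finite f.
Proof.
move=> hf c; elim: hf => [|f1 f2 [U bU [fU _ _]] _ ih].
  apply: (sub_finite_set _ (finite_set0 T)) => a []; by rewrite eqxx.
have fin1 : finite_set [set a | [/\ D a, r a = r c & f1 a != 0]].
  have [[a [Da ac f1a]]|none] := pselect (exists a, [/\ D a, r a = r c & f1 a != 0]).
    apply: (sub_finite_set _ (finite_set1 a)) => b [Db bc f1b] /=.
    by apply: (base_rinj ab bU); rewrite ?ac//; [case: (fU _ f1b)|case: (fU _ f1a)].
  by apply: (sub_finite_set _ (finite_set0 T)) => a ha; apply: none; exists a.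
have fin12 := conj fin1 ih; rewrite -finite_setU in fin12.
apply: sub_finite_set fin12 => a [Da ac fa].
have [f1a|f1a] := eqVneq (f1 a) 0; last by left.
by right; split => //; rewrite f1a add0r in fa.
Qed.

Lemma convolveE f (xi : T -> R[i]) c (P : set T) : D c ->
  P `<=` [set a | D a /\ r a = r c] ->
  (forall a, D a -> r a = r c -> f a * xi (a^v ** c) != 0 -> P a) ->
  convolve G f xi c = \sum_(a \in P) f a * xi (a^v ** c).
Proof.
move=> Dc PD fP; rewrite /convolve mem_set//; apply/esym/fsbig_widen => //.
move=> a [[Da ac] nP] /=; apply/eqP/negP => /negP /(fP _ Da ac).
exact: nP.
Qed.

Lemma convolve_nD f (xi : T -> R[i]) c : ~ D c -> convolve G f xi c = 0.
Proof. by move=> Dc; rewrite /convolve memNset. Qed.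

Lemma convolveDl f g (xi : T -> R[i]) : fibre_finite f -> fibre_finite g ->
  convolve G (fun a => f a + g a) xi = (fun c => convolve G f xi c + convolve G g xi c).
Proof.
move=> ff gf; apply/funext => c.
have [Dc|Dc] := pselect (D c); last by rewrite !convolve_nD// addr0.
pose P := [set a | [/\ D a, r a = r c & f a != 0]] `|`
          [set a | [/\ D a, r a = r c & g a != 0]].
have finP : finite_set P by rewrite finite_setU.
have PD : P `<=` [set a | D a /\ r a = r c] by move=> a [][].
rewrite !(convolveE Dc PD).
- by rewrite -fsbig_split//=; apply: eq_fsbigr => a _; rewrite mulrDl.
- by move=> a Da ac; rewrite mulf_eq0 negb_or => /andP[ga _]; right.
- by move=> a Da ac; rewrite mulf_eq0 negb_or => /andP[fa _]; left.
move=> a Da ac; rewrite mulf_eq0 negb_or => /andP[fga _].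
have [fa|fa] := eqVneq (f a) 0; last by left.
by right; split => //; rewrite fa add0r in fga.
Qed.

Lemma convolve_lin f (z : R[i]) (xi eta : T -> R[i]) : fibre_finite f ->
  convolve G f (fun a => z * xi a + eta a) =
  (fun c => z * convolve G f xi c + convolve G f eta c).
Proof.
move=> ff; apply/funext => c.
have [Dc|Dc] := pselect (D c); last by rewrite !convolve_nD// mulr0 addr0.
pose P := [set a | [/\ D a, r a = r c & f a != 0]].
have PD : P `<=` [set a | D a /\ r a = r c] by move=> a [].
have fP (zeta : T -> R[i]) a : D a -> r a = r c -> f a * zeta (a^v ** c) != 0 -> P a.
  by move=> Da ac; rewrite mulf_eq0 negb_or => /andP[fa _].
rewrite (convolveE Dc PD (fP xi)) (convolveE Dc PD (fP eta)) (convolveE Dc PD (fP _)).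
rewrite mulr_fsumr -fsbig_split//=; last exact: ff.
by apply: eq_fsbigr => a _; ring.
Qed.

Lemma convolveDr f (xi eta : T -> R[i]) : fibre_finite f ->
  convolve G f (fun a => xi a + eta a) =
  (fun c => convolve G f xi c + convolve G f eta c).
Proof.
move=> ff; have := convolve_lin 1 xi eta ff.
under eq_fun do rewrite mul1r; move=> ->.
by under eq_fun do rewrite mul1r.
Qed.

Lemma convolve0l (xi : T -> R[i]) : convolve G (fun=> 0) xi = (fun=> 0).
Proof.
apply/funext => c; have [Dc|Dc] := pselect (D c); last by rewrite convolve_nD.
by rewrite /convolve mem_set// fsbig1// => a _; rewrite mul0r.
Qed.

Lemma convolve0r f : convolve G f (fun=> 0) = (fun=> 0).
Proof.
apply/funext => c; have [Dc|Dc] := pselect (D c); last by rewrite convolve_nD.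
by rewrite /convolve mem_set// fsbig1// => a _; rewrite mulr0.
Qed.

Lemma convolve_at U f (xi : T -> R[i]) c a : base U -> (forall b, f b != 0 -> U b) ->
  D c -> U a -> r a = r c -> convolve G f xi c = f a * xi (a^v ** c).
Proof.
move=> bU fU Dc Ua ac; rewrite (@convolveE f xi c [set a])//.
- by rewrite fsbig_set1.
- by move=> b ->; split => //; exact: (base_sub ab bU).
move=> b Db bc; rewrite mulf_eq0 negb_or => /andP[/fU Ub _].
by apply: (base_rinj ab bU) => //; rewrite bc.
Qed.

Lemma convolve_off U f (xi : T -> R[i]) c : (forall b, f b != 0 -> U b) ->
  D c -> ~ (exists2 a, U a & r a = r c) -> convolve G f xi c = 0.
Proof.
move=> fU Dc no; rewrite (@convolveE f xi c set0)//; first by rewrite fsbig_set0.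
move=> b Db bc; rewrite mulf_eq0 negb_or => /andP[/fU Ub _].
by apply: no; exists b.
Qed.

Lemma lregE f (xi : vec R T) : ell2 D xi -> lreg G f xi = convolve G f xi.
Proof. by move=> xi2; rewrite /lreg mem_set. Qed.

(** On a bisection, [c |-> a^-1 c] is a partial injection, so convolution by a
    function carried by a bisection is a weighted partial isometry. *)
Lemma bounded_lreg1 S f : bfun S f -> bounded_op D (lreg G f).
Proof.
move=> hf; have ff := bsum_fibre_finite (bisection_sum1 hf).
case: hf => U bU [fSU fc [K fK]].
have fU b : f b != 0 -> U b by move=> /fSU[].
pose P c := `[< D c /\ exists2 a, U a & r a = r c >].
pose m c := xget c [set b | exists a, [/\ U a, r a = r c & b = a^v ** c]].
have mE c a : U a -> r a = r c -> m c = a^v ** c.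
  move=> Ua ac; rewrite /m; case: xgetP => [b _ [a' [Ua' a'c ->]]|/(_ (a^v ** c))[]].
    by rewrite (base_rinj ab bU Ua Ua')// ac.
  by exists a.
have bd (xi : vec R T) : ell2 D xi -> ell2 D (lreg G f xi) /\
    l2norm D (lreg G f xi) <= `|K| * l2norm D xi.
  move=> xi2; rewrite lregE//; apply: ell2_bound.
  - by move=> c; exact: convolve_nD.
  - by rewrite mulr_ge0 ?l2norm_ge0.
  move=> F; rewrite /fsq exprMn.
  apply: (@le_trans _ _ (`|K| ^+ 2 * \sum_(c <- F | P c) normc (xi (m c)) ^+ 2)).
    rewrite mulr_sumr big_mkcond/= [leRHS]big_mkcond/=; apply: ler_sum => c _.
    case: ifPn => [/asboolP[Dc [a Ua ac]]|/asboolPn nP].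
      rewrite (convolve_at _ bU fU Dc Ua ac) (mE _ _ Ua ac) normcM exprMn.
      rewrite ler_wpM2r ?sqr_ge0// ler_pXn2r// ?nnegrE ?modulus_ge0//.
      exact: le_trans (fK a) (ler_norm K).
    have [Dc|Dc] := pselect (D c); last by rewrite convolve_nD// normc0 expr0n.
    rewrite (convolve_off _ fU Dc) ?normc0 ?expr0n// => -[a Ua ac].
    by apply: nP; split => //; exists a.
  rewrite ler_wpM2l ?sqr_ge0//.
  rewrite (_ : \sum_(c <- F | P c) _ = fsq xi [fset m c | c in F & P c]%fset).
    exact: fsq_le.
  rewrite /fsq big_imfset/=.
    rewrite [RHS]big_filter; apply: eq_bigl => //.
  move=> c c' /andP[_ /asboolP[Dc [a Ua ac]]].
  move=> /andP[_ /asboolP[Dc' [a' Ua' a'c']]] /=.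
  rewrite (mE _ _ Ua ac) (mE _ _ Ua' a'c') => e.
  have Da := base_sub ab bU Ua; have Da' := base_sub ab bU Ua'.
  have aa' : a = a'.
    apply: (base_sinj ab bU) => //.
    by rewrite -(rng_inv gl) -(rng_inv gl a') -(rng_mul gl _ c) e (rng_mul gl).
  by rewrite -(gpd_mulVK gl Da Dc ac) e aa' (gpd_mulVK gl Da' Dc' a'c').
split.
- by move=> xi xi2; rewrite /lreg memNset.
- by move=> xi /bd[].
- move=> z xi eta xi2 eta2; have [l2 _] := ell2_lin z xi2 eta2.
  by rewrite !lregE// convolve_lin.
- by exists `|K| => xi /bd[].
Qed.

Lemma lreg0 : lreg G (fun=> 0) = @opzero R T.
Proof.
apply/funext => xi; rewrite /lreg; case: ifP => // _.
by rewrite convolve0l.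
Qed.

Lemma lregD f g : fibre_finite f -> fibre_finite g ->
  lreg G (fun a => f a + g a) = oplin 1 (lreg G f) (lreg G g).
Proof.
move=> ff gf; apply/funext => xi; apply/funext => c; rewrite /oplin /lreg mul1r.
by case: ifP => // _; rewrite ?convolveDl// addr0.
Qed.

Lemma bounded_lreg S f : bsum S f -> bounded_op D (lreg G f).
Proof.
elim=> [|f1 f2 hf1 hf2 ih]; first by rewrite lreg0; exact: (bounded_zero R D).1.
rewrite lregD; [|exact: bsum_fibre_finite (bisection_sum1 hf1)|exact: bsum_fibre_finite hf2].
by apply: (bounded_lin 1 _ ih).1; exact: bounded_lreg1 hf1.
Qed.

Lemma convolve_delta f b c : D b -> D c ->
  convolve G f (delta R b) c = if `[< s c = s b >] then f (c ** b^v) else 0.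
Proof.
move=> Db Dc; case: asboolP => [cb|cb].
  have Dq := arrows_quot gl Dc Db cb; have iDb := arrows_inv gl Db.
  have e : (c ** b^v)^v ** c = b.
    have cib : s c = r b^v by rewrite (rng_inv gl).
    rewrite (gpd_invM gl)// (gpd_invK gl)// -(gpd_mulA gl)// ?(arrows_inv gl)//.
    - by rewrite (gpd_mulVl gl)// cb (gpd_mulr1 gl).
    - exact: (arrows_inv gl).
    - by rewrite (rng_inv gl).
    - by rewrite (src_inv gl).
  rewrite (@convolveE _ _ _ [set c ** b^v])//.
  - by rewrite fsbig_set1 e /delta eqxx mulr1.
  - by move=> _ ->; split => //; rewrite (rng_mul gl).
  move=> a Da ac; rewrite /delta; case: (a^v ** c =P b) => [ba _|]; last by rewrite mulr0 eqxx.
  rewrite /= -ba (gpd_invM gl) ?(gpd_invK gl)//; last by rewrite (src_inv gl).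
    by rewrite gpd_mulVK//.
  exact: (arrows_inv gl).
rewrite (@convolveE _ _ _ set0)//; first by rewrite fsbig_set0.
move=> a Da ac; rewrite /delta; case: (a^v ** c =P b) => [ba|]; last by rewrite mulr0 eqxx.
by move=> _; apply: cb; rewrite -ba (src_mul gl).
Qed.

(** Applied to a delta function, convolution operators compose as the functions
    convolve: both sides are the same sum. Together with [lreg_delta] this
    identifies products of operators entry by entry. *)
Lemma convolve_convolve_delta f g b c : D b -> D c ->
  convolve G f (convolve G g (delta R b)) c =
  if `[< s c = s b >] then convolve G f g (c ** b^v) else 0.
Proof.
move=> Db Dc; rewrite {1}/convolve mem_set//; case: asboolP => cb; last first.
  apply: fsbig1 => a [Da ac]; rewrite convolve_delta//; last exact: arrows_lquot.
  by rewrite (src_mul gl) asboolF// mulr0.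
rewrite /convolve mem_set; last exact: arrows_quot.
rewrite (rng_mul gl); apply: eq_fsbigr => a; rewrite inE => -[Da ac].
rewrite -/(convolve G g (delta R b) _) convolve_delta//; last exact: arrows_lquot.
rewrite (src_mul gl) asboolT// -(gpd_mulA gl)//.
- exact: (arrows_inv gl).
- exact: (arrows_inv gl).
- by rewrite (src_inv gl).
- by rewrite (rng_inv gl).
Qed.

Lemma lreg_delta f b c : D b -> D c ->
  lreg G f (delta R b) c = if `[< s c = s b >] then f (c ** b^v) else 0.
Proof. by move=> Db Dc; rewrite lregE ?convolve_delta//; exact: (ell2_delta R Db).1. Qed.

Lemma lreg_comp f g : bounded_op D (lreg G f) -> bounded_op D (lreg G g) ->
  bounded_op D (lreg G (convolve G f g)) ->
  lreg G f \o lreg G g = lreg G (convolve G f g).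
Proof.
move=> fb gb fgb; apply: (@bop_ext_matrix _ _ D) => //; first exact: (bounded_comp fb gb).1.
move=> b c Db Dc /=; rewrite lreg_delta// lregE; last exact: bop_ell2.
by rewrite lregE ?convolve_convolve_delta//; exact: (ell2_delta R Db).1.
Qed.

Lemma oplin_lreg (z : R[i]) f g : bounded_op D (lreg G f) -> bounded_op D (lreg G g) ->
  bounded_op D (lreg G (fun a => z * f a + g a)) ->
  oplin z (lreg G f) (lreg G g) = lreg G (fun a => z * f a + g a).
Proof.
move=> fb gb fgb; apply: (@bop_ext_matrix _ _ D) => //; first exact: (bounded_lin z fb gb).1.
move=> b c Db Dc; rewrite /oplin !lreg_delta//.
by case: ifP => //; rewrite mulr0 addr0.
Qed.

Definition star f : T -> R[i] := fun c => if `[< D c >] then ((f c^v)^*)%C else 0.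

Lemma adj_lreg f : bounded_op D (lreg G f) -> bounded_op D (lreg G (star f)) ->
  adj D (lreg G f) = lreg G (star f).
Proof.
move=> fb sb; apply: (@bop_ext_matrix _ _ D) => //; first exact: bounded_adj.
move=> b c Db Dc; rewrite adj_matrix// !lreg_delta//.
case: asboolP => [bc|bc]; last by rewrite asboolF ?conjc0//; apply: nesym.
rewrite asboolT// /star asboolT; last exact: arrows_quot.
rewrite (gpd_invM gl)// ?(gpd_invK gl)//; first exact: (arrows_inv gl).
by rewrite (rng_inv gl).
Qed.

Definition sub_mulclosed S := forall a b, S a -> S b -> s a = r b -> S (a ** b).

(** The product is carried by the bisection [U V] and each of its values is one
    product of values of [f] and [g]; continuity at an arrow [a b] follows from the
    openness of products of bisections. *)
Lemma bisection_convolve S f g : S `<=` D -> sub_mulclosed S -> bfun S f -> bfun S g ->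
  bsum S (convolve G f g).
Proof.
move=> SD SM [U bU [fSU fc [K fK]]] [V bV [gSV gc [L gL]]].
have fU b : f b != 0 -> U b by move=> /fSU[].
have supp c : convolve G f g c != 0 -> exists a, [/\ U a, r a = r c, D c, f a != 0 & g (a^v ** c) != 0].
  have [Dc|Dc] := pselect (D c); last by rewrite convolve_nD ?eqxx.
  have [[a Ua ac]|no] := pselect (exists2 a, U a & r a = r c).
    rewrite (convolve_at _ bU fU Dc Ua ac); rewrite mulf_eq0 negb_or => /andP[fa ga].
    by exists a.
  by rewrite (convolve_off _ fU Dc no) eqxx.
have [[a0 [b0 [Ua0 Vb0 ab0]]]|noab] := pselect (exists a b, [/\ U a, V b & s a = r b]); last first.
  rewrite (_ : convolve G f g = (fun=> 0)); first exact: BSum0.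
  apply/funext => c; apply/eqP/negP => /negP /supp[a [Ua ac Dc _ /gSV[_ Vb]]].
  by apply: noab; exists a, (a^v ** c); split => //; rewrite (rng_mul gl) (rng_inv gl).
apply: bisection_sum1; exists [set c | exists a b, [/\ U a, V b, s a = r b & c = a ** b]].
  exact: (base_mul ab bU bV Ua0 Vb0 ab0).
split.
- move=> c /supp[a [Ua ac Dc /fSU[Sa _] /gSV[Sb Vb]]].
  have Da := base_sub ab bU Ua.
  have e : s a = r (a^v ** c) by rewrite (rng_mul gl) (rng_inv gl).
  have cE := gpd_mulVK gl Da Dc ac; split; first by rewrite -cE; exact: SM.
  by exists a, (a^v ** c).
- move=> c Dc e e0.
  have [[a Ua ac]|no] := pselect (exists2 a, U a & r a = r c).
    have Da := base_sub ab bU Ua; have Db := arrows_lquot gl Da Dc ac.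
    set b := a^v ** c in Db.
    have abE : s a = r b by rewrite (rng_mul gl) (rng_inv gl).
    have cE : a ** b = c := gpd_mulVK gl Da Dc ac.
    have K0 : 0 <= K := le_trans (modulus_ge0 _) (fK a).
    have nb := modulus_ge0 (g b).
    have e2 : 0 < e / 2 by rewrite divr_gt0.
    have [d0 dg] := share_le nb e2; have [q0 qK] := share_le K0 e2.
    have [A bA [Aa hA]] := fc a Da _ d0; have [B bB [Bb hB]] := gc b Db _ q0.
    have [A' bA' [A'a hA']] := base_inter ab bA bU Aa Ua.
    exists [set c | exists a b, [/\ A' a, B b, s a = r b & c = a ** b]].
      exact: (base_mul ab bA' bB A'a Bb abE).
    split; first by exists a, b.
    move=> c' [a' [b' [A'a' Bb' ab' ->]]].
    have [Aa' Ua'] := hA' _ A'a'.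
    have Da' := base_sub ab bU Ua'; have Db' := base_sub ab bB Bb'.
    rewrite (convolve_at _ bU fU Dc Ua ac) (convolve_at _ bU fU (arrows_mul gl Da' Db' ab') Ua'); last first.
      by rewrite (rng_mul gl).
    rewrite (gpd_mulKV gl)//  -/b.
    have -> : f a' * g b' - f a * g b = f a' * (g b' - g b) + (f a' - f a) * g b by ring.
    rewrite (le_trans (le_normcD _ _))// !normcM.
    have h1 := ler_wpM2r nb (hA _ Aa').
    have h2 := ler_wpM2l (modulus_ge0 (f a')) (hB _ Bb').
    have h3 := ler_wpM2r (ltW q0) (fK a'); lra.
  (* off the open and closed set of arrows whose range lies in [r(U)] the
     convolution vanishes *)
  have Drc := arrows_rng gl Dc.
  have iU := base_inv ab bU.
  have [[u Uu]|Un] := pselect (exists u, U u); last first.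
    have [W bW Wc] := base_at ab Dc; exists W => //; split => // c' Wc'.
    have Dc' := base_sub ab bW Wc'.
    rewrite !(convolve_off _ fU)//; try by move=> [a Ua _]; apply: Un; exists a.
    by rewrite subrr normc0 ltW.
  have iUu : [set a^v | a in U] u^v by exists u.
  have bUU := base_mul ab bU iU Uu iUu (esym (rng_inv gl u)).
  set UU := [set _ | _] in bUU.
  have nUU : ~ UU (r c).
    move=> [a [_ [Ua [a' Ua' <-] _ rcE]]]; apply: no; exists a => //.
    by rewrite -(rng_mul gl a a'^v) -rcE (rng_rng gl).
  have [V1 bV1 [V1c hV1]] := base_closed ab bUU Drc nUU.
  have [V2 bV2 [V2c hV2]] := base_unit ab Dc.
  have [W bW [Wc hW]] := base_inter ab bV1 bV2 V1c V2c.
  have [C bC Cc'] := base_at ab Dc.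
  exists [set c | exists a b, [/\ W a, C b, s a = r b & c = a ** b]].
    by apply: (base_mul ab bW bC Wc Cc'); rewrite (src_rng gl).
  split; first by exists (r c), c; rewrite (src_rng gl) (gpd_mul1 gl).
  move=> _ [a [b [Wa Cb ab' ->]]].
  have Da := base_sub ab bW Wa; have Db := base_sub ab bC Cb.
  have [V1a V2a] := hW _ Wa; have ra := hV2 _ V2a.
  rewrite (convolve_off _ fU (arrows_mul gl Da Db ab')); last first.
    move=> [a' Ua' ra']; apply: (hV1 _ V1a).
    exists a', a'^v; split => //; first by exists a'.
      by rewrite (rng_inv gl).
    by rewrite (gpd_mulV gl) ?ra' ?(rng_mul gl)//; exact: (base_sub ab bU).
  by rewrite (convolve_off _ fU Dc no) subrr normc0 ltW.
exists (`|K| * `|L|) => c; have [->|/supp[a [Ua ac Dc _ _]]] := eqVneq (convolve G f g c) 0.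
  by rewrite normc0 mulr_ge0.
rewrite (convolve_at _ bU fU Dc Ua ac) normcM ler_pM ?modulus_ge0//.
  exact: le_trans (fK _) (ler_norm _).
exact: le_trans (gL _) (ler_norm _).
Qed.

Lemma bsum_convolve S f g : S `<=` D -> sub_mulclosed S -> bsum S f -> bsum S g ->
  bsum S (convolve G f g).
Proof.
move=> SD SM hf hg; elim: hf => [|f1 f2 hf1 hf2 ih].
  rewrite convolve0l; exact: BSum0.
rewrite convolveDl; [|exact: bsum_fibre_finite (bisection_sum1 hf1)|exact: bsum_fibre_finite hf2].
apply: bisection_sumD => //; elim: hg => [|g1 g2 hg1 hg2 ih2].
  rewrite convolve0r; exact: BSum0.
rewrite convolveDr; last exact: bsum_fibre_finite (bisection_sum1 hf1).
by apply: bisection_sumD => //; exact: bisection_convolve.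
Qed.

Lemma bisection_star S f : S `<=` D -> (forall a, S a -> S a^v) -> bfun S f ->
  bfun S (star f).
Proof.
move=> SD Sinv [U bU [fU fc [K fK]]].
exists [set a^v | a in U]; first exact: (base_inv ab).
split.
- move=> a; rewrite /star; case: asboolP; last by rewrite eqxx.
  move=> Da; rewrite conjc_eq0 => /fU[Sa Ua]; split.
    by rewrite -(gpd_invK gl Da); exact: Sinv.
  by exists a^v => //; exact: (gpd_invK gl).
- move=> a Da e e0; have [V bV [Va hV]] := fc _ (arrows_inv gl Da) e e0.
  exists [set a^v | a in V]; first exact: (base_inv ab).
  split; first by exists a^v => //; exact: (gpd_invK gl).
  move=> _ [b Vb <-]; have Db := base_sub ab bV Vb.
  rewrite /star !asboolT//; last exact: (arrows_inv gl).
  by rewrite -rmorphB/= modulusC (gpd_invK gl)//; exact: hV.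
- exists `|K| => a; rewrite /star; case: ifP => _; last by rewrite normc0.
  by rewrite modulusC; exact: le_trans (fK _) (ler_norm _).
Qed.

Lemma bsum_star S f : S `<=` D -> (forall a, S a -> S a^v) -> bsum S f -> bsum S (star f).
Proof.
move=> SD Sinv; elim=> [|f1 f2 hf1 _ ih].
  rewrite (_ : star _ = (fun=> 0)); first exact: BSum0.
  by apply/funext => a; rewrite /star conjc0 if_same.
rewrite (_ : star _ = (fun a => star f1 a + star f2 a)); last first.
  by apply/funext => a; rewrite /star; case: ifP; rewrite ?addr0// rmorphD.
by apply: BSumS => //; exact: bisection_star.
Qed.

End ConvolutionOperators.

(** * Cartan subalgebras from clopen subgroupoids *)

Record clopen_subgroupoid (T : topologicalType) (G : groupoid_data T)
    (base : set (set T)) (S : set T) : Prop := ClopenSubgroupoid {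
  csub_arrows : S `<=` arrows G;
  csub_clopen : rel_clopen G base S;
  csub_mul : forall a b, S a -> S b -> gsrc G a = grng G b -> S (gmul G a b);
  csub_inv : forall a, S a -> S (ginv G a) }.

(** The last field replaces the requirement that [S] be the whole interior of
    the isotropy: an interior isotropy arrow outside [S] must sit over an isolated
    unit and have infinitely many conjugates under [S]. *)
Record cartan_subgroupoid (T : topologicalType) (G : groupoid_data T)
    (base : set (set T)) (S : set T) : Prop := CartanSubgroupoid {
  csub_clopen_sub : clopen_subgroupoid G base S;
  csub_units : forall a, arrows G a -> S (grng G a);
  csub_iso : forall a, S a -> grng G a = gsrc G a;
  csub_comm : forall a b, S a -> S b -> grng G a = grng G b ->
    gmul G a b = gmul G b a;
  csub_normal : forall a b, S a -> arrows G b -> gsrc G b = grng G a ->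
    S (gmul G (gmul G b a) (ginv G b));
  csub_conj : forall a V, arrows G a -> ~ S a -> base V -> V a ->
    (forall b, V b -> grng G b = gsrc G b) ->
    base [set grng G a] /\
    infinite_set [set gmul G (gmul G c a) (ginv G c) | c in
      [set c | S c /\ gsrc G c = grng G a]] }.

Section ReducedAlgebras.
Variables (R : realType) (T : topologicalType) (G : groupoid_data T).
Variable base : set (set T).
Hypotheses (gl : groupoid_laws G) (ab : ample_base G base).
Local Notation D := (arrows G).
Local Notation r := (grng G).
Local Notation s := (gsrc G).
Local Notation "a ** b" := (gmul G a b) (at level 40, left associativity).
Local Notation "a ^v" := (ginv G a) (at level 2, format "a ^v").
Implicit Types (f g h : T -> R[i]) (a b c : T) (U V W : set T) (S : set T).
Implicit Types (x y : operator R T).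
Local Notation bsum := (@bisection_sum R T G base).
Local Notation bfun := (@bisection_fun R T G base).

Definition conv_ops S : set (operator R T) := [set lreg G f | f in bsum S].

Lemma arrows_clopen_subgroupoid : clopen_subgroupoid G base D.
Proof.
split => //.
- split => // a Da; have [U bU Ua] := base_at ab Da; exists U => //; split => //.
  exact: (base_sub ab).
- by move=> a b; exact: (arrows_mul gl).
- exact: (arrows_inv gl).
Qed.

Lemma Cred_subE S : clopen_subgroupoid G base S ->
  Cred_sub R G S = opclosure D (conv_ops S).
Proof.
move=> [SD Scl _ _]; rewrite /Cred_sub /conv_ops; congr (opclosure _ _).
by apply/seteqP; split => _ [f /(CcP ab _ SD Scl) hf <-]; exists f => //;
  apply/(CcP ab _ SD Scl).
Qed.

Lemma conv_ops_bounded S : conv_ops S `<=` bounded_op D.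
Proof. by move=> _ [f hf <-]; exact: (bounded_lreg gl ab hf). Qed.

Lemma conv_ops_Cstar S : clopen_subgroupoid G base S ->
  Cstar_algebra D (opclosure D (conv_ops S)).
Proof.
move=> [SD Scl SM SV]; apply: opclosure_Cstar.
- exact: conv_ops_bounded.
- by exists (fun=> 0); [exact: BSum0|rewrite lreg0].
- move=> z _ _ [f hf <-] [g hg <-].
  have hfg : bsum S (fun a => z * f a + g a).
    by apply: bisection_sumD => //; exact: bisection_sumZ.
  by exists (fun a => z * f a + g a) => //; rewrite (oplin_lreg gl)//; apply: (bounded_lreg gl ab); eassumption.
- move=> _ _ [f hf <-] [g hg <-].
  have hfg := bsum_convolve gl ab SD SM hf hg.
  by exists (convolve G f g) => //; rewrite (lreg_comp gl)//; apply: (bounded_lreg gl ab); eassumption.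
- move=> _ [f hf <-]; have hs := bsum_star gl ab SD SV hf.
  by exists (star G f) => //; rewrite (adj_lreg gl)//; apply: (bounded_lreg gl ab); eassumption.
Qed.

Lemma conv_opsS S S' : S `<=` S' -> conv_ops S `<=` conv_ops S'.
Proof. by move=> SS' _ [f hf <-]; exists f => //; exact: bisection_sumS SS' hf. Qed.

Variable S : set T.
Hypothesis cS : cartan_subgroupoid G base S.
Let clS := csub_clopen_sub cS.
Let SD := csub_arrows clS.
Let A := opclosure D (conv_ops D).
Let B := opclosure D (conv_ops S).

Lemma convolve_neq0 f g c : convolve G f g c != 0 ->
  exists a, [/\ D c, D a, r a = r c, f a != 0 & g (a^v ** c) != 0].
Proof.
have [Dc|Dc] := pselect (D c); last by rewrite convolve_nD ?eqxx.
move=> fgc; apply: contrapT => no; move/negP: fgc; apply; apply/eqP.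
rewrite /convolve mem_set// fsbig1// => a [Da ac].
apply/eqP; rewrite mulf_eq0; apply/negPn/negP; rewrite negb_or => /andP[fa ga].
by apply: no; exists a.
Qed.

(** ** Commutativity *)

(** On a bundle of abelian groups [a |-> a^-1 c] permutes the fibre of [c] and
    exchanges the two factors of each term. *)
Lemma convolve_comm f g : bsum S f -> bsum S g -> convolve G f g = convolve G g f.
Proof.
move=> hf hg; apply/funext => c.
have fS a : f a != 0 -> S a := bisection_sum_supp hf (a := a).
have gS a : g a != 0 -> S a := bisection_sum_supp hg (a := a).
have SM := csub_mul clS; have SV := csub_inv clS.
have [Sc|Sc] := pselect (S c); last first.
  have none h k : (forall a, h a != 0 -> S a) -> (forall a, k a != 0 -> S a) ->
      convolve G h k c = 0.
    move=> hS kS; apply/eqP/negP => /negP /convolve_neq0[a [Dc Da ac /hS Sa /kS Sb]].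
    apply: Sc; rewrite -(gpd_mulVK gl Da Dc ac); apply: SM => //.
    by rewrite (rng_mul gl) (rng_inv gl).
  by rewrite !none.
have Dc := SD Sc.
pose P := [set a | S a /\ r a = r c].
have PD : P `<=` [set a | D a /\ r a = r c] by move=> a [/SD].
rewrite (convolveE Dc PD); last first.
  by move=> a Da ac; rewrite mulf_eq0 negb_or => /andP[/fS Sa _].
rewrite (convolveE Dc PD); last first.
  by move=> a Da ac; rewrite mulf_eq0 negb_or => /andP[/gS Sa _].
have Pm a : P a -> P (a^v ** c) /\ (a^v ** c)^v ** c = a.
  move=> [Sa ac]; have Da := SD Sa; have Sb : S (a^v ** c).
    by apply: SM => //; [exact: SV|rewrite (src_inv gl)].
  split; first by split => //; rewrite (rng_mul gl) (rng_inv gl) -(csub_iso cS Sa).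
  have iDa := arrows_inv gl Da.
  rewrite (gpd_invM gl)//; last by rewrite (src_inv gl).
  rewrite (gpd_invK gl)// -(csub_comm cS _ (SV _ Sc))//; last by rewrite (rng_inv gl) -(csub_iso cS Sc) ac.
  rewrite (gpd_mulKr gl)//.
  by rewrite -(csub_iso cS Sa) -(csub_iso cS Sc).
rewrite (@reindex_fsbig _ _ _ _ _ (fun a => a^v ** c) P P); last first.
  split.
  - by move=> a /Pm[].
  - move=> a b; rewrite !inE => /Pm[_ aE] /Pm[_ bE] e; by rewrite -aE -bE e.
  - by move=> a /[dup] Pa /Pm[Pb bE]; exists (a^v ** c).
by apply: eq_fsbigr => a; rewrite inE => /Pm[_ ->]; rewrite mulrC.
Qed.

Lemma subalgebra_abelian : abelian_ops B.
Proof.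
have comm1 x y : conv_ops S x -> conv_ops S y -> x \o y = y \o x.
  move=> [f hf <-] [g hg <-]; have SM := csub_mul clS.
  have b1 h : bsum S h -> bounded_op D (lreg G h) by move=> hh; exact: (bounded_lreg gl ab hh).
  have b2 h k : bsum S h -> bsum S k -> bounded_op D (lreg G (convolve G h k)).
    by move=> hh hk; apply: b1; exact: (bsum_convolve gl ab).
  rewrite (lreg_comp gl (b1 _ hf) (b1 _ hg) (b2 _ _ hf hg)).
  rewrite (lreg_comp gl (b1 _ hg) (b1 _ hf) (b2 _ _ hg hf)).
  by rewrite convolve_comm.
have Sb := @conv_ops_bounded S.
move=> x y Bx By; apply: (opclosure_commute Sb (opclosure_bounded By) _ Bx) => x' Sx'.
apply/esym; apply: (opclosure_commute Sb (Sb _ Sx') _ By) => y' Sy'.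
exact: comm1.
Qed.

(** ** The conditional expectation *)

(** The class of [a] is the coset [S a] in the source fibre of [a]. The compression to
    these cosets keeps the entries [(a, b)] with [a b^-1] in [S] and no others, so on
    functions it is restriction to [S]. *)
Definition coset_class a : set T := [set b | [/\ D b, s b = s a & S (b ** a^v)]].

Lemma coset_classP a b : D a -> D b ->
  coset_class a = coset_class b <-> s a = s b /\ S (b ** a^v).
Proof.
move=> Da Db; have SM := csub_mul clS; have SV := csub_inv clS.
have sub c d : D c -> D d -> s c = s d -> S (d ** c^v) -> coset_class d `<=` coset_class c.
  move=> Dc Dd cd Sdc e [De ed Sed]; split => //; first by rewrite ed.
  rewrite (_ : e ** c^v = (e ** d^v) ** (d ** c^v)).
    by apply: SM => //; rewrite (src_mul gl) (src_inv gl) (rng_mul gl).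
  have Dec := arrows_inv gl Dc.
  rewrite (gpd_mulA gl)//; last 3 first.
  - exact: (arrows_quot gl).
  - by rewrite (src_mul gl) (src_inv gl).
  - by rewrite (rng_inv gl).
  by rewrite (gpd_mulKr gl).
split=> [e|[ab' Sba]].
  have : coset_class b b.
    by split => //; rewrite (gpd_mulV gl)//; exact: (csub_units cS).
  by rewrite -e => -[_ ->].
apply/seteqP; split; apply: sub => //.
rewrite (_ : a ** b^v = (b ** a^v)^v); first exact: SV.
rewrite (gpd_invM gl)// ?(gpd_invK gl)//; first exact: (arrows_inv gl).
by rewrite (rng_inv gl).
Qed.

Local Notation E := (@compress R T (set T) D coset_class).

Lemma lreg_block_diagonal f : bsum S f -> block_diagonal D coset_class (lreg G f).
Proof.
move=> hf c xi xi2; rewrite !lregE//; last exact: ell2_block.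
apply/funext => t; rewrite /block /vrestr; have [Dt|Dt] := pselect (D t); last first.
  by rewrite !convolve_nD// if_same.
have same a : D a -> r a = r t -> f a != 0 -> coset_class (a^v ** t) = coset_class t.
  move=> Da at_ fa; have Db := arrows_lquot gl Da Dt at_.
  apply/coset_classP => //; split; first by rewrite (src_mul gl).
  rewrite -{1}(gpd_mulVK gl Da Dt at_) (gpd_mulK gl) ?(rng_mul gl) ?(rng_inv gl)//.
  exact: bisection_sum_supp hf fa.
rewrite /convolve !mem_set//; case: eqP => tc; [apply: eq_fsbigr|apply: fsbig1] => a.
  rewrite inE => -[Da at_]; have [->|fa] := eqVneq (f a) 0; first by rewrite !mul0r.
  by rewrite same// tc eqxx.
move=> [Da at_]; have [->|fa] := eqVneq (f a) 0; first by rewrite mul0r.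
by rewrite same//; case: eqP => // _; rewrite mulr0.
Qed.

Lemma compress_lreg f : bsum D f -> E (lreg G f) = lreg G (zero_off S f).
Proof.
move=> hf; have fb := bounded_lreg gl ab hf.
have hrf := bisection_sum_restrict ab (csub_clopen clS) hf.
have rb := bounded_lreg gl ab hrf.
apply: (@bop_ext_matrix _ _ D) => //; first exact: (bounded_compress _ fb).1.
move=> b t Db Dt; have d2 := (ell2_delta R Db).1.
rewrite compressE// [RHS]lreg_delta//.
have [bt|bt] := eqVneq (coset_class b) (coset_class t).
  rewrite (_ : block _ _ _ = delta R b).
    rewrite lreg_delta//; case: ifP => // _; rewrite /zero_off asboolT//.
    by have /coset_classP[] := bt.
  apply/funext => u; rewrite /block /vrestr /delta.
  by case: eqP => // ut; case: (eqVneq u b) => // ub; rewrite ub bt in ut.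
rewrite (_ : block _ _ _ = (fun=> 0)); last first.
  apply/funext => u; rewrite /block /vrestr /delta.
  by case: eqP => // ut; case: (eqVneq u b) => // ub; rewrite -ub ut eqxx in bt.
rewrite (bop0 fb); case: asboolP => // tb; rewrite /zero_off asboolF// => Stb.
by move/eqP: bt; apply; apply/coset_classP.
Qed.

Lemma compress_mem x : A x -> B (E x).
Proof.
move=> Ax; have xb := opclosure_bounded Ax; have [_ hx] := Ax.
split; first exact: (bounded_compress _ xb).1.
move=> e /hx[_ [f hf <-] xf]; have fb := bounded_lreg gl ab hf.
exists (E (lreg G f)).
  rewrite compress_lreg//; exists (zero_off S f) => //.
  by apply: bisection_sumS (bisection_sum_restrict ab (csub_clopen clS) hf) => a [].
rewrite -compress_lin; have [lb _] := bounded_lin (-1) fb xb.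
exact: le_trans (bounded_compress _ lb).2 xf.
Qed.

Lemma sub_BA : B `<=` A.
Proof. apply: opclosureS; exact: conv_opsS SD. Qed.

Lemma B_block_diagonal x : B x -> block_diagonal D coset_class x.
Proof.
apply: block_diagonal_closure; first exact: conv_ops_bounded.
by move=> _ [f hf <-]; exact: lreg_block_diagonal.
Qed.

Lemma compress_expectation : cond_expectation D A B E /\ faithful D A E.
Proof.
have Ab x : A x -> bounded_op D x by exact: opclosure_bounded.
have Bb x : B x -> bounded_op D x by exact: opclosure_bounded.
split; last by move=> x /Ab; exact: compress_faithful.
split.
- exact: compress_mem.
- by move=> x Bx; apply: compress_id; [exact: Bb|exact: B_block_diagonal].
- by move=> z x y _ _; exact: compress_lin.
- move=> x y z Bx Ay Bz; apply: (compress_bimodule (Bb _ Bx) (Ab _ Ay) (Bb _ Bz));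
    exact: B_block_diagonal.
split=> x /Ab xb; first exact: positive_compress.
exact: (bounded_compress _ xb).2.
Qed.

(** ** Maximality *)

(** The value at [c] of the function that [x] convolves with; it makes sense for
    every [x] in the reduced algebra, and [matrix_coefficient] says that it
    determines [x]. *)
Definition coefficient x c := x (delta R (s c)) c.

Lemma matrix_approx x e : A x -> 0 < e -> exists2 f, bsum D f &
  forall b t, D b -> D t -> normc (x (delta R b) t - lreg G f (delta R b) t) <= e.
Proof.
move=> [xb hx] /hx[_ [f hf <-] xf]; exists f => // b t Db Dt.
have fb := bounded_lreg gl ab hf; have [lb _] := bounded_lin (-1) fb xb.
have [d2 d1] := ell2_delta R Db.
have := modulus_le_l2norm t (bop_ell2 (delta R b) lb).
rewrite {1}/oplin mulN1r addrC => /le_trans; apply.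
apply: le_trans (opnorm_ub lb d2) _; apply: le_trans xf.
by rewrite ler_piMr// opnorm_ge0.
Qed.

Lemma gpd_mulr1V c : D c -> c ** (s c)^v = c.
Proof.
move=> Dc; have Ds := arrows_src gl Dc.
have := gpd_mulKr gl Dc Ds; rewrite (src_src gl) => /(_ erefl) h.
rewrite -[RHS]h -{1}(gpd_mulr1 gl (arrows_quot gl Dc Ds _)) ?(src_src gl)//.
by rewrite (src_mul gl) (src_inv gl) (rng_src gl).
Qed.

Lemma matrix_coefficient x b t : A x -> D b -> D t ->
  x (delta R b) t = if `[< s t = s b >] then coefficient x (t ** b^v) else 0.
Proof.
move=> Ax Db Dt; apply/eqP; rewrite -subr_eq0; apply/eqP/modulus_small0 => e e0.
have [|f hf fx] := matrix_approx Ax (e := e / 2); first by rewrite divr_gt0.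
have := fx b t Db Dt; rewrite lreg_delta//.
case: asboolP => tb h1; last first.
  by move: h1; rewrite !subr0; lra.
have Dc := arrows_quot gl Dt Db tb; have Ds := arrows_src gl Dc.
have := fx _ _ Ds Dc; rewrite lreg_delta// (src_src gl) asboolT// gpd_mulr1V//.
rewrite -/(coefficient x _) modulusB => h2.
set y := f _ in h1 h2.
have -> : x (delta R b) t - coefficient x (t ** b^v) =
  (x (delta R b) t - y) + (y - coefficient x (t ** b^v)) by ring.
rewrite (le_trans (le_normcD _ _))//; lra.
Qed.

Lemma coefficient_neq0_open x c : A x -> D c -> coefficient x c != 0 ->
  exists2 V, base V & V c /\ forall d, V d -> coefficient x d != 0.
Proof.
move=> Ax Dc xc.
have m0 : 0 < normc (coefficient x c).
  rewrite lt_neqAle modulus_ge0 andbT eq_sym; apply: contra xc => /eqP/eq0_normc ->.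
  exact: eqxx.
set m := normc _ in m0.
have [|f hf fx] := matrix_approx Ax (e := m / 4); first by rewrite divr_gt0.
have fx' d : D d -> normc (coefficient x d - f d) <= m / 4.
  move=> Dd; have := fx _ _ (arrows_src gl Dd) Dd.
  by rewrite lreg_delta//; [rewrite (src_src gl) asboolT// gpd_mulr1V|exact: (arrows_src gl)].
have [|V bV [Vc hV]] := bisection_sum_continuous ab hf Dc (e := m / 4).
  by rewrite divr_gt0.
exists V => //; split => // d Vd; have Dd := base_sub ab bV Vd.
apply/eqP => xd; have := fx' d Dd; have := fx' c Dc; have := hV d Vd.
rewrite xd => h1 h2 h3.
have : m <= m / 4 + m / 4 + m / 4.
  rewrite {1}/m (_ : coefficient x c = (coefficient x c - f c) + (f c - f d) - (0 - f d)); last by ring.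
  rewrite (le_trans (le_normcD _ _))// lerD ?normcN//.
  by rewrite (le_trans (le_normcD _ _))// lerD// modulusB.
lra.
Qed.

Definition ind U : T -> R[i] := fun a => if `[< U a >] then 1 else 0.

Lemma ind_neq0 U a : ind U a != 0 -> U a.
Proof. by rewrite /ind; case: asboolP => //; rewrite eqxx. Qed.

Lemma bsum_ind U S' : base U -> U `<=` S' -> bsum S' (ind U).
Proof.
move=> bU US; apply: bisection_sum1; exists U => //; split.
- by move=> a /ind_neq0 Ua; split => //; exact: US.
- have -> : ind U = zero_off U (fun=> 1) by [].
  apply: (locally_continuous_restrict ab); first exact: (base_clopen ab).
  move=> a Da e e0; have [V bV Va] := base_at ab Da; exists V => //; split => // b _.
  by rewrite subrr normc0 ltW.
- exists 1 => a; rewrite /ind; case: ifP => _; first by rewrite normc1.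
  by rewrite normc0.
Qed.

Lemma lreg_ind_delta U a b : base U -> U a -> D b -> s a = r b ->
  lreg G (ind U) (delta R b) = delta R (a ** b).
Proof.
move=> bU Ua Db asb; have Da := base_sub ab bU Ua; have Dab := arrows_mul gl Da Db asb.
apply/funext => t; have [Dt|Dt] := pselect (D t); last first.
  rewrite lregE; last exact: (ell2_delta R Db).1.
  rewrite convolve_nD// /delta; case: eqP => // tab; by rewrite tab in Dt.
rewrite lreg_delta// /delta; case: (eqVneq t (a ** b)) => [->|tab].
  by rewrite (src_mul gl) asboolT// (gpd_mulK gl)// /ind asboolT.
case: asboolP => // tb; rewrite /ind asboolF// => Utb.
move/eqP: tab; apply; have <- := gpd_mulKr gl Dt Db tb; congr (_ ** _).
by apply: (base_sinj ab bU) => //; rewrite (src_mul gl) (src_inv gl).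
Qed.

Lemma lreg_ind_delta0 U b : base U -> D b -> (forall a, U a -> s a <> r b) ->
  lreg G (ind U) (delta R b) = (fun=> 0).
Proof.
move=> bU Db no; apply/funext => t; have [Dt|Dt] := pselect (D t); last first.
  rewrite lregE ?convolve_nD//; exact: (ell2_delta R Db).1.
rewrite lreg_delta//; case: asboolP => // tb; rewrite /ind asboolF// => Utb.
by apply: (no _ Utb); rewrite (src_mul gl) (src_inv gl).
Qed.

Lemma lreg_ind_at U a (xi : vec R T) c : base U -> ell2 D xi -> U a -> D c -> r a = r c ->
  lreg G (ind U) xi c = xi (a^v ** c).
Proof.
move=> bU xi2 Ua Dc ac; rewrite lregE// (convolve_at ab _ bU _ Dc Ua ac).
  by rewrite /ind asboolT// mul1r.
by move=> b /ind_neq0.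
Qed.

(** Infinitely many equal nonzero coordinates would have an infinite norm. *)
Lemma ell2_finite_level (xi : vec R T) (P : set T) (z : R[i]) : ell2 D xi ->
  z != 0 -> (forall a, P a -> xi a = z) -> finite_set P.
Proof.
move=> xi2 z0 Pz; apply: contrapT => infP.
have m0 : 0 < normc z ^+ 2.
  rewrite exprn_gt0// lt_neqAle modulus_ge0 andbT eq_sym; apply: contra z0 => /eqP/eq0_normc ->.
  exact: eqxx.
pose n := Num.bound (l2norm D xi ^+ 2 / normc z ^+ 2).
have [F FP Fn] := infinite_set_fset n infP.
have := fsq_le F xi2; rewrite leNgt => /negP; apply.
rewrite /fsq (eq_big_seq (fun=> normc z ^+ 2)); last by move=> a /FP/Pz ->.
rewrite big_const_seq count_predT iter_addr_0 -mulr_natr mulrC -ltr_pdivrMr//.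
have : l2norm D xi ^+ 2 / normc z ^+ 2 < n%:R.
  by apply: archi_boundP; rewrite divr_ge0 ?sqr_ge0.
move=> /lt_le_trans; apply; rewrite ler_nat.
exact: Fn.
Qed.

(** An element commuting with the indicators of sets of units lives on the isotropy,
    hence by continuity on its interior. Over an isolated unit the point masses of
    [S] belong to the subalgebra; commuting with them makes the coefficients
    constant on the [S]-conjugates of [c], so a nonzero coefficient outside [S] would
    occur infinitely often in a square-summable family. *)
Lemma coefficient_support x c : A x -> (forall y, B y -> x \o y = y \o x) -> D c ->
  coefficient x c != 0 -> S c.
Proof.
move=> Ax xB Dc xc; have xb := opclosure_bounded Ax.
have indB U : base U -> U `<=` S -> B (lreg G (ind U)).
  move=> bU US; apply: sub_opclosure; first exact: conv_ops_bounded.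
  by exists (ind U) => //; exact: bsum_ind.
have commE U xi t : base U -> U `<=` S ->
    x (lreg G (ind U) xi) t = lreg G (ind U) (x xi) t.
  by move=> bU US; have := congr1 (fun f : operator R T => f xi t) (xB _ (indB _ bU US)).
(* a small set of units containing [r d] but not [s d] separates the two *)
have iso d : D d -> coefficient x d != 0 -> r d = s d.
  move=> Dd xd; apply: contrapT => rs.
  have Dr := arrows_rng gl Dd; have Ds := arrows_src gl Dd.
  have [U1 bU1 [U1r U1s]] := base_sep ab Dr Ds rs.
  have [U2 bU2 [U2r hU2]] := base_unit ab Dd.
  have [W bW [Wr hW]] := base_inter ab bU1 bU2 U1r U2r.
  have WS : W `<=` S.
    by move=> a Wa; have [_ /hU2 <-] := hW _ Wa; apply: (csub_units cS); exact: (base_sub ab bW).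
  have := commE W (delta R (s d)) d bW WS.
  rewrite (lreg_ind_delta0 bW Ds); last first.
    move=> a Wa; have [U1a /hU2 ra] := hW _ Wa; rewrite -ra (src_rng gl) (rng_src gl) ra => as_.
    by apply: U1s; rewrite -as_.
  rewrite (bop0 xb) (lreg_ind_at bW (bop_ell2 _ xb) Wr Dd) ?(rng_rng gl)//.
  have -> : (r d)^v ** d = d.
    by rewrite -{2}(gpd_mul1 gl Dd) (gpd_mulKV gl)// (src_rng gl).
  by move=> xd0; rewrite /coefficient -xd0 eqxx in xd.
apply: contrapT => Sc.
have [V bV [Vc hV]] := coefficient_neq0_open Ax Dc xc.
have [|bu infc] := csub_conj cS Dc Sc bV Vc.
  by move=> d Vd; apply: iso; [exact: (base_sub ab bV)|exact: hV].
apply: infc; pose u := s c.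
have rcu : r c = u := iso _ Dc xc; rewrite rcu in bu *.
have Du : D u := arrows_src gl Dc.
apply: (ell2_finite_level (xi := x (delta R u)) (bop_ell2 _ xb) xc).
move=> _ [d [Sd du] <-]; have Dd := SD Sd.
(* [d] is isolated, being the product of a bisection with the isolated unit [u] *)
have [C bC Cd] := base_at ab Dd.
have bd : base [set d].
  have uu : s d = r u by rewrite du (rng_src gl).
  have := base_mul ab bC bu Cd erefl uu.
  congr base; apply/seteqP; split => e.
    move=> [a [_ [Ca -> as_ ->]]] /=.
    have -> : a = d by apply: (base_sinj ab bC) => //; rewrite as_.
    by rewrite -du (gpd_mulr1 gl).
  by move=> ->; exists d, u; rewrite -{4}du (gpd_mulr1 gl).
have dcu : s d = r c by rewrite du rcu.
have Ddc := arrows_mul gl Dd Dc dcu.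
have := commE [set d] (delta R u) (d ** c) bd.
rewrite (lreg_ind_delta bd erefl Du); last by rewrite du (rng_src gl).
rewrite (lreg_ind_at bd (bop_ell2 _ xb) (erefl d)) ?(rng_mul gl)// (gpd_mulKV gl)//.
rewrite -{1}du (gpd_mulr1 gl)// matrix_coefficient// (src_mul gl) asboolT ?du// => h.
have {h} : coefficient x (d ** c ** d^v) = x (delta R u) c by apply: h => _ ->.
by rewrite {1}/coefficient (src_mul gl) (src_inv gl) (csub_iso cS Sd) du.
Qed.

Lemma commutant_mem x : A x -> (forall y, B y -> x \o y = y \o x) -> B x.
Proof.
move=> Ax xB; have xb := opclosure_bounded Ax.
rewrite -(@block_diagonal_matrix R T (set T) D coset_class x xb); first exact: compress_mem.
move=> b t Db Dt bt; rewrite matrix_coefficient//; case: asboolP => // tb.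
apply/eqP/negP => /negP /(coefficient_support Ax xB (arrows_quot gl Dt Db tb)) Stb.
by move/eqP: bt; apply; apply/coset_classP.
Qed.

Lemma subalgebra_maximal : maximal_abelian D A B.
Proof.
split; [exact: sub_BA|exact: conv_ops_Cstar|exact: subalgebra_abelian|].
move=> M _ MA Mab BM; apply/seteqP; split => // x Mx.
by apply: commutant_mem; [exact: MA|move=> y /BM My; exact: Mab].
Qed.

(** ** Regularity *)

(** If [f] lives on the bisection [U], then [f h f^*] lives on the conjugates of [S] by
    elements of [U], and [S] is normal. *)
Lemma conjugate_mem f y : bfun D f -> B y -> B (lreg G f \o y \o lreg G (star G f)).
Proof.
move=> hf By; have hf' := bisection_sum1 hf.
have DDM := arrows_clopen_subgroupoid; have DM := csub_mul DDM; have DV := csub_inv DDM.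
have hs := bsum_star gl ab (@subset_refl _ D) DV hf'.
have fb := bounded_lreg gl ab hf'; have sb := bounded_lreg gl ab hs.
have one z : conv_ops S z -> conv_ops S (lreg G f \o z \o lreg G (star G f)).
  move=> [h hh <-]; have hhD := bisection_sumS SD hh.
  have hb := bounded_lreg gl ab hh.
  have hhs := bsum_convolve gl ab (@subset_refl _ D) DM hhD hs.
  have hfhs := bsum_convolve gl ab (@subset_refl _ D) DM hf' hhs.
  set k := convolve G f (convolve G h (star G f)) in hfhs.
  have kS c : k c != 0 -> S c.
    case: hf => U bU [fU _ _].
    move=> /convolve_neq0[a [Dc Da ac /fU[_ Ua]]].
    move=> /convolve_neq0[d [Dac Dd dac hd]].
    have Sd : S d := bisection_sum_supp hh hd.
    set t := d^v ** (a^v ** c); have Dt : D t by exact: (arrows_lquot gl).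
    rewrite /star asboolT// conjc_eq0 => /fU[_ Ut].
    have acr : s a = r (a^v ** c) by rewrite (rng_mul gl) (rng_inv gl).
    have sdt : s d = r t by rewrite (rng_mul gl) (rng_inv gl).
    have at_ : a = t^v.
      apply: (base_sinj ab bU) => //.
      by rewrite (src_inv gl) -sdt -(csub_iso cS Sd) dac.
    have -> : c = (a ** d) ** a^v.
      rewrite -(gpd_mulVK gl Da Dc ac) -{1}(gpd_mulVK gl Dd Dac dac) -/t.
      rewrite (gpd_mulA gl)//; last by rewrite dac.
      by rewrite at_ (gpd_invK gl).
    by apply: (csub_normal cS) => //; rewrite dac.
  exists k; last first.
    rewrite -(lreg_comp gl fb (bounded_lreg gl ab hhs) (bounded_lreg gl ab hfhs)).
    by rewrite -(lreg_comp gl hb sb (bounded_lreg gl ab hhs)).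
  have := bisection_sum_restrict ab (csub_clopen clS) hfhs.
  rewrite (_ : zero_off S k = k); first by apply: bisection_sumS => a [].
  apply/funext => a; rewrite /zero_off; case: asboolP => // Sa.
  by apply/esym/eqP/negP => /negP /kS.
have yb := opclosure_bounded By; have [_ hy] := By.
have [c1 _] := bounded_comp fb yb; have [c2 _] := bounded_comp c1 sb.
split => // e e0; have nf := opnorm_ge0 fb; have ns := opnorm_ge0 sb.
pose K := opnorm D (lreg G f) * opnorm D (lreg G (star G f)).
have K0 : 0 <= K by rewrite mulr_ge0.
have [d0 dK] := share_le K0 e0; have [z Sz yz] := hy _ d0.
exists (lreg G f \o z \o lreg G (star G f)); first exact: one.
have zb := conv_ops_bounded Sz.
have [lb _] := bounded_lin (-1) zb yb.
have [d1 h1] := bounded_comp fb lb; have [d2 h2] := bounded_comp d1 sb.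
rewrite (_ : oplin _ _ _ = lreg G f \o oplin (-1) z y \o lreg G (star G f)); last first.
  apply/funext => xi; apply/funext => t; rewrite /oplin /=.
  by rewrite (bop_lin (-1) fb)//; exact: bop_ell2.
rewrite (le_trans h2)//.
have h3 := ler_wpM2r ns (le_trans h1 (ler_wpM2l nf yz)).
by apply: le_trans h3 _; rewrite mulrAC -/K.
Qed.

Lemma bisection_normalizer f : bfun D f -> normalizer D A B (lreg G f).
Proof.
move=> hf; have hf' := bisection_sum1 hf.
have DDM := arrows_clopen_subgroupoid; have DV := csub_inv DDM.
have hs := bsum_star gl ab (@subset_refl _ D) DV hf'.
have fb := bounded_lreg gl ab hf'; have sb := bounded_lreg gl ab hs.
split; first by apply: sub_opclosure; [exact: conv_ops_bounded|exists f].
move=> y By; rewrite (adj_lreg gl fb sb); split; first exact: conjugate_mem.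
have ss : star G (star G f) = f.
  apply/funext => a; rewrite /star; case: asboolP => Da; last first.
    by rewrite (bisection_sum_off hf').
  by rewrite asboolT ?conjcK ?(gpd_invK gl)//; exact: (arrows_inv gl).
rewrite -{2}ss; apply: conjugate_mem => //; exact: (bisection_star gl ab).
Qed.

Lemma subalgebra_regular : regular D A B.
Proof.
have DDM := arrows_clopen_subgroupoid.
apply/seteqP; split.
  apply: smallest_sub; first exact: conv_ops_Cstar.
  by move=> x [].
move=> x Ax M [CM nM]; have [Mb M0 Mlin _ [_ Mcl]] := CM.
apply: Mcl; apply: opclosureS Ax => _ [f hf <-].
elim: hf => [|f1 f2 hf1 hf2 ih]; first by rewrite lreg0.
rewrite lregD.
- by apply: Mlin => //; apply: nM; exact: bisection_normalizer.
- exact: (bsum_fibre_finite ab (bisection_sum1 hf1)).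
- exact: (bsum_fibre_finite ab hf2).
Qed.

(** Bisection functions give normalizers, and their sums are dense. *)
Proposition Cartan_of_subgroupoid : Cartan D (Cred R G) (Cred_sub R G S).
Proof.
rewrite /Cred !Cred_subE//; last exact: arrows_clopen_subgroupoid.
split; [exact: subalgebra_maximal|exact: subalgebra_regular|].
by have [cE fE] := compress_expectation; exists E.
Qed.

End ReducedAlgebras.

(** * Eventual classes and path words *)

Section EventualClasses.
Implicit Types (f g : nat -> int) (p q : qgroup) (m k : int).

Lemma qclassP f g : qclass f = qclass g <->
  exists N : nat, forall n, (N <= n)%N -> f n = g n.
Proof.
split=> [/eqmodP/asboolP[N _ h]|[N h]].
  by exists N => n; exact: h.
by apply/eqmodP/asboolP; exists N => // n; exact: h.
Qed.

Lemma qclassE f g : (exists N : nat, forall n, (N <= n)%N -> f n = g n) ->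
  qclass f = qclass g.
Proof. by move/qclassP. Qed.

Lemma qreprK q : qclass (repr q) = q.
Proof. exact: reprK. Qed.

Lemma repr_qclass f : exists N : nat, forall n, (N <= n)%N -> repr (qclass f) n = f n.
Proof. by apply/qclassP; exact: qreprK. Qed.

Lemma qmulE f g : qmul (qclass f) (qclass g) = qclass (fun n => f n + g n).
Proof.
have [N hf] := repr_qclass f; have [M hg] := repr_qclass g.
by apply: qclassE; exists (maxn N M) => n; rewrite geq_max => /andP[/hf -> /hg ->].
Qed.

Lemma qinvE f : qinv (qclass f) = qclass (fun n => - f n).
Proof.
by have [N hf] := repr_qclass f; apply: qclassE; exists N => n /hf ->.
Qed.

Lemma tshiftE k f (p : nat) : k <= p%:Z -> tshift k f p = f `|p%:Z - k|%N.
Proof. by rewrite /tshift => ->. Qed.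

Lemma qshiftE k f : qshift k (qclass f) = qclass (tshift k f).
Proof.
have [N hf] := repr_qclass f; apply: qclassE; exists (N + `|k|)%N => n hn.
by rewrite !tshiftE ?hf//; lia.
Qed.

(** The initial values, where [tshift] is defined to be [0], do not count. *)
Lemma qshiftP k f g : (exists N : nat, forall n, (N <= n)%N -> k <= n%:Z ->
  f n = g `|n%:Z - k|%N) -> qclass f = qshift k (qclass g).
Proof.
move=> [N h]; rewrite qshiftE; apply: qclassE; exists (N + `|k|)%N => n hn.
by rewrite tshiftE ?h//; lia.
Qed.

Lemma qmulA : associative qmul.
Proof.
move=> a b c; rewrite -(qreprK a) -(qreprK b) -(qreprK c) !qmulE.
by congr qclass; apply/funext => n; rewrite addrA.
Qed.

Lemma qmulC : commutative qmul.
Proof.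
move=> a b; rewrite -(qreprK a) -(qreprK b) !qmulE.
by congr qclass; apply/funext => n; rewrite addrC.
Qed.

Lemma qmul1q q : qmul qone q = q.
Proof. by rewrite -(qreprK q) qmulE; congr qclass; apply/funext => n; rewrite add0r. Qed.

Lemma qmulVq q : qmul (qinv q) q = qone.
Proof.
by rewrite -(qreprK q) qinvE qmulE; congr qclass; apply/funext => n; rewrite addNr.
Qed.

Lemma qshift0 q : qshift 0 q = q.
Proof.
rewrite -(qreprK q); apply/esym/qshiftP; exists 0%N => n _ _; congr (repr q _); lia.
Qed.

Lemma qshift1 k : qshift k qone = qone.
Proof. by apply/esym/qshiftP; exists 0%N. Qed.

Lemma qshiftM k p q : qshift k (qmul p q) = qmul (qshift k p) (qshift k q).
Proof.
rewrite -(qreprK p) -(qreprK q) qmulE !qshiftE qmulE; apply: qclassE.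
by exists `|k|%N => n hn; rewrite !tshiftE//; lia.
Qed.

Lemma qshiftV k q : qshift k (qinv q) = qinv (qshift k q).
Proof.
rewrite -(qreprK q) qinvE !qshiftE qinvE; apply: qclassE.
by exists `|k|%N => n hn; rewrite !tshiftE//; lia.
Qed.

Lemma qshiftD k m q : qshift k (qshift m q) = qshift (k + m) q.
Proof.
rewrite -(qreprK q) !qshiftE; apply: qclassE.
exists (`|k| + `|m|)%N => n hn; rewrite !tshiftE; try lia.
congr (repr q _); lia.
Qed.

Lemma qshift_inj k p q : qshift k p = qshift k q -> p = q.
Proof.
move=> /(congr1 (qshift (- k))).
by rewrite !qshiftD addNr !qshift0.
Qed.

End EventualClasses.

Section Paths.
Variable E : graph.
Implicit Types (mu nu ka : rawpath E) (x y : infword E) (v : vertex E) (e : edge E).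

Lemma pathE (mu nu : rawpath E) : mu.1 = nu.1 -> mu.2 = nu.2 -> mu = nu.
Proof. by case: mu nu => a b [c d] /= -> ->. Qed.

Definition ishift (n : nat) x : infword E := fun i => x (n + i)%N.

Lemma ishift_ipath n x : is_ipath x -> is_ipath (ishift n x).
Proof. by move=> xp i; rewrite /ishift addnS. Qed.

Lemma size_iseg x m n : plen (iseg x m n) = (n - m)%N.
Proof. by rewrite /plen /iseg /= size_map size_iota. Qed.

Lemma iseg_nth x m n i e : (i < n - m)%N -> nth e (iseg x m n).2 i = x (m + i)%N.
Proof. by move=> h; rewrite /= (nth_map 0%N) ?size_iota// nth_iota. Qed.

Lemma iseg_path x m n : is_ipath x -> is_path (iseg x m n).
Proof.
move=> xp; rewrite /is_path /iseg/=; case: (n - m)%N => //= k.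
rewrite eqxx/=; elim: k m => //= k ih m.
by rewrite xp eqxx ih.
Qed.

Lemma psrc_iseg x m n : is_ipath x -> (m <= n)%N -> psrc (iseg x m n) = rge (x n).
Proof.
move=> xp mn; rewrite /psrc /iseg /=.
case: n mn => [|n]; first by rewrite leqn0 => /eqP ->.
rewrite leq_eqVlt => /predU1P[->|]; first by rewrite subnn.
rewrite ltnS => mn; rewrite subSn// -addn1 iotaD !map_cat last_cat /= subnKC//.
Qed.

Lemma iseg_cat x m n p : is_ipath x -> (m <= n)%N -> (n <= p)%N ->
  iseg x m p = pcat (iseg x m n) (iseg x n p).
Proof.
move=> xp mn np; apply: pathE => //=.
have -> : (p - m = (n - m) + (p - n))%N by lia.
by rewrite iotaD map_cat; congr (_ ++ map _ (iota _ _)); lia.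
Qed.

Lemma iseg_ishift n x i j : iseg (ishift n x) i j = iseg x (n + i) (n + j).
Proof.
apply: pathE => //=; rewrite subnDl iotaDl -map_comp.
by apply: eq_map.
Qed.

Lemma icat_lt mu x i e : (i < plen mu)%N -> icat mu x i = nth e mu.2 i.
Proof. by move=> h; rewrite /icat; apply: set_nth_default. Qed.

Lemma icat_ge mu x i : (plen mu <= i)%N -> icat mu x i = x (i - plen mu)%N.
Proof. by move=> h; rewrite /icat nth_default. Qed.

Lemma icat_shift mu x : ishift (plen mu) (icat mu x) = x.
Proof. by apply/funext => i; rewrite /ishift icat_ge ?leq_addr// addKn. Qed.

Lemma icat_vtx v x : icat (vtx v) x = x.
Proof. by apply/funext => i; rewrite icat_ge// subn0. Qed.

Lemma icat_iseg x n : icat (iseg x 0 n) (ishift n x) = x.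
Proof.
apply/funext => i; have [h|h] := ltnP i n.
  by rewrite (icat_lt _ (x 0%N)) ?size_iseg ?subn0// iseg_nth// subn0.
by rewrite icat_ge ?size_iseg ?subn0// /ishift subnKC.
Qed.

Lemma icat_pcat mu nu x : icat (pcat mu nu) x = icat mu (icat nu x).
Proof.
apply/funext => i; have [h|h] := ltnP i (plen mu).
  rewrite (icat_lt _ (x 0%N) h) (@icat_lt _ _ _ (x 0%N)).
    by rewrite /= nth_cat h.
  by rewrite /plen /= size_cat ltn_addr.
rewrite (icat_ge _ h); have [h'|h'] := ltnP (i - plen mu)%N (plen nu).
  rewrite (icat_lt _ (x 0%N) h') (@icat_lt _ _ _ (x 0%N)).
    by rewrite /= nth_cat ltnNge h.
  by rewrite /plen /= size_cat -ltn_subLR.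
rewrite !icat_ge//; first by congr x; rewrite /plen /= size_cat subnDA.
by rewrite /plen /= size_cat -leq_subRL ?h'// ; lia.
Qed.

Lemma irng_icat mu x : is_path mu -> irng x = psrc mu -> irng (icat mu x) = prng mu.
Proof.
case: mu => v [|e w] /=; first by rewrite icat_vtx.
by move=> /andP[/eqP ev _] _; rewrite /irng /icat /= ev.
Qed.

Lemma icat_ipath mu x : is_path mu -> is_ipath x -> irng x = psrc mu -> is_ipath (icat mu x).
Proof.
case: mu => v w mup xp xmu i.
have [h|h] := ltnP i.+1 (size w).
  have h' := ltnW h; rewrite !(icat_lt _ (x 0%N))//=.
  case: w mup xmu h h' => // e w /andP[_ /pathP pw] _ /= h h'.
  by have /eqP := pw (x 0%N) i h.
rewrite [icat _ _ i.+1](icat_ge (mu := (v, w)) _ h); have [h'|h'] := ltnP i (size w); last first.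
  by rewrite icat_ge// xp subSn.
have iE : i.+1 = size w by apply/eqP; rewrite eqn_leq h' h.
rewrite (icat_lt _ (x 0%N))//= /plen /= -iE subnn -/(irng x) xmu /psrc /=.
by rewrite -nth_last size_map -iE /= (nth_map (x 0%N))// -iE.
Qed.

Lemma iseg_icat mu x : is_path mu -> irng x = psrc mu -> iseg (icat mu x) 0 (plen mu) = mu.
Proof.
move=> mup xmu; apply: pathE; first exact: irng_icat.
apply: (@eq_from_nth _ (x 0%N)) => [|i]; first by rewrite -/(plen _) size_iseg subn0.
rewrite -/(plen _) size_iseg subn0 => h; rewrite iseg_nth ?subn0//.
by rewrite (icat_lt _ (x 0%N)).
Qed.

Lemma iseg_icatD mu x n : is_path mu -> is_ipath x -> irng x = psrc mu ->
  iseg (icat mu x) 0 (plen mu + n) = pcat mu (iseg x 0 n).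
Proof.
move=> mup xp xmu; rewrite (@iseg_cat _ _ (plen mu)) ?leq_addr//; last exact: icat_ipath.
rewrite iseg_icat//; congr pcat.
by rewrite -[in RHS](icat_shift mu x) iseg_ishift addn0.
Qed.

Lemma ipath_eq x y : (forall n, iseg x 0 n = iseg y 0 n) -> x = y.
Proof.
move=> h; apply/funext => i; have := congr1 (fun mu => nth (x 0%N) mu.2 i) (h i.+1).
by rewrite !iseg_nth ?subn0.
Qed.

Lemma iseg_prefix x y m n : (m <= n)%N -> iseg x 0 n = iseg y 0 n -> iseg x 0 m = iseg y 0 m.
Proof.
move=> mn h; apply: pathE; first by case: h.
have : take m (iseg x 0 n).2 = take m (iseg y 0 n).2 by rewrite h.
by rewrite /= !subn0 -!map_take take_iota (minn_idPl mn).
Qed.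

Lemma pcat_path mu nu : is_path mu -> is_path nu -> psrc mu = prng nu -> is_path (pcat mu nu).
Proof.
case: mu nu => v [|e w] [u [|f z]] //=.
- by rewrite /psrc /is_path /= => _ + ->.
- by rewrite /is_path /= cats0.
rewrite /is_path /psrc /= last_map => /andP[-> pw] /andP[/eqP fu pz] us.
by rewrite cat_path pw /= pz andbT us fu.
Qed.

Lemma psrc_pcat mu nu : psrc mu = prng nu -> psrc (pcat mu nu) = psrc nu.
Proof. by rewrite /psrc /pcat /= map_cat last_cat => ->. Qed.

Lemma plen_pcat mu nu : plen (pcat mu nu) = (plen mu + plen nu)%N.
Proof. by rewrite /plen size_cat. Qed.

Lemma pcat_inj mu mu' nu nu' : plen mu = plen mu' -> psrc mu = prng nu ->
  psrc mu' = prng nu' -> pcat mu nu = pcat mu' nu' -> mu = mu' /\ nu = nu'.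
Proof.
move=> e s1 s2 [e1 e2]; have := congr1 (take (plen mu)) e2.
rewrite take_size_cat// e take_size_cat// => e3.
have mm : mu = mu' by exact: pathE.
split => //; apply: pathE; first by rewrite -/(prng nu) -s1 mm s2.
by move: e2; rewrite mm => /eqP; rewrite eqseq_cat// eqxx => /eqP.
Qed.

Lemma icat_inj mu mu' x x' : plen mu = plen mu' -> is_path mu -> is_path mu' ->
  irng x = psrc mu -> irng x' = psrc mu' -> icat mu x = icat mu' x' ->
  mu = mu' /\ x = x'.
Proof.
move=> e mp mp' xm xm' h.
have mm : mu = mu' by rewrite -(iseg_icat mp xm) -(iseg_icat mp' xm') h e.
by split => //; rewrite -(icat_shift mu x) h e icat_shift.
Qed.

Lemma icat_prefix mu nu x y : (plen mu <= plen nu)%N -> is_path mu -> is_path nu ->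
  is_ipath x -> is_ipath y ->
  irng x = psrc mu -> irng y = psrc nu -> icat mu x = icat nu y ->
  exists2 ka, [/\ is_path ka, psrc mu = prng ka & nu = pcat mu ka] &
    irng y = psrc ka /\ x = icat ka y.
Proof.
move=> le mp np xp yp xm yn h; pose n := (plen nu - plen mu)%N; pose ka := iseg x 0 n.
have nuE : nu = pcat mu ka.
  by rewrite -(iseg_icat np yn) -h -(iseg_icatD _ mp xp xm); congr (iseg _ _ _); lia.
have kp : is_path ka by exact: iseg_path.
have mk : psrc mu = prng ka by rewrite -xm.
exists ka => //; have yk : irng y = psrc ka by rewrite yn nuE psrc_pcat.
by split => //; rewrite -(icat_shift mu x) h nuE icat_pcat icat_shift.
Qed.

Lemma icat_agree mu x y n i : (i < plen mu + n)%N -> iseg y 0 n = iseg x 0 n ->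
  icat mu y i = icat mu x i.
Proof.
move=> lt yx; have [h|h] := ltnP i (plen mu).
  by rewrite !(icat_lt _ (x 0%N) h).
rewrite !icat_ge//; have := congr1 (fun w => nth (x 0%N) w.2 (i - plen mu)) yx.
by rewrite !iseg_nth ?subn0//; lia.
Qed.

End Paths.

(** * Self-similar actions on infinite paths *)

Section Action.
Variables (E : graph) (X : self_similar E).
Implicit Types (mu nu ka : rawpath E) (x y : infword E) (g h : int) (n : nat).

Lemma act_iseg_succ g x n : is_ipath x ->
  act X g (iseg x 0 n.+1) = pcat (act X g (iseg x 0 n)) (act X (irestr X g x n) (iseg x n n.+1)).
Proof.
move=> xp; rewrite (iseg_cat xp (leq0n n) (leqnSn n)) act_cat//; try exact: iseg_path.
by rewrite psrc_iseg.
Qed.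

Lemma act_step g x n : is_ipath x ->
  act X (irestr X g x n) (iseg x n n.+1) = (rge (iact X g x n), [:: iact X g x n]).
Proof.
move=> xp; have sp := iseg_path n n.+1 xp.
have := act_path X (restr X g (iseg x 0 n)) sp; have := act_len X (restr X g (iseg x 0 n)) sp.
rewrite /iact /irestr size_iseg subSnn /plen; case: (act X _ _) => v [|e [|]]//= _.
by rewrite /is_path /= andbT => /eqP ->.
Qed.

Lemma act_iseg g x n : is_ipath x -> act X g (iseg x 0 n) = iseg (iact X g x) 0 n.
Proof.
move=> xp; have e1 : act X g (iseg x 0 1) = iseg (iact X g x) 0 1.
  rewrite act_iseg_succ// act_step//.
  have -> : iseg x 0 0 = vtx (rge (x 0%N)) by [].
  have -> : act X g (vtx (rge (x 0%N))) = vtx (rge (iact X g x 0)).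
    have sp := iseg_path 0 1 xp; have := act_rng X g sp.
    have -> : prng (iseg x 0 1) = rge (x 0%N) by [].
    move=> <-; congr vtx; have h := act_step g 0 xp; move: h.
    by rewrite /irestr (_ : iseg x 0 0 = vtx (rge (x 0%N)))// restr_vtx => ->.
  exact: pathE.
elim: n => [|n ih].
  have sp := iseg_path 0 1 xp; have := act_rng X g sp.
  by rewrite e1.
rewrite act_iseg_succ// ih act_step//; apply: pathE => //.
rewrite /iseg /pcat (_ : iota 0 (n.+1 - 0) = iota 0 (n - 0) ++ [:: n]) ?map_cat//.
by rewrite !subn0 -addn1 iotaD.
Qed.

Lemma vtx_inj : injective (@vtx E).
Proof. by move=> v w []. Qed.

Lemma iact_ipath g x : is_ipath x -> is_ipath (iact X g x).
Proof.
move=> xp i; set y := iact X g x.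
have : path (fun e1 e2 => sce e1 == rge e2) (y 0%N) [seq y j | j <- iota 1 i.+1].
  have := act_path X g (iseg_path 0 i.+2 xp); rewrite act_iseg// /is_path.
  by move=> /andP[].
move=> /pathP pw; have := pw (y 0%N) i.
rewrite size_map size_iota => /(_ (ltnSn _)) /eqP.
rewrite (nth_map 0%N) ?size_iota// nth_iota// add1n => <-.
case: i {pw} => // i.
by rewrite [nth _ _ _](nth_map 0%N) ?size_iota 1?ltnW// nth_iota 1?ltnW// add1n.
Qed.

Lemma rge_iact g x n : is_ipath x -> vtx (rge (iact X g x n)) = act X g (vtx (rge (x n))).
Proof.
move=> xp; have := act_src X g (iseg_path 0 n xp).
by rewrite act_iseg// !psrc_iseg//; exact: iact_ipath.
Qed.

Lemma rge_iact_restr g x n : is_ipath x ->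
  vtx (rge (iact X g x n)) = act X (irestr X g x n) (vtx (rge (x n))).
Proof.
move=> xp; have := act_rng X (irestr X g x n) (iseg_path n n.+1 xp).
by rewrite act_step.
Qed.

Lemma irng_iact g x : is_ipath x -> vtx (irng (iact X g x)) = act X g (vtx (irng x)).
Proof. exact: rge_iact. Qed.

Lemma vtx_act g v : vtx (prng (act X g (vtx v))) = act X g (vtx v).
Proof. by rewrite (@act_rng _ X g (vtx v)). Qed.

Lemma iact0 x : is_ipath x -> iact X 0 x = x.
Proof.
move=> xp; apply: ipath_eq => n; rewrite -act_iseg// act0//; exact: iseg_path.
Qed.

Lemma iactD g h x : is_ipath x -> iact X (g + h) x = iact X g (iact X h x).
Proof.
move=> xp; have hp := iact_ipath h xp; apply: ipath_eq => n.
by rewrite -!act_iseg// actD//; exact: iseg_path.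
Qed.

Lemma iactK g x : is_ipath x -> iact X (- g) (iact X g x) = x.
Proof. by move=> xp; rewrite -iactD// addNr iact0. Qed.

Lemma iactNK g x : is_ipath x -> iact X g (iact X (- g) x) = x.
Proof. by move=> xp; rewrite -iactD// subrr iact0. Qed.

Lemma irestrD g h x n : is_ipath x ->
  irestr X (g + h) x n = irestr X g (iact X h x) n + irestr X h x n.
Proof. by move=> xp; rewrite /irestr restrD ?act_iseg//; exact: iseg_path. Qed.

Lemma irestr0 x n : is_ipath x -> irestr X 0 x n = 0.
Proof. by move=> xp; rewrite /irestr restr0//; exact: iseg_path. Qed.

Lemma irestrN g x n : is_ipath x -> irestr X (- g) (iact X g x) n = - irestr X g x n.
Proof.
move=> xp; apply/eqP; rewrite -subr_eq0 opprK -irestrD// addNr irestr0//.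
Qed.

Lemma actK g mu : is_path mu -> act X (- g) (act X g mu) = mu.
Proof. by move=> mp; rewrite -actD// addNr act0. Qed.

(** Only the compatibility of the action with ranges and sources is axiomatic; that
    [g] and [g|_ka] agree at the source of [ka] is read off the path [g (ka x)]. *)
Lemma act_restr_src g ka x : is_path ka -> is_ipath x -> irng x = psrc ka ->
  act X (restr X g ka) (vtx (psrc ka)) = act X g (vtx (psrc ka)).
Proof.
move=> kp xp xk; have zp := icat_ipath kp xp xk.
have := rge_iact g (plen ka) zp; rewrite rge_iact_restr// /irestr iseg_icat//.
by rewrite -(psrc_iseg zp (leq0n (plen ka))) iseg_icat.
Qed.

Lemma iact_icat g ka x : is_path ka -> is_ipath x -> irng x = psrc ka ->
  iact X g (icat ka x) = icat (act X g ka) (iact X (restr X g ka) x).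
Proof.
move=> kp xp xk; have zp := icat_ipath kp xp xk.
have gkp := act_path X g kp; have hxp := iact_ipath (restr X g ka) xp.
have xk' : irng (iact X (restr X g ka) x) = psrc (act X g ka).
  by apply: vtx_inj; rewrite irng_iact// xk (act_restr_src g kp xp xk) act_src.
have wp := icat_ipath gkp hxp xk'.
have lk : plen (act X g ka) = plen ka by exact: act_len.
apply: ipath_eq => n; apply: (iseg_prefix (leq_addl (plen ka) n)).
rewrite -act_iseg// iseg_icatD// act_cat//; last exact: iseg_path.
  by rewrite -lk iseg_icatD// act_iseg.
Qed.

Lemma irestr_icat g ka x n : is_path ka -> is_ipath x -> irng x = psrc ka ->
  irestr X g (icat ka x) (plen ka + n) = irestr X (restr X g ka) x n.
Proof.
move=> kp xp xk; rewrite /irestr iseg_icatD// restr_cat//; first exact: iseg_path.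
Qed.

End Action.

(** * Cylinder sets and the groupoid of a self-similar graph *)

(** Cylinder sets are only declared to be a subbase. A finite intersection of them
    around a point contains the member of the sequence with the largest of the
    finitely many indices involved. *)
Lemma nbhs_subbase (T : topologicalType) (sb : set (set T)) (a : T) (N : nat -> set T)
    (W : set T) :
  (forall U, open U <-> exists2 F, F `<=` finI_from sb id & \bigcup_(V in F) V = U) ->
  (forall m n, (m <= n)%N -> N n `<=` N m) -> (forall n, sb (N n) /\ N n a) ->
  (forall U, sb U -> U a -> exists n, N n `<=` U) ->
  (nbhs a W <-> exists n, N n `<=` W).
Proof.
move=> oE Nmono Na Nsub; split; last first.
  move=> [n NW]; have [bN Nna] := Na n; rewrite nbhsE; exists (N n) => //; split => //.
  apply/oE; exists [set N n]; last by rewrite bigcup_set1.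
  by move=> _ ->; exact: finI_from1.
rewrite nbhsE => -[U [/oE[F Fsb <-] [V FV Va]] UW].
have [J Jsb JV] := Fsb _ FV; rewrite -JV in Va.
suff [n hn] : exists n, forall B, B \in (J : seq (set T)) -> N n `<=` B.
  exists n => b Nb; apply: UW; exists V => //; rewrite -JV => B BJ.
  exact: hn BJ _ Nb.
have {Va} : forall B, B \in (J : seq (set T)) -> sb B /\ B a.
  by move=> B BJ; split; [have := Jsb _ BJ; rewrite inE|exact: Va BJ].
elim: (J : seq (set T)) => [|B l ih] Bl; first by exists 0%N.
have [|n hn] := ih; first by move=> C Cl; apply: Bl; rewrite in_cons Cl orbT.
have [sbB Ba] := Bl _ (mem_head _ _); have [m hm] := Nsub _ sbB Ba.
exists (maxn n m) => C; rewrite in_cons => /orP[/eqP ->|Cl].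
  exact: subset_trans (Nmono _ _ (leq_maxr _ _)) hm.
exact: subset_trans (Nmono _ _ (leq_maxl _ _)) (hn _ Cl).
Qed.

Section CylinderSets.
Variables (E : graph) (X : self_similar E).
Implicit Types (mu nu ka : rawpath E) (x y : infword E) (g h : int) (n : nat).
Local Notation G := (ssg_groupoid X).
Local Notation D := (arrows G).
Local Notation "a ** b" := (gmul G a b) (at level 40, left associativity).
Local Notation "a ^v" := (ginv G a) (at level 2, format "a ^v").

Lemma quadE (a b : quad X) : qrng a = qrng b -> qcls a = qcls b -> qdeg a = qdeg b ->
  qsrc a = qsrc b -> a = b.
Proof. by case: a b => x q k y [x' q' k' y'] /= -> -> -> ->. Qed.

(** [zelt X mu g nu x] is a term for arbitrary arguments; these are the conditions
    under which it is an arrow. *)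
Definition presents mu g nu x : Prop :=
  [/\ admissible X mu g nu, is_ipath x & irng x = psrc nu].

Lemma presents_rng mu g nu x : presents mu g nu x -> irng (iact X g x) = psrc mu.
Proof. by move=> [[mp np mn] xp xn]; apply: vtx_inj; rewrite irng_iact// xn. Qed.

Lemma presents_arrow mu g nu x : presents mu g nu x -> D (zelt X mu g nu x).
Proof. by move=> [am xp xn]; exists mu, g, nu; split => //; exists x. Qed.

Lemma arrow_presents a : D a -> exists mu g nu x, presents mu g nu x /\ a = zelt X mu g nu x.
Proof. by move=> [mu [g [nu [am [x [xp xn] <-]]]]]; exists mu, g, nu, x. Qed.

Lemma qrng_ipath a : D a -> is_ipath (qrng a).
Proof.
move=> /arrow_presents[mu [g [nu [x [pr ->]]]]] /=.
have [[mp np mn] xp xn] := pr; apply: icat_ipath => //; first exact: iact_ipath.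
exact: presents_rng pr.
Qed.

Lemma qsrc_ipath a : D a -> is_ipath (qsrc a).
Proof.
move=> /arrow_presents[mu [g [nu [x [[[mp np mn] xp xn] ->]]]]] /=.
exact: icat_ipath.
Qed.

Lemma presents_cat mu g nu ka x : admissible X mu g nu -> is_path ka -> psrc nu = prng ka ->
  is_ipath x -> irng x = psrc ka -> presents (pcat mu (act X g ka)) (restr X g ka) (pcat nu ka) x.
Proof.
move=> [mp np mn] kp nk xp xk; have gkp := act_path X g kp.
have mgk : psrc mu = prng (act X g ka).
  by apply: vtx_inj; rewrite mn nk act_rng.
split => //; last by rewrite psrc_pcat.
split; [exact: pcat_path|exact: pcat_path|].
by rewrite !psrc_pcat// (act_restr_src X g kp xp xk) act_src.
Qed.

Lemma zelt_cat mu g nu ka x : is_path ka -> is_ipath x -> irng x = psrc ka ->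
  zelt X mu g nu (icat ka x) = zelt X (pcat mu (act X g ka)) (restr X g ka) (pcat nu ka) x.
Proof.
move=> kp xp xk; apply: quadE => /=.
- by rewrite iact_icat// icat_pcat.
- rewrite plen_pcat act_len// PoszD -qshiftD; congr qshift.
  apply: qshiftP; exists 0%N => n _ kn.
  rewrite -(irestr_icat X g _ kp xp xk); congr (irestr X g _ _); lia.
- by rewrite !plen_pcat act_len//; lia.
- by rewrite icat_pcat.
Qed.

Lemma zcyl_cat mu g nu ka : is_path ka -> psrc nu = prng ka ->
  zcyl X (pcat mu (act X g ka)) (restr X g ka) (pcat nu ka) `<=` zcyl X mu g nu.
Proof.
move=> kp nk _ [x [xp xn] <-]; rewrite psrc_pcat// in xn.
exists (icat ka x); last by rewrite zelt_cat.
by split; [exact: icat_ipath|rewrite irng_icat].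
Qed.

(** An arrow has presentations with arbitrarily long prefixes, so that those of any
    two arrows can be brought to comparable lengths. *)
Lemma presents_refine mu g nu x n : presents mu g nu x ->
  let ka := iseg x 0 n in
  [/\ is_path ka, psrc nu = prng ka,
    presents (pcat mu (act X g ka)) (restr X g ka) (pcat nu ka) (ishift n x) &
    zelt X mu g nu x = zelt X (pcat mu (act X g ka)) (restr X g ka) (pcat nu ka) (ishift n x)].
Proof.
move=> [am xp xn] ka; have kp : is_path ka by exact: iseg_path.
have sp := ishift_ipath n xp.
have sk : irng (ishift n x) = psrc ka by rewrite psrc_iseg// /irng /ishift addn0.
split => //; first exact: presents_cat.
by rewrite -zelt_cat// icat_iseg.
Qed.

(** The arrows with the presentation of [zelt X mu g nu x], along the paths that
    agree with [x] up to [n]: a neighbourhood base at this arrow. *)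
Definition near_zelt mu g nu x n : set (quad X) :=
  [set zelt X mu g nu y | y in
    [set y | [/\ is_ipath y, irng y = psrc nu & iseg y 0 n = iseg x 0 n]]].

Lemma near_zeltP mu g nu x n b : presents mu g nu x -> near_zelt mu g nu x n b ->
  exists y, [/\ presents mu g nu y, iseg y 0 n = iseg x 0 n & b = zelt X mu g nu y].
Proof. by move=> [am _ _] [y [yp yn yx] <-]; exists y. Qed.

Lemma near_zeltI mu g nu x y n : presents mu g nu y -> iseg y 0 n = iseg x 0 n ->
  near_zelt mu g nu x n (zelt X mu g nu y).
Proof. by move=> [_ yp yn] yx; exists y. Qed.

Lemma near_zelt_mono mu g nu x m n : (m <= n)%N ->
  near_zelt mu g nu x n `<=` near_zelt mu g nu x m.
Proof.
by move=> mn _ [y [yp yn yx] <-]; exists y => //; split => //; exact: iseg_prefix mn yx.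
Qed.

Lemma near_zeltE mu g nu x n (ka := iseg x 0 n) : presents mu g nu x ->
  near_zelt mu g nu x n = zcyl X (pcat mu (act X g ka)) (restr X g ka) (pcat nu ka).
Proof.
move=> pr; have [kp nk _ _] := presents_refine n pr; rewrite -/ka in kp nk.
apply/seteqP; split => b.
  move=> /(near_zeltP pr)[y [pry yx ->]]; have [_ _ pr1 ->] := presents_refine n pry.
  by rewrite yx -/ka in pr1 *; case: pr1 => _ yp yn; exists (ishift n y).
move=> [y [yp yk] <-]; rewrite psrc_pcat// in yk.
rewrite -zelt_cat//; apply: near_zeltI.
  by case: pr => am _ _; split; [|exact: icat_ipath|rewrite irng_icat].
have kn : plen ka = n by rewrite size_iseg subn0.
by rewrite -{1}kn iseg_icat.
Qed.

Hypothesis hpf : pseudo_free X.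

Lemma act_restr_inj g h ka : is_path ka -> act X g ka = act X h ka ->
  restr X g ka = restr X h ka -> g = h.
Proof.
move=> kp e1 e2; have hkp := act_path X h kp.
suff : - h + g = 0 by move=> e; apply/eqP; rewrite -subr_eq0 addrC e.
apply: (hpf kp); first by rewrite actD// e1 actK.
by rewrite restrD// e1 e2 -restrD// addNr restr0.
Qed.

(** With source prefixes of equal length, cylinder sets coincide or are
    disjoint: this is what pseudo-freeness is used for. *)
Lemma zelt_inj mu g nu x mu' g' nu' x' : presents mu g nu x -> presents mu' g' nu' x' ->
  plen nu = plen nu' -> zelt X mu g nu x = zelt X mu' g' nu' x' ->
  [/\ mu = mu', g = g', nu = nu' & x = x'].
Proof.
move=> pr pr' ln [e1 e2 e3 e4].
have [[mp np mn] xp xn] := pr; have [[mp' np' mn'] xp' xn'] := pr'.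
have [enu ex] := icat_inj ln np np' xn xn' e4.
have lm : plen mu = plen mu' by move: e3; rewrite ln; lia.
have [emu eg] := icat_inj lm mp mp' (presents_rng pr) (presents_rng pr') e1.
subst x' nu' mu'; split => //.
move: e2 => /qshift_inj/qclassP[N /(_ N (leqnn N)) h].
apply: (act_restr_inj (iseg_path 0 N xp)) => //.
by rewrite !act_iseg// eg.
Qed.

(** Both presentations are refined until their source prefixes have equal length;
    by [zelt_inj] they then coincide. *)
Lemma near_zelt_sub mu g nu x mu' g' nu' : presents mu g nu x -> admissible X mu' g' nu' ->
  zcyl X mu' g' nu' (zelt X mu g nu x) -> near_zelt mu g nu x (plen nu') `<=` zcyl X mu' g' nu'.
Proof.
move=> pr am' [x' [xp' xn'] e]; rewrite near_zeltE//.
have [_ _ pr1 e1] := presents_refine (plen nu') pr.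
have pr' : presents mu' g' nu' x' by [].
have [kp' nk' pr1' e1'] := presents_refine (plen nu) pr'.
have [||-> -> -> _] := zelt_inj pr1 pr1'; last exact: zcyl_cat.
  by rewrite !plen_pcat !size_iseg; lia.
by rewrite -e1 -e1' e.
Qed.

Lemma nbhs_zelt mu g nu x (W : set (quad X)) : presents mu g nu x ->
  (nbhs (zelt X mu g nu x) W <-> exists n, near_zelt mu g nu x n `<=` W).
Proof.
move=> pr; apply: (nbhs_subbase
  (sb := [set U | exists mu g nu, admissible X mu g nu /\ U = zcyl X mu g nu])).
- by move=> U; split=> [[F sF <-]|[F sF <-]]; exists F.
- exact: near_zelt_mono.
- move=> n; split; last exact: near_zeltI.
  have [_ _ [am _ _] _] := presents_refine n pr; rewrite near_zeltE//.
  by exists (pcat mu (act X g (iseg x 0 n))), (restr X g (iseg x 0 n)), (pcat nu (iseg x 0 n)).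
- move=> _ [mu' [g' [nu' [am' ->]]]] xU; exists (plen nu'); exact: near_zelt_sub.
Qed.

(** ** Groupoid structure *)

Lemma zelt_inv mu g nu x : is_ipath x ->
  (zelt X mu g nu x)^v = zelt X nu (- g) mu (iact X g x).
Proof.
move=> xp; apply: quadE => //=; [by rewrite iactK| |by rewrite opprB].
rewrite -qshiftV qshiftD (_ : - _ + _ = (plen nu)%:Z); last by lia.
congr qshift; rewrite qinvE; congr qclass.
by apply/funext => n; rewrite irestrN.
Qed.

Lemma zelt_mul mu g nu h rho x : is_ipath x ->
  zelt X mu g nu (iact X h x) ** zelt X nu h rho x = zelt X mu (g + h) rho x.
Proof.
move=> xp; apply: quadE => //=.
- by rewrite iactD.
- rewrite qshiftD (_ : _ - _ + _ = (plen mu)%:Z); last by lia.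
  rewrite -qshiftM qmulE; congr (qshift _ (qclass _)).
  by apply/funext => n; rewrite irestrD.
- lia.
Qed.

Lemma presents_inv mu g nu x : presents mu g nu x -> presents nu (- g) mu (iact X g x).
Proof.
move=> pr; have [[mp np mn] xp xn] := pr.
split; [split => //|exact: iact_ipath|exact: presents_rng pr].
by rewrite mn actK.
Qed.

Lemma presents_mul mu g nu h rho x : presents mu g nu (iact X h x) -> presents nu h rho x ->
  presents mu (g + h) rho x.
Proof.
move=> [[mp np mn] _ _] [[_ rp nr] xp xr]; split => //; split => //.
by rewrite mn nr actD.
Qed.

Definition qunit x : quad X := Quad X x qone 0 x.

Lemma qunitE x : is_ipath x -> qunit x = zelt X (vtx (irng x)) 0 (vtx (irng x)) x.
Proof.
move=> xp; apply: quadE => //=; rewrite ?icat_vtx ?iact0// qshift0.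
by congr qclass; apply/funext => n; rewrite irestr0.
Qed.

Lemma presents_unit x : is_ipath x -> presents (vtx (irng x)) 0 (vtx (irng x)) x.
Proof. by move=> xp; split => //; split => //; rewrite act0. Qed.

Lemma qunitD x : is_ipath x -> D (qunit x).
Proof. by move=> xp; rewrite qunitE//; apply: presents_arrow; exact: presents_unit. Qed.

(** Each arrow is refined by the length of the middle prefix of the other; the new
    middle prefixes are initial segments of the same path, of the same length. *)
Lemma composable_presents a b : D a -> D b -> gsrc G a = grng G b ->
  exists mu g nu h rho x, [/\ presents mu g nu (iact X h x), presents nu h rho x,
    a = zelt X mu g nu (iact X h x) & b = zelt X nu h rho x].
Proof.
move=> /arrow_presents[mu [g [nu [x [pr ->]]]]] /arrow_presents[nu' [h [rho [y [pr' ->]]]]].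
move=> [sr _].
have [kp nk pr1 e1] := presents_refine (plen nu') pr.
set ka := iseg _ _ _ in kp nk pr1 e1.
have [kp' nk' pr1' e1'] := presents_refine (plen nu) pr'.
set ka' := iseg _ _ _ in kp' nk' pr1' e1'.
have [[mp1 np1 mn1] xp1 xn1] := pr1; have [[mp1' np1' mn1'] xp1' xn1'] := pr1'.
have sr1 : icat (pcat nu ka) (ishift (plen nu') x) =
    icat (pcat nu' (act X h ka')) (iact X (restr X h ka') (ishift (plen nu) y)).
  by have := congr1 (@qsrc _ _) e1; have := congr1 (@qrng _ _) e1' => /= <- <-.
have [|en ex] := icat_inj _ np1 mp1' xn1 (presents_rng pr1') sr1.
  by rewrite !plen_pcat act_len// !size_iseg; lia.
exists (pcat mu (act X g ka)), (restr X g ka), (pcat nu ka), (restr X h ka'),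
  (pcat rho ka'), (ishift (plen nu) y).
by rewrite -ex; split => //; rewrite en.
Qed.

Lemma ssg_laws : groupoid_laws G.
Proof.
split => //.
- by move=> a Da; apply: qunitD; exact: qrng_ipath.
- by move=> a Da; apply: qunitD; exact: qsrc_ipath.
- move=> a /arrow_presents[mu [g [nu [x [pr ->]]]]]; rewrite zelt_inv; last by case: pr.
  by apply: presents_arrow; exact: presents_inv.
- move=> a b Da Db ab.
  have [mu [g [nu [h [rho [x [pr1 pr2 -> ->]]]]]]] := composable_presents Da Db ab.
  rewrite zelt_mul; last by case: pr2.
  by apply: presents_arrow; exact: presents_mul pr1 pr2.
- move=> a b c _ _ _ _ _; apply: quadE => //=; last by rewrite addrA.
  by rewrite qshiftM qshiftD qmulA.
- by move=> a _; apply: quadE => //=; rewrite ?add0r// qmul1q qshift0.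
- by move=> a _; apply: quadE => //=; rewrite ?addr0// qshift1 qmulC qmul1q.
- move=> a _; apply: quadE => //=; last by rewrite subrr.
  by rewrite qshiftD subrr qshift0 qmulC qmulVq.
- move=> a _; apply: quadE => //=; last by rewrite addNr.
  by rewrite -qshiftM qmulVq qshift1.
Qed.

End CylinderSets.

(** * Cylinder sets form a base of compact open bisections *)

Section CylinderBase.
Variables (E : graph) (X : self_similar E).
Hypothesis hpf : pseudo_free X.
Implicit Types (mu nu ka rho : rawpath E) (x y : infword E) (g h : int) (n : nat).
Implicit Types (U V W : set (quad X)).
Local Notation G := (ssg_groupoid X).
Local Notation D := (arrows G).
Local Notation r := (grng G).
Local Notation s := (gsrc G).
Local Notation "a ** b" := (gmul G a b) (at level 40, left associativity).
Local Notation "a ^v" := (ginv G a) (at level 2, format "a ^v").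

Definition zbase : set (set (quad X)) :=
  [set U | exists mu g nu, admissible X mu g nu /\ U = zcyl X mu g nu].

Lemma zbaseI mu g nu : admissible X mu g nu -> zbase (zcyl X mu g nu).
Proof. by move=> am; exists mu, g, nu. Qed.

Lemma zcyl_presents mu g nu a : admissible X mu g nu -> zcyl X mu g nu a ->
  exists2 x, presents X mu g nu x & a = zelt X mu g nu x.
Proof. by move=> am [x [xp xn] <-]; exists x. Qed.

Lemma presents_zcyl mu g nu x : presents X mu g nu x -> zcyl X mu g nu (zelt X mu g nu x).
Proof. by move=> [am xp xn]; exists x. Qed.

Lemma gsrcE a b : (s a = r b) <-> (qsrc a = qrng b).
Proof. by split=> [[]|h] //; apply: quadE. Qed.

Lemma gsrc_eq a b : (s a = s b) <-> (qsrc a = qsrc b).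
Proof. by split=> [[]|h] //; apply: quadE. Qed.

Lemma grng_eq a b : (r a = r b) <-> (qrng a = qrng b).
Proof. by split=> [[]|h] //; apply: quadE. Qed.

Definition set_mul U V := [set c | exists a b, [/\ U a, V b, s a = r b & c = a ** b]].

Lemma zcyl_inv mu g nu : admissible X mu g nu ->
  [set a^v | a in zcyl X mu g nu] = zcyl X nu (- g) mu.
Proof.
move=> am; apply/seteqP; split => c.
  move=> [_ /(zcyl_presents am)[x pr ->] <-]; rewrite zelt_inv; last by case: pr.
  exact/presents_zcyl/presents_inv.
have am' : admissible X nu (- g) mu.
  by case: am => mp np mn; split => //; rewrite mn actK.
move=> /(zcyl_presents am')[x pr ->]; exists (zelt X mu g nu (iact X (- g) x)).
  by have := presents_inv pr; rewrite opprK => /presents_zcyl.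
have xp : is_ipath x by case: pr.
by rewrite zelt_inv ?iactNK//; exact: iact_ipath.
Qed.

Lemma zcyl_mul mu g nu ka h rho b : is_path ka -> psrc nu = prng ka ->
  admissible X mu g nu -> presents X (pcat nu ka) h rho b ->
  zbase (set_mul (zcyl X mu g nu) (zcyl X (pcat nu ka) h rho)).
Proof.
move=> kp nk am prb; have amb : admissible X (pcat nu ka) h rho by case: prb.
have pr1 y : presents X (pcat nu ka) h rho y ->
    presents X (pcat mu (act X g ka)) (restr X g ka) (pcat nu ka) (iact X h y).
  move=> pry; apply: presents_cat => //; first by apply: iact_ipath; case: pry.
  by rewrite (presents_rng pry) psrc_pcat.
have pr2 y : presents X (pcat nu ka) h rho y ->
    presents X (pcat mu (act X g ka)) (restr X g ka + h) rho y.
  by move=> pry; exact: presents_mul (pr1 _ pry) pry.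
have eqm y : presents X (pcat nu ka) h rho y ->
    zelt X mu g nu (icat ka (iact X h y)) ** zelt X (pcat nu ka) h rho y =
    zelt X (pcat mu (act X g ka)) (restr X g ka + h) rho y.
  move=> pry; have [_ yp yr] := pry; rewrite zelt_cat//; last 2 first.
  - exact: iact_ipath.
  - by rewrite (presents_rng pry) psrc_pcat.
  by rewrite zelt_mul.
exists (pcat mu (act X g ka)), (restr X g ka + h), rho; split; first by case: (pr2 _ prb).
apply/seteqP; split => c.
  move=> [_ [_ [/(zcyl_presents am)[x prx ->] /(zcyl_presents amb)[y pry ->] /gsrcE e ->]]].
  rewrite /= in e.
  have [_ xp xn] := prx; have [[kp' rp kr] yp yr] := pry.
  have le : (plen nu <= plen (pcat nu ka))%N by rewrite plen_pcat leq_addr.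
  have [_ np _] := am.
  have [ka' [kp1 nk1 e1] [e2 e3]] :=
    icat_prefix le np kp' xp (iact_ipath X h yp) xn (presents_rng pry) e.
  have [_ ekk] : nu = nu /\ ka = ka' by apply: pcat_inj.
  subst ka'; rewrite e3 eqm//; exact/presents_zcyl/pr2.
have am2 : admissible X (pcat mu (act X g ka)) (restr X g ka + h) rho by case: (pr2 _ prb).
move=> [y [yp yr] <-]; have pry : presents X (pcat nu ka) h rho y by [].
exists (zelt X mu g nu (icat ka (iact X h y))), (zelt X (pcat nu ka) h rho y).
have hy : irng (iact X h y) = psrc ka by rewrite (presents_rng pry) psrc_pcat.
split; [|exact: presents_zcyl|by apply/gsrcE => /=; rewrite icat_pcat|by rewrite eqm].
apply: presents_zcyl; split => //; first by apply: icat_ipath => //; exact: iact_ipath.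
by rewrite irng_icat.
Qed.

(** When the source prefix [nu] is the longer one, the product is computed as the
    inverse of the product of the inverses. *)
Lemma zbase_mul U V a b : zbase U -> zbase V -> U a -> V b -> s a = r b -> zbase (set_mul U V).
Proof.
move=> [mu [g [nu [am ->]]]] [nu' [h [rho [am' ->]]]].
move=> /(zcyl_presents am)[x prx ->] /(zcyl_presents am')[y pry ->] /gsrcE /= e.
have [[mp np mn] xp xn] := prx; have [[np' rp nr] yp yr] := pry.
have hyp := iact_ipath X h yp; have hyn := presents_rng pry.
have [le|le] := leqP (plen nu) (plen nu').
  have [ka [kp nk nE] [e2 e3]] := icat_prefix le np np' xp hyp xn hyn e.
  by subst nu'; exact: zcyl_mul pry.
have [ka [kp nk nE] [e2 e3]] := icat_prefix (ltnW le) np' np hyp xp hyn xn (esym e).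
subst nu.
have prx' := presents_inv prx.
have am2 : admissible X rho (- h) nu' by case: (presents_inv pry).
have [mu1 [g1 [nu1 [am1 e1]]]] := zcyl_mul kp nk am2 prx'.
exists nu1, (- g1), mu1; split.
  by case: am1 => ? ? q; split => //; rewrite q actK.
rewrite -zcyl_inv// -e1; have gl := ssg_laws X.
have zD mu2 g2 nu2 c : admissible X mu2 g2 nu2 -> zcyl X mu2 g2 nu2 c -> D c.
  by move=> am3 zc; exists mu2, g2, nu2.
rewrite -(zcyl_inv am) -(zcyl_inv am'); apply/seteqP; split => c.
  move=> [a1 [b1 [a1U b1V ab ->]]].
  have Da := zD _ _ _ _ am a1U; have Db := zD _ _ _ _ am' b1V.
  exists (b1^v ** a1^v).
    by exists b1^v, a1^v; split => //; [exists b1|exists a1].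
  by rewrite -(gpd_invM gl)// (gpd_invK gl)//; exact: (arrows_mul gl).
move=> [_ [_ [_ [[b1 b1V <-] [a1 a1U <-] ab ->]]] <-].
have Da := zD _ _ _ _ am a1U; have Db := zD _ _ _ _ am' b1V.
rewrite (src_inv gl) (rng_inv gl) in ab.
exists a1, b1; split => //.
by rewrite -(gpd_invM gl)// (gpd_invK gl)//; exact: (arrows_mul gl).
Qed.

(** An ultrafilter decides each letter of the source path because there are finitely
    many edges; the decided letters form the path of its limit. *)
Lemma zcyl_compact mu g nu : admissible X mu g nu -> compact (zcyl X mu g nu).
Proof.
move=> am; rewrite compact_ultra => F FU FZ.
have letter n : exists e, F [set a : quad X | qsrc a (plen nu + n)%N = e].
  apply: contrapT => none.
  have : \forall a \near F, forall e : edge E, qsrc (a : quad X) (plen nu + n)%N <> e.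
    apply: filter_forall => e.
    have [h|//] := in_ultra_setVsetC [set a : quad X | qsrc a (plen nu + n)%N = e] FU.
    by exfalso; apply: none; exists e.
  move=> /filter_ex[a /(_ _)]; exact.
have [x xF] := choice letter.
have agree n : F [set a : quad X | forall i, (i < n)%N -> qsrc a (plen nu + i)%N = x i].
  have : \forall a \near F, forall i : 'I_n, qsrc (a : quad X) (plen nu + i)%N = x i.
    by apply: filter_forall => i; exact: xF.
  by apply: filterS => a h i lt; have := h (Ordinal lt).
have agreeZ n : F (zcyl X mu g nu `&`
    [set a : quad X | forall i, (i < n)%N -> qsrc a (plen nu + i)%N = x i]).
  by apply: filterI => //; exact: agree.
have pref n a : (zcyl X mu g nu `&`
    [set a : quad X | forall i, (i < n)%N -> qsrc a (plen nu + i)%N = x i]) a ->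
    (0 < n)%N -> exists y, [/\ presents X mu g nu y, iseg y 0 n = iseg x 0 n & a = zelt X mu g nu y].
  move=> [/(zcyl_presents am)[y pry ->] ah] n0; exists y; split => //.
  have yx i : (i < n)%N -> y i = x i.
    by move=> lt; rewrite -ah//= icat_ge ?leq_addr// addKn.
  apply: pathE; first by rewrite /= yx.
  rewrite /=; apply/eq_in_map => i; rewrite mem_iota subn0 => /andP[_ lt]; exact: yx.
have near n : (0 < n)%N -> exists2 y, presents X mu g nu y & iseg y 0 n = iseg x 0 n.
  by move=> n0; have /filter_ex[a /pref /(_ n0)[y [pry yx _]]] := agreeZ n; exists y.
have xp : is_ipath x.
  move=> i; have [//|y [_ yp _] yx] := near i.+2.
  have yE j : (j < i.+2)%N -> y j = x j.
    move=> lt; have := congr1 (fun w => nth (x 0%N) w.2 j) yx.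
    by rewrite !iseg_nth ?subn0.
  by rewrite -!yE// ltnS leqnSn.
have xn : irng x = psrc nu.
  by have [//|y [_ yp <-] yx] := near 1%N; rewrite /irng; case: yx => ->.
have pr : presents X mu g nu x by [].
exists (zelt X mu g nu x); split; first exact: presents_zcyl.
move=> W /(nbhs_zelt hpf _ pr)[n nW].
apply: filterS (agreeZ n.+1) => a /pref/(_ isT)[y [pry yx ->]]; apply: nW.
by apply: near_zeltI => //; exact: iseg_prefix yx.
Qed.

Lemma zbase_near mu g nu x n : presents X mu g nu x -> zbase (near_zelt mu g nu x n).
Proof.
move=> pr; rewrite near_zeltE//; apply: zbaseI.
by have [_ _ [am _ _] _] := presents_refine n pr.
Qed.

Lemma near_zelt_self mu g nu x n : presents X mu g nu x ->
  near_zelt mu g nu x n (zelt X mu g nu x).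
Proof. by move=> pr; exact: near_zeltI. Qed.

Lemma ssg_ample : ample_base G zbase.
Proof.
split.
- by move=> _ [mu [g [nu [am ->]]]] a aU; exists mu, g, nu.
- move=> _ a b [mu [g [nu [am ->]]]] /(zcyl_presents am)[x prx ->].
  move=> /(zcyl_presents am)[y pry ->] /grng_eq /= e.
  have [[mp np mn] xp xn] := prx; have [_ yp yn] := pry.
  have [_ e2] := icat_inj erefl mp mp (presents_rng prx) (presents_rng pry) e.
  by rewrite -(iactK X g xp) e2 iactK.
- move=> _ a b [mu [g [nu [am ->]]]] /(zcyl_presents am)[x prx ->].
  move=> /(zcyl_presents am)[y pry ->] /gsrc_eq /= e.
  have [[mp np mn] xp xn] := prx; have [_ yp yn] := pry.
  by have [_ ->] := icat_inj erefl np np xn yn e.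
- move=> a W /arrow_presents[mu [g [nu [x [pr ->]]]]]; split.
    move=> /(nbhs_zelt hpf _ pr)[n nW]; exists (near_zelt mu g nu x n).
      exact: zbase_near.
    by split => //; exact: near_zelt_self.
  move=> [_ [mu' [g' [nu' [am' ->]]]] [xU UW]]; apply/(nbhs_zelt hpf _ pr).
  by exists (plen nu'); apply: subset_trans UW; exact: near_zelt_sub.
- exact: zbase_mul.
- move=> _ [mu [g [nu [am ->]]]]; rewrite zcyl_inv//; apply: zbaseI.
  by case: am => ? ? q; split => //; rewrite q actK.
- by move=> _ [mu [g [nu [am ->]]]]; exact: zcyl_compact.
- move=> _ a [mu [g [nu [am ->]]]] /arrow_presents[mu' [g' [nu' [x [pr ->]]]]] aU.
  exists (near_zelt mu' g' nu' x (plen nu)); first exact: zbase_near.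
  split; first exact: near_zelt_self.
  (* agreement up to [plen nu] being symmetric, a common point would put [a] in
     the cylinder set as well *)
  move=> _ /(near_zeltP pr)[y [pry yx ->]] yU; apply: aU.
  by apply: (near_zelt_sub hpf pry am yU); exact: near_zeltI.
- move=> a Da; have rp := qrng_ipath Da.
  exists (zcyl X (vtx (irng (qrng a))) 0 (vtx (irng (qrng a)))).
    by apply: zbaseI; case: (presents_unit X rp).
  split; first by have := presents_zcyl (presents_unit X rp); rewrite -qunitE.
  move=> b [y [yp yn] <-]; have yn' : irng y = irng (qrng a) by [].
  by rewrite -yn' -qunitE.
move=> a b Da Db ab.
have [mu [g [nu [x [pr aE]]]]] := arrow_presents Da.
have [sab|sab] := pselect (qsrc a = qsrc b).
  have am : admissible X mu g nu by case: pr.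
  exists (zcyl X mu g nu); first exact: zbaseI.
  split; first by rewrite aE; exact: presents_zcyl.
  move=> /(zcyl_presents am)[y pry bE]; apply: ab; rewrite aE bE.
  have [[mp np mn] xp xn] := pr; have [_ yp yn] := pry.
  have := sab; rewrite aE bE /= => e.
  by have [_ ->] := icat_inj erefl np np xn yn e.
have [i di] : exists i, qsrc a i <> qsrc b i.
  by apply: contrapT => h; apply: sab; apply/funext => i; apply: contrapT => hi; apply: h; exists i.
exists (near_zelt mu g nu x i.+1); first exact: zbase_near.
split; first by rewrite aE; exact: near_zelt_self.
move=> /(near_zeltP pr)[y [pry yx bE]]; apply: di; rewrite aE bE /=.
by apply/esym; apply: icat_agree yx; rewrite ltn_addl.
Qed.

End CylinderBase.

(** * Infinite paths that are alone at their range *)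

Section Cycles.
Variables (E : graph) (X : self_similar E).
Implicit Types (mu nu ka : rawpath E) (x y z : infword E) (g h : int) (n i j : nat).
Implicit Types (v w : vertex E).

Lemma ipath_from v : source_free E -> exists2 x, is_ipath x & irng x = v.
Proof.
move=> sf; have [nxt nxtE] := choice sf.
exists (fun n => iter n (fun e => nxt (sce e)) (nxt v)); last exact: nxtE.
by move=> i; rewrite iterS nxtE.
Qed.

Lemma pigeonhole (f : nat -> vertex E) : exists i j, (i < j)%N /\ f i = f j.
Proof.
apply: contrapT => no.
have inj : injective (fun i : 'I_#|vertex E|.+1 => f i).
  move=> i j fij; apply/val_inj => /=; apply: contrapT => /eqP.
  by rewrite neq_ltn => /orP[lt|lt]; apply: no; [exists i, j|exists j, i].
by have := leq_card _ inj; rewrite card_ord ltnn.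
Qed.

Definition lonely y := is_ipath y /\ forall z, is_ipath z -> irng z = irng y -> z = y.

Lemma lonely_shift n y : lonely y -> lonely (ishift n y).
Proof.
move=> [yp yu]; split; first exact: ishift_ipath.
move=> z zp zy; have kp := iseg_path 0 n yp.
have zk : irng z = psrc (iseg y 0 n) by rewrite psrc_iseg// zy /irng /ishift addn0.
have : icat (iseg y 0 n) z = y by apply: yu; [exact: icat_ipath|rewrite irng_icat].
by move=> h; have := icat_shift (iseg y 0 n) z; rewrite h size_iseg subn0 => ->.
Qed.

Lemma lonely_act g y : lonely y -> lonely (iact X g y).
Proof.
move=> [yp yu]; split; first exact: iact_ipath.
move=> z zp zy; rewrite -(iactNK X g zp); congr iact.
apply: yu; first exact: iact_ipath.
by apply: vtx_inj; rewrite irng_iact// zy irng_iact// actK.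
Qed.

Lemma lonely_fixed g y : lonely y -> act X g (vtx (irng y)) = vtx (irng y) -> iact X g y = y.
Proof.
move=> [yp yu] gy; apply: yu; first exact: iact_ipath.
by apply: vtx_inj; rewrite irng_iact.
Qed.

Lemma lonely_cycle x : lonely x -> exists i L, (0 < L)%N /\ ishift L (ishift i x) = ishift i x.
Proof.
move=> lx; have [i [j [ij fij]]] := pigeonhole (fun n => rge (x n)).
exists i, (j - i)%N; rewrite subn_gt0; split => //.
have [_ yu] := lonely_shift i lx; apply: yu.
  by do 2 apply: ishift_ipath; case: lx.
by rewrite /irng /ishift addn0 addn0 subnKC// ltnW.
Qed.

(** The prefix of length [n] of [y] determines that of [m (g y)], which is longer
    by the length of [m]. *)
Lemma contraction_lonely m g x : is_path m -> (0 < plen m)%N -> is_ipath x ->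
  (forall y, is_ipath y -> irng y = irng x ->
     irng (iact X g y) = psrc m /\ y = icat m (iact X g y)) -> lonely x.
Proof.
move=> mp m0 xp fx; split => // y yp yx; apply: ipath_eq => n.
have [sx ex] := fx _ xp erefl; have [sy ey] := fx _ yp yx.
elim: n => [|n ih]; first by apply: pathE => //; exact: yx.
apply: (@iseg_prefix _ _ _ _ (plen m + n)); first by lia.
rewrite ex ey !iseg_icatD//; try exact: iact_ipath.
by rewrite -!act_iseg// ih.
Qed.

Section Twist.
Variables (y : infword E) (L : nat).
Hypotheses (ly : lonely y) (L0 : (0 < L)%N) (yL : ishift L y = y) (sf : source_free E).
Let yp : is_ipath y := ly.1.
Let C := iseg y 0 L.
Let w := irng y.

Lemma cycle_path : is_path C. Proof. exact: iseg_path. Qed.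

Lemma cycle_psrc : psrc C = w.
Proof. by rewrite psrc_iseg// /w /irng -[in RHS]yL /ishift addn0. Qed.

Lemma cycle_plen : plen C = L. Proof. by rewrite size_iseg subn0. Qed.

Lemma cycle_icat : icat C y = y.
Proof. by rewrite -{1}yL icat_iseg. Qed.

Lemma lonely_is_cycle : is_cycle C.
Proof. by split; [exact: cycle_path|rewrite cycle_plen|rewrite cycle_psrc]. Qed.

Lemma mem_cycle f : f \in C.2 -> exists2 n, (n < L)%N & f = y n.
Proof. by move=> /mapP[n]; rewrite mem_iota subn0 => /andP[_ nL] ->; exists n. Qed.

(** An entrance would start a second path with the range of [y]. *)
Lemma lonely_no_entrance : no_entrance C.
Proof.
move=> e f /mem_cycle[n nL ->] efn.
have [x xp xe] := ipath_from (sce e) sf.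
have ep : is_path (rge e, [:: e]) by rewrite /is_path /= eqxx.
have xs : irng x = psrc (rge e, [:: e]) by [].
have [_ yu] := lonely_shift n ly.
have := yu _ (icat_ipath ep xp xs); rewrite irng_icat// => h.
have := congr1 (@^~ 0%N) (h _); rewrite /icat /ishift /= addn0; apply.
by rewrite /irng addn0.
Qed.

(** A group element fixing one vertex of the cycle fixes the only path starting
    there, and this path runs through the base point. *)
Lemma cycle_vertex_fixed g v : on_cycle C v -> act X g (vtx v) = vtx v ->
  act X g (vtx w) = vtx w.
Proof.
move=> /mapP[f /mem_cycle[n nL ->] ->] gv.
have lz := lonely_shift n ly; have [zp _] := lz.
have gz : iact X g (ishift n y) = ishift n y.
  by apply: lonely_fixed => //; rewrite /irng /ishift addn0.
have := rge_iact X g (L - n) zp; rewrite gz /ishift (subnKC (ltnW nL)).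
have -> : rge (y L) = w by rewrite /w /irng -[in RHS]yL /ishift addn0.
by move=> <-.
Qed.

Lemma base_on_cycle : on_cycle C w.
Proof.
apply/mapP; exists (y 0%N) => //; rewrite /C /= subn0; apply/mapP; exists 0%N => //.
by rewrite mem_iota.
Qed.

Lemma fixer_sub g h : act X g (vtx w) = vtx w -> act X h (vtx w) = vtx w ->
  act X (g - h) (vtx w) = vtx w.
Proof. by move=> gw hw; rewrite actD// -{1}hw actK. Qed.

Lemma fixer_mul g t : act X g (vtx w) = vtx w -> act X (t * g) (vtx w) = vtx w.
Proof.
move=> gw; have nat_case (n : nat) : act X (n%:Z * g) (vtx w) = vtx w.
  elim: n => [|n ih]; first by rewrite mul0r act0.
  by rewrite -addn1 PoszD mulrDl mul1r actD// gw.
case: t => n; first exact: nat_case.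
rewrite NegzE mulNr -[X in act _ X]add0r; apply: fixer_sub; first exact: act0.
exact: nat_case.
Qed.

Lemma restr_mul g t : act X g C = C -> restr X (t * g) C = t * restr X g C.
Proof.
move=> gC; have Cp := cycle_path.
have nat_case (n : nat) : act X (n%:Z * g) C = C /\ restr X (n%:Z * g) C = n%:Z * restr X g C.
  elim: n => [|n [ih1 ih2]]; first by rewrite !mul0r act0// restr0.
  by rewrite -addn1 PoszD mulrDl mul1r actD// restrD// gC ih1 ih2 mulrDl mul1r.
case: t => n; first by have [] := nat_case n.
have [h1 h2] := nat_case n.+1.
have : restr X (- (n.+1%:Z * g) + n.+1%:Z * g) C = 0 by rewrite addNr restr0.
rewrite restrD// h1 h2 NegzE !mulNr => /eqP; rewrite addr_eq0 => /eqP ->.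
by [].
Qed.

Lemma irestr_cycle g t (j : nat) (c : int) : act X g C = C -> restr X g C = c * g ->
  irestr X (t * g) y (j * L) = t * c ^+ j * g.
Proof.
move=> gC gc; elim: j t => [|j ih] t.
  by rewrite mul0n expr0 mulr1 /irestr (_ : iseg y 0 0 = vtx w)// restr_vtx.
rewrite -{1}cycle_icat mulSn -{1}cycle_plen irestr_icat//; last by rewrite cycle_psrc.
  by rewrite restr_mul// gc mulrA ih exprS mulrA.
exact: cycle_path.
Qed.

Lemma irestr_mul g t p : iact X g y = y -> irestr X (t * g) y p = t * irestr X g y p.
Proof.
move=> gy; have nat_case (n : nat) :
    iact X (n%:Z * g) y = y /\ irestr X (n%:Z * g) y p = n%:Z * irestr X g y p.
  elim: n => [|n [ih1 ih2]]; first by rewrite !mul0r iact0// irestr0.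
  by rewrite -addn1 PoszD mulrDl mul1r iactD// irestrD// gy ih1 ih2 mulrDl mul1r.
case: t => n; first by have [] := nat_case n.
have [h1 h2] := nat_case n.+1.
rewrite NegzE !mulNr -{1}h1 irestrN// h2.
by [].
Qed.

(** The generator [a^p] of the stabiliser of [w] restricts along the cycle to
    its power of exponent [c], so along [y] the restrictions are the powers of
    exponents [c ^ j]; these never become periodic as [c] is not [1], [0] or [-1]. *)
Lemma cycle_twist : pseudo_free X ->
  (forall p : nat, (0 < p)%N ->
     (exists2 v, on_cycle C v & act X p%:Z (vtx v) = vtx v) ->
     (forall q : nat, (0 < q)%N ->
        (exists2 v, on_cycle C v & act X q%:Z (vtx v) = vtx v) -> (p <= q)%N) ->
     restr X p%:Z C <> p%:Z /\ restr X p%:Z C <> - p%:Z) ->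
  exists2 h, iact X h y = y &
    forall k : int, k <> 0 -> qshift k (qclass (irestr X h y)) <> qclass (irestr X h y).
Proof.
move=> hpf hcyc; have Cp := cycle_path.
pose P (q : nat) := (0 < q)%N && [exists v, on_cycle C v && (act X q%:Z (vtx v) == vtx v)].
have PP q : reflect ((0 < q)%N /\ exists2 v, on_cycle C v & act X q%:Z (vtx v) = vtx v) (P q).
  apply: (iffP andP) => -[q0]; first by move=> /existsP[v /andP[vC /eqP qv]]; split => //; exists v.
  by move=> [v vC qv]; split => //; apply/existsP; exists v; rewrite vC qv eqxx.
have exP : exists q, P q.
  have [i [j [ij fij]]] := pigeonhole (fun n => prng (act X n%:Z (vtx w))).
  exists (j - i)%N; apply/PP; split; first by rewrite subn_gt0.
  exists w; first exact: base_on_cycle.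
  have -> : (j - i)%N%:Z = - i%:Z + j%:Z by lia.
  have e : act X i%:Z (vtx w) = act X j%:Z (vtx w) by rewrite -[LHS]vtx_act fij vtx_act.
  by rewrite actD// -e actK.
case: (ex_minnP exP) => p /PP[p0 [v vC pv]] pmin.
have [||] := hcyc p p0; first by exists v.
  by move=> q q0 hq; apply: pmin; apply/PP.
have pw := cycle_vertex_fixed vC pv.
have py : iact X p y = y by exact: lonely_fixed.
have pC : act X p C = C by rewrite act_iseg// py.
set q := restr X p C => q1 q2.
have qy : iact X q y = y.
  have : iact X p (icat C y) = icat C y by rewrite cycle_icat.
  rewrite iact_icat ?cycle_psrc// pC -/q => /(congr1 (ishift (plen C))).
  by rewrite !icat_shift.
have qw : act X q (vtx w) = vtx w by rewrite -irng_iact// qy.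
pose c := (q %/ p)%Z; have pn0 : p%:Z != 0 by lia.
have qE : q = c * p.
  rewrite (divz_eq q p) -/c; suff -> : (q %% p)%Z = 0 by rewrite addr0.
  have remw : act X (q %% p)%Z (vtx w) = vtx w.
    have -> : (q %% p)%Z = q - c * p by rewrite {2}(divz_eq q p) addrC addKr.
    by apply: fixer_sub => //; exact: fixer_mul.
  have := modz_ge0 q pn0; have := ltz_pmod q (d := p); rewrite ltz_nat => /(_ p0).
  case: (q %% p)%Z remw => // k kw kp _; case: (posnP k) => [->//|k0].
  have : (p <= k)%N by apply: pmin; apply/PP; split => //; exists w => //; exact: base_on_cycle.
  by rewrite leqNgt; move: kp; rewrite ltz_nat => ->.
have q0 : q <> 0 by move=> q0; have := hpf _ _ Cp pC q0; apply/eqP.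
exists p%:Z => // k k0 /[1!qshiftE] /qclassP[N hN].
set f := irestr X p y in hN.
pose K := `|k|%N; have K0 : (0 < K)%N by rewrite absz_gt0; apply/eqP.
have per n : (N + K <= n)%N -> f (n + K)%N = f n.
  move=> hn; have [kpos|kneg] := leP 0 k.
    rewrite -hN ?tshiftE; try lia.
    congr f; lia.
  rewrite -[RHS]hN ?tshiftE; try lia.
  congr f; lia.
have perM n i : (N + K <= n)%N -> f (n + K * i)%N = f n.
  move=> hn; elim: i => [|i ih]; first by rewrite muln0 addn0.
  rewrite (_ : n + K * i.+1 = n + K * i + K)%N; last by rewrite mulnS; lia.
  rewrite per ?ih//; lia.
have fE j : f (j * L)%N = c ^+ j * p.
  by rewrite /f -{1}[p%:Z]mul1r (irestr_cycle _ _ pC qE) mul1r.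
have NKL : (N + K <= (N + K) * L)%N by rewrite leq_pmulr.
have := perM _ L NKL; rewrite (_ : _ + _ = (N + K + K) * L)%N; last by rewrite [RHS]mulnDl.
rewrite !fE => /(mulIf pn0); rewrite exprD.
have c0 : c != 0 by apply/eqP => c0; apply: q0; rewrite qE c0 mul0r.
move=> h; have cK : c ^+ K = 1.
  by apply: (mulfI (expf_neq0 (N + K)%N c0)); rewrite h mulr1.
have : (`|c| ^ K = 1)%N by rewrite -abszX cK.
case cE : `|c|%N => [|[|a]].
- by rewrite exp0n.
- move=> _; have [e|e] : c = 1 \/ c = -1 by lia.
    by apply: q1; rewrite qE e mul1r.
  by apply: q2; rewrite qE e mulN1r.
by move=> e; have := ltn_expl K (isT : (1 < a.+2)%N); rewrite e; lia.
Qed.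

End Twist.

End Cycles.

(** * The symmetric cycline subgroupoid *)

Section PathTopology.
Variable E : graph.
Implicit Types (mu : rawpath E) (x y : infword E).

Lemma cylinderP mu y : is_path mu ->
  cylinder mu y <-> is_ipath y /\ iseg y 0 (plen mu) = mu.
Proof.
move=> mp; split=> [[x [xp xm] <-]|[yp ymu]].
  by split; [exact: icat_ipath|exact: iseg_icat].
have e := icat_iseg y (plen mu); rewrite ymu in e.
exists (ishift (plen mu) y) => //; split; first exact: ishift_ipath.
by have := psrc_iseg yp (leq0n (plen mu)); rewrite ymu => ->; rewrite /irng /ishift addn0.
Qed.

Lemma nbhs_infword x (W : set (infword E)) : is_ipath x ->
  (nbhs x W <-> exists n, forall y, is_ipath y -> iseg y 0 n = iseg x 0 n -> W y).
Proof.
move=> xp; have sn n : plen (iseg x 0 n) = n by rewrite size_iseg subn0.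
have cylE n y : cylinder (iseg x 0 n) y <-> is_ipath y /\ iseg y 0 n = iseg x 0 n.
  by have := cylinderP y (iseg_path 0 n xp); rewrite sn.
have -> : nbhs x W <-> exists n, cylinder (iseg x 0 n) `<=` W.
  apply: (nbhs_subbase (sb := [set cylinder mu | mu in [set mu | is_path mu]])).
  - by move=> U; split=> [[F sF <-]|[F sF <-]]; exists F.
  - move=> m n mn y /cylE[yp yx]; apply/cylE; split => //; exact: iseg_prefix yx.
  - move=> n; split; last by apply/cylE.
    by exists (iseg x 0 n) => //; exact: iseg_path.
  move=> _ [mu mp <-] /(cylinderP _ mp)[_ xmu]; exists (plen mu) => y /cylE[yp yx].
  by apply/(cylinderP _ mp); rewrite yx.
by split=> -[n h]; exists n => y; [move=> yp yx; apply/h/cylE|move=> /cylE[]; exact: h].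
Qed.

Lemma fixes_nbhdP (X : self_similar E) g x : is_ipath x ->
  (fixes_nbhd X g x <->
   exists n, forall y, is_ipath y -> iseg y 0 n = iseg x 0 n -> iact X g y = y).
Proof.
move=> xp; split=> [/(nbhs_infword _ xp)[n h]|[n h]].
  by exists n => y yp yx; exact: h.
by apply/(nbhs_infword _ xp); exists n => y yp yx _; exact: h.
Qed.

End PathTopology.

Section SymmetricSubgroupoid.
Variables (E : graph) (X : self_similar E).
Hypotheses (hsf : source_free E) (hpf : pseudo_free X).
Hypothesis hgr : forall (x : infword E) (g : int), is_ipath x -> generic X g x \/ rare X g x.
Hypothesis hcyc : forall (C : rawpath E) (p : nat), is_cycle C -> no_entrance C -> (0 < p)%N ->
  (exists2 v, on_cycle C v & act X p%:Z (vtx v) = vtx v) ->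
  (forall q : nat, (0 < q)%N ->
    (exists2 v, on_cycle C v & act X q%:Z (vtx v) = vtx v) -> (p <= q)%N) ->
  restr X p%:Z C <> p%:Z /\ restr X p%:Z C <> - p%:Z.
Implicit Types (mu nu ka rho : rawpath E) (x y : infword E) (g h : int).
Implicit Types (U V W : set (quad X)) (a b c : quad X).
Local Notation G := (ssg_groupoid X).
Local Notation D := (arrows G).
Local Notation S := (Ssym X).
Local Notation r := (grng G).
Local Notation s := (gsrc G).
Local Notation zbase := (@zbase E X).
Local Notation "a ** b" := (gmul G a b) (at level 40, left associativity).
Local Notation "a ^v" := (ginv G a) (at level 2, format "a ^v").

Let gl := ssg_laws X.
Let ab := ssg_ample hpf.

Definition iso0 a : Prop := qrng a = qsrc a /\ qdeg a = 0.

(** [Ssym X] is the interior of the isotropy of degree zero; its algebraic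
    closure properties all follow from this description. *)
Lemma SsymP a : S a <-> exists2 U, zbase U & U a /\ forall b, U b -> iso0 b.
Proof.
split=> [[mu [g [[am cyc] az]]]|[_ [mu [g [nu [am ->]]]] [aU Uiso]]].
  exists (zcyl X mu g mu); first exact: zbaseI.
  split => // b [x [xp xm] <-]; split => /=; first exact: cyc.
  by rewrite subrr.
have [x pr aE] := zcyl_presents am aU; have [[mp np mn] xp xn] := pr.
have [/= _ deg] := Uiso _ (presents_zcyl pr).
have lmn : plen mu = plen nu by lia.
have [/= e _] := Uiso _ (presents_zcyl pr).
have [munu _] := icat_inj lmn mp np (presents_rng pr) xn e.
subst nu; exists mu, g; split => //; split => // y yp ym.
have pry : presents X mu g mu y by [].
by have [/= ->] := Uiso _ (presents_zcyl pry).
Qed.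

Lemma Ssym_iso0 a : S a -> iso0 a.
Proof. by move=> /SsymP[U _ [Ua h]]; exact: h. Qed.

Lemma Ssym_sub : S `<=` D.
Proof. by move=> a /SsymP[U bU [Ua _]]; exact: (base_sub ab bU). Qed.

Lemma Ssym_mul a b : S a -> S b -> s a = r b -> S (a ** b).
Proof.
move=> /SsymP[U bU [Ua hU]] /SsymP[V bV [Vb hV]] sab; apply/SsymP.
exists (set_mul U V); first exact: (base_mul ab bU bV Ua Vb sab).
split; first by exists a, b.
move=> _ [a' [b' [/hU[ra da] /hV[rb db] /gsrcE e ->]]]; split => /=.
  by rewrite ra e rb.
by rewrite da db.
Qed.

Lemma Ssym_inv a : S a -> S a^v.
Proof.
move=> /SsymP[U bU [Ua hU]]; apply/SsymP; exists [set b^v | b in U]; first exact: (base_inv ab).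
split; first by exists a.
by move=> _ [b /hU[rb db] <-]; split => /=; rewrite ?rb// db oppr0.
Qed.

Lemma Ssym_open a : S a -> exists2 U, zbase U & U a /\ U `<=` S.
Proof.
move=> /SsymP[U bU [Ua hU]]; exists U => //; split => // b Ub.
by apply/SsymP; exists U.
Qed.

(** Near [a] and [b], a product [b' a' b''^-1] with [a'] in the isotropy has
    [s b' = s b''], so [b' = b''] because both lie in one bisection; hence the product
    is in the isotropy, and the degrees of [b'] and its inverse cancel. *)
Lemma Ssym_normal a b : S a -> D b -> s b = r a -> S ((b ** a) ** b^v).
Proof.
move=> /[dup] Sa /SsymP[U bU [Ua hU]] Db sba; have Da := Ssym_sub Sa.
have [V bV Vb] := base_at ab Db.
have bVU := base_mul ab bV bU Vb Ua sba; rewrite -/(set_mul V U) in bVU.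
have iV := base_inv ab bV.
have VUba : set_mul V U (b ** a) by exists b, a.
have iVb : [set c^v | c in V] b^v by exists b.
have [ra _] := Ssym_iso0 Sa.
have e1 : s (b ** a) = r b^v.
  by rewrite (src_mul gl) (rng_inv gl) sba; apply: quadE => /=.
apply/SsymP; exists (set_mul (set_mul V U) [set c^v | c in V]).
  exact: (base_mul ab bVU iV VUba iVb e1).
split; first by exists (b ** a), b^v.
move=> _ [_ [_ [[b' [a' [Vb' Ua' e ->]]] [b'' Vb'' <-] /gsrcE e' ->]]].
have [ra' da'] := hU _ Ua'.
have b'E : b' = b''.
  apply: (base_sinj ab bV Vb' Vb''); apply/gsrc_eq; move/gsrcE: e => ->.
  by rewrite ra'; exact: e'.
subst b''; split => //=.
by rewrite da' addr0 subrr.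
Qed.

(** This is where genericity and rarity enter. Let [a] have degree zero and equal
    range and source, over [x]. If [x] is generic, [g] fixes a neighbourhood of
    [x] and [a] is symmetric. If [x] is rare, no symmetric arrow is close to [a]. *)
Lemma Ssym_closed a : D a -> ~ S a -> exists2 U, zbase U & U a /\ forall b, U b -> ~ S b.
Proof.
move=> Da Sa; have [mu [g [nu [x [pr aE]]]]] := arrow_presents Da.
have am : admissible X mu g nu by case: pr.
have [dega|dega] := eqVneq (plen mu) (plen nu); last first.
  exists (zcyl X mu g nu); first exact: zbaseI.
  split; first by rewrite aE; exact: presents_zcyl.
  by move=> b /(zcyl_presents am)[y pry ->] /Ssym_iso0[/= _ e]; apply/eqP: dega; lia.
have [rs|rs] := pselect (qrng a = qsrc a); last first.
  have [i di] : exists i, qrng a i <> qsrc a i.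
    by apply: contrapT => h; apply: rs; apply/funext => i; apply: contrapT => hi; apply: h; exists i.
  exists (near_zelt mu g nu x i.+1); first exact: zbase_near.
  split; first by rewrite aE; exact: near_zelt_self.
  move=> b /(near_zeltP pr)[y [[_ yp _] yx ->]] /Ssym_iso0[/= e _].
  have gyx : iseg (iact X g y) 0 i.+1 = iseg (iact X g x) 0 i.+1.
    by rewrite -!act_iseg ?yx//; case: pr.
  apply: di; rewrite aE /= -(icat_agree _ gyx) ?ltn_addl//.
  by rewrite -(icat_agree _ yx) ?ltn_addl// e.
have [[mp np mn] xp xn] := pr; move: rs Sa; rewrite aE /= => rs Sa.
have [munu gx] := icat_inj dega mp np (presents_rng pr) xn rs.
subst nu; have [|] := hgr g xp.
  move=> [//|/(fixes_nbhdP _ _ xp)[n hn]]; exfalso; apply: Sa; apply/SsymP.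
  exists (near_zelt mu g mu x n); first exact: zbase_near.
  split; first exact: near_zelt_self.
  move=> b /(near_zeltP pr)[y [[_ yp _] yx ->]].
  by split => /=; rewrite ?subrr// (hn _ yp yx).
move=> [_ [N hN]]; exists (near_zelt mu g mu x N); first exact: zbase_near.
split; first exact: near_zelt_self.
(* a symmetric cycline neighbourhood of an arrow over [y] shows that [g] fixes a
   neighbourhood of [y] *)
move=> _ /(near_zeltP pr)[y [pry yx ->]] /SsymP[_ [mu2 [g2 [nu2 [am2 ->]]]] [yU hU]].
have [_ yp yn] := pry; apply: (hN y).
  apply/cylinderP; first exact: iseg_path.
  by rewrite size_iseg subn0.
apply/fixes_nbhdP => //; exists (plen nu2) => z zp zy.
have prz : presents X mu g mu z.
  by split => //; rewrite -yn; have := congr1 (@prng E) zy.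
have [/= e _] := hU _ (near_zelt_sub hpf pry am2 yU (near_zeltI prz zy)).
by move: e => /(congr1 (ishift (plen mu))); rewrite !icat_shift.
Qed.

Lemma Ssym_clopen : clopen_subgroupoid G zbase S.
Proof.
split; [exact: Ssym_sub|split; [exact: Ssym_open|exact: Ssym_closed]|exact: Ssym_mul|exact: Ssym_inv].
Qed.

(** With [mu = nu m] the cycline condition reads [y = m (g y)] for all [y] with the
    range of [x]. *)
Lemma cycline_lonely mu g nu x : presents X mu g nu x -> (plen nu < plen mu)%N ->
  (forall y, is_ipath y -> irng y = psrc nu -> icat mu (iact X g y) = icat nu y) -> lonely x.
Proof.
move=> pr le cyc; have [[mp np mn] xp xn] := pr.
have fact y : is_ipath y -> irng y = psrc nu -> exists2 ka,
    [/\ is_path ka, psrc nu = prng ka & mu = pcat nu ka] &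
    irng (iact X g y) = psrc ka /\ y = icat ka (iact X g y).
  move=> yp yn; have pry : presents X mu g nu y by [].
  apply: (icat_prefix (ltnW le) np mp yp (iact_ipath X g yp) yn (presents_rng pry)).
  by rewrite cyc.
have [m [mp' nm muE] _] := fact _ xp xn.
apply: (contraction_lonely (m := m) (g := g)) => //.
  by move: le; rewrite muE plen_pcat; lia.
move=> y yp yx; have [m' [mp'' nm' muE'] hy] := fact y yp (etrans yx xn).
have [_ ->] : nu = nu /\ m = m' by apply: (pcat_inj _ nm nm') => //; rewrite -muE -muE'.
exact: hy.
Qed.

Lemma lonely_twist x : lonely x -> exists i h, iact X h (ishift i x) = ishift i x /\
  forall k : int, k <> 0 -> qshift k (qclass (irestr X h (ishift i x))) <>
    qclass (irestr X h (ishift i x)).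
Proof.
move=> lx; have [i [L [L0 per]]] := lonely_cycle lx; have ly := lonely_shift i lx.
have [|h hy tw] := cycle_twist ly L0 per hpf.
  move=> p p0 hp pmin; apply: hcyc => //.
    exact: lonely_is_cycle.
  exact: (lonely_no_entrance ly hsf).
by exists i, h.
Qed.

Lemma lonely_unit nu x : is_path nu -> lonely x -> irng x = psrc nu ->
  zbase [set qunit X (icat nu x)].
Proof.
move=> np [xp xu] xn; exists nu, 0, nu; split; first by split; rewrite ?act0.
have e : qunit X (icat nu x) = zelt X nu 0 nu x.
  apply: quadE => //=; rewrite ?iact0 ?subrr// -(qshift1 (plen nu)).
  by congr (qshift _ (qclass _)); apply/funext => n; rewrite irestr0.
apply/seteqP; split => [_ ->|_ [y [yp yn] <-]] /=; first by rewrite e; exists x.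
by rewrite e (xu y yp)// yn.
Qed.

Lemma conj_cls b c : qdeg b = 0 ->
  qcls ((b ** c) ** b^v) = qmul (qmul (qcls b) (qcls c)) (qshift (qdeg c) (qinv (qcls b))).
Proof. by move=> /= ->; rewrite oppr0 add0r !qshift0. Qed.

(** The conjugates of [c] by the multiples of an element with class [phi] differ by
    multiples of [phi] minus its shift by the degree of [c]; this difference is not
    eventually zero, and the integers have no torsion. *)
Lemma lonely_conj nu x c : is_path nu -> lonely x -> irng x = psrc nu -> D c ->
  qrng c = icat nu x -> qdeg c <> 0 ->
  infinite_set [set (b ** c) ** b^v | b in [set b | S b /\ s b = r c]].
Proof.
move=> np lx xn Dc cu degc finA.
have [i [h [hy tw]]] := lonely_twist lx; set y := ishift i x in hy tw.
have [yp yu] : lonely y by exact: lonely_shift.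
pose rho := pcat nu (iseg x 0 i).
have xp : is_ipath x by case: lx.
have kp := iseg_path 0 i xp; have nk : psrc nu = prng (iseg x 0 i) by rewrite -xn.
have rp : is_path rho by exact: pcat_path.
have yr : irng y = psrc rho.
  by rewrite psrc_pcat// psrc_iseg// /irng /y /ishift addn0.
have uE : icat rho y = icat nu x by rewrite icat_pcat icat_iseg.
have hny (n : nat) : iact X (n%:Z * h) y = y.
  elim: n => [|n ih]; first by rewrite mul0r iact0.
  by rewrite -addn1 PoszD mulrDl mul1r iactD// hy.
pose b (n : nat) := zelt X rho (n%:Z * h) rho y.
have Sb n : S (b n).
  have am : admissible X rho (n%:Z * h) rho by split => //; rewrite -yr -irng_iact// hny.
  exists rho, (n%:Z * h); split; last by exists y.
  split => // z zp zr; have -> : z = y by apply: yu => //; rewrite zr.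
  by rewrite hny.
pose phi := tshift (plen rho) (irestr X h y).
have bE n : qcls (b n) = qclass (fun p => n%:Z * phi p).
  rewrite /b /= qshiftE; congr qclass; apply/funext => p; rewrite /phi /tshift.
  by case: ifP => _; rewrite ?mulr0// irestr_mul.
have twphi k : k <> 0 -> qshift k (qclass phi) <> qclass phi.
  move=> k0; rewrite /phi -qshiftE qshiftD addrC -qshiftD => /qshift_inj.
  exact: tw.
pose conj (n : nat) := (b n ** c) ** (b n)^v.
have conj_inj : injective conj.
  have deg0 n : qdeg (b n) = 0 by rewrite /= subrr.
  move=> n m /(congr1 (@qcls _ _ )); rewrite /conj !conj_cls// !bE !qinvE !qshiftE.
  rewrite -(qreprK (qcls c)) !qmulE => /qclassP[N hN]; apply: contrapT => nm.
  apply: (twphi _ degc); apply/esym/qshiftP; exists N => p pN dp.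
  have := hN p pN; rewrite !tshiftE//.
  set u := phi p; set v := phi _ => e.
  have : (n%:Z - m%:Z) * (u - v) = 0 by move: e; lia.
  by move=> /eqP; rewrite mulf_eq0 => /orP[/eqP e0|/eqP e0]; lia.
apply: infinite_nat; rewrite -(_ : conj @^-1` [set (b ** c) ** b^v | b in [set b | S b /\ s b = r c]] = setT).
  by apply: finite_preimage finA => n m _ _; exact: conj_inj.
apply/seteqP; split => // n _; exists (b n) => //; split; first exact: Sb.
by apply/gsrcE; rewrite cu -uE.
Qed.

(** An interior isotropy arrow outside [S] comes from a cycline triple with prefixes of
    different lengths. The inverse triple is used when [mu] is the shorter prefix. *)
Lemma Ssym_conj a V : D a -> ~ S a -> zbase V -> V a -> (forall b, V b -> r b = s b) ->
  zbase [set r a] /\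
  infinite_set [set (b ** a) ** b^v | b in [set b | S b /\ s b = r a]].
Proof.
move=> Da Sa [mu [g [nu [am ->]]]] /(zcyl_presents am)[x pr aE] Viso.
have [[mp np mn] xp xn] := pr.
have cyc y : is_ipath y -> irng y = psrc nu -> icat mu (iact X g y) = icat nu y.
  move=> yp yn; have pry : presents X mu g nu y by [].
  by have [] := Viso _ (presents_zcyl pry).
have degn : plen mu != plen nu.
  apply/eqP => lmn; apply: Sa; apply/SsymP; exists (zcyl X mu g nu); first exact: zbaseI.
  split; first by rewrite aE; exact: presents_zcyl.
  by move=> b [y [yp yn] <-]; split => /=; [exact: cyc|rewrite lmn subrr].
have dega : qdeg a <> 0 by rewrite aE /=; move/eqP: degn; lia.
have rE : qrng a = icat nu x by rewrite aE /= cyc.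
have lx : lonely x.
  have [lt|] := ltnP (plen nu) (plen mu); first exact: cycline_lonely pr lt cyc.
  rewrite leq_eqVlt (negbTE degn) /= => lt; have pr' := presents_inv pr.
  have cyc' y : is_ipath y -> irng y = psrc mu -> icat nu (iact X (- g) y) = icat mu y.
    move=> yp ym; have [_ np' nm] : admissible X nu (- g) mu by case: pr'.
    rewrite -cyc ?iactNK//; first exact: iact_ipath.
    by apply: vtx_inj; rewrite irng_iact// ym nm.
  have := lonely_act X (- g) (cycline_lonely pr' lt cyc').
  by rewrite iactK.
have uE : r a = qunit X (icat nu x) by rewrite /= rE.
split; first by rewrite uE; exact: lonely_unit.
exact: lonely_conj np lx xn Da rE dega.
Qed.

Lemma Ssym_cartan : cartan_subgroupoid G zbase S.
Proof.
split.
- exact: Ssym_clopen.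
- move=> a Da; have rp := qrng_ipath Da; apply/SsymP.
  have pr := presents_unit X rp; have am : admissible X (vtx (irng (qrng a))) 0 (vtx (irng (qrng a))).
    by case: pr.
  exists (zcyl X (vtx (irng (qrng a))) 0 (vtx (irng (qrng a)))); first exact: zbaseI.
  split; first by have := presents_zcyl pr; rewrite -qunitE.
  by move=> b /(zcyl_presents am)[y [_ yp yr] ->]; split => /=; rewrite ?iact0// subrr.
- by move=> a /Ssym_iso0[ra _]; apply: quadE.
- move=> a b /Ssym_iso0[ra da] /Ssym_iso0[rb db] /grng_eq rab; apply: quadE => /=.
  + exact: rab.
  + by rewrite da db !qshift0 qmulC.
  + by rewrite da db.
  + by rewrite -ra -rb rab.
- exact: Ssym_normal.
- exact: Ssym_conj.
Qed.

End SymmetricSubgroupoid.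

Theorem theorem3 (R : realType) (E : graph) (X : self_similar E)
    (hsf : source_free E)
    (hpf : pseudo_free X)
    (hgr : forall (x : infword E) (g : int), is_ipath x ->
       generic X g x \/ rare X g x)
    (hcyc : forall (C : rawpath E) (p : nat),
       is_cycle C -> no_entrance C ->
       (0 < p)%N ->
       (exists2 v, on_cycle C v & act X p%:Z (vtx v) = vtx v) ->
       (forall q : nat, (0 < q)%N ->
          (exists2 v, on_cycle C v & act X q%:Z (vtx v) = vtx v) ->
          (p <= q)%N) ->
       restr X p%:Z C <> p%:Z /\ restr X p%:Z C <> - p%:Z) :
  Cartan (arrows (ssg_groupoid X))
    (Cred R (ssg_groupoid X))
    (Cred_sub R (ssg_groupoid X) (Ssym X)).
Proof.
exact: (Cartan_of_subgroupoid R (ssg_laws X) (ssg_ample hpf)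
  (Ssym_cartan hsf hpf hgr hcyc)).
Qed.
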